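(* Assume Setting A, that $\bar{\mathbf I}(\lambda^\circ)$ is positive definite, and that $E\|D_\lambda\log p_k^*(X_k;\lambda^\circ)\|^2<\infty$ and $E\|D^2_{\lambda\lambda}\log p_k^*(X_k;\lambda^\circ)\|<\infty$ for all $k$. Let $\hat\lambda^{(n)}=(\hat\theta^{(n)},\hat\gamma^{*(n)})$ be measurable estimators satisfying (N1) $n^{-1/2}D_\lambda\ell^{(n)}(\hat\lambda^{(n)})\to\mathbf 0$ in probability; (N2) $\hat\lambda^{(n)}\to\lambda^\circ$ in probability; (N3) $\frac1n\int_0^1\mathbf J^{(n)}(\lambda^\circ+t[\hat\lambda^{(n)}-\lambda^\circ])\,dt\to\bar{\mathbf I}(\lambda^\circ)$ in probability. Then, as $n\to\infty$, (a) $\sqrt n[\hat\lambda^{(n)}-\lambda^\circ]\to N\big(\mathbf 0,\ \bar{\mathbf I}^{-1}(\lambda^\circ)\bar{\boldsymbol\Sigma}(\lambda^\circ)\bar{\mathbf I}^{-1}(\lambda^\circ)\big)$ in distribution; (b) $\sqrt n[\hat\theta^{(n)}-\theta^\circ]\to N\big(\mathbf 0,\ [\bar{\mathbf I}^{-1}(\lambda^\circ)]_{\theta\theta}\big)$ in distribution, where $[\cdot]_{\theta\theta}$ is the upper-left $S\times S$ block.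
   Context: Setting A. Let $(\Omega_X,\mathcal B_X)$, $(\Omega_Y,\mathcal B_Y)$ be measurable spaces with a $\sigma$-finite measure $\nu_X$ on $\Omega_X$. Fix $K\ge1$, distinct $y_0,\dots,y_K\in\Omega_Y$, $S\ge1$, and for $\theta\in\mathbb R^S$ and $k=0,\dots,K$ measurable functions $x\mapsto\psi_\theta(x,y_k)$ on $\Omega_X$ with $\psi_\theta(x,y_0)=0$, such that $\theta\mapsto\psi_\theta(x,y_k)$ is three times continuously differentiable for every $x$. Let $\theta^\circ\in\mathbb R^S$ (true parameter) and for each $k$ let $f_k$ be an everywhere positive probability density on $\Omega_X$ w.r.t. $\nu_X$ of the form $\log f_k(x)=\beta(x)+\psi_{\theta^\circ}(x,y_k)-\varepsilon_k$ with a measurable $\beta$ and constants $\varepsilon_k$ (these are the conditional densities of $X$ given $Y=y_k$ under the association model with log-odds ratio $\psi_{\theta^\circ}$). $X_k$ denotes a random element with density $f_k$. Fix $\bar r_0,\dots,\bar r_K>0$ with $\sum_k\bar r_k=1$. On a common probability space let $(X_{ki})_{i\ge1}$, $k=0,\dots,K$, be independent i.i.d. sequences with $X_{ki}\sim X_k$; for $n$ in an increasing sequence with $n_k=\bar r_kn\in\mathbb N$ for all $k$, the sample is $\{X_{ki}:k=0,\dots,K,\ i\le n_k\}$. For $\lambda=(\theta,\gamma^* )\in\mathbb R^S\times\mathbb R^K$, $\gamma^*=(\gamma_1^*,\dots,\gamma_K^* )$, $\gamma_0^*:=0$, put $p_k^*(x;\lambda)=\exp(\gamma_k^*+\psi_\theta(x,y_k))/\sum_{l=0}^K\exp(\gamma_l^*+\psi_\theta(x,y_l))$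 and $\ell^{(n)}(\lambda)=\sum_{k=0}^K\sum_{i=1}^{n_k}\log p_k^*(X_{ki};\lambda)$. The true value is $\lambda^\circ=(\theta^\circ,\gamma^\circ)$ with $\gamma_k^\circ=\log\bar r_k-\varepsilon_k-\log\bar r_0+\varepsilon_0$, so that $p_k^*(x;\lambda^\circ)=\bar r_kf_k(x)/\sum_l\bar r_lf_l(x)$. $D_\lambda$ denotes the gradient in $\lambda$, $\mathbf J^{(n)}(\lambda)=-D^2_{\lambda\lambda}\ell^{(n)}(\lambda)$; $E$, $\mathrm{Cov}$, $P$ refer to the true distribution. Define $\bar{\mathbf I}(\lambda)=\sum_k\bar r_kE[-D^2_{\lambda\lambda}\log p_k^*(X_k;\lambda)]$, $\bar{\boldsymbol\Sigma}(\lambda)=\sum_k\bar r_k\mathrm{Cov}(D_\lambda\log p_k^*(X_k;\lambda))$, $\mathbf I(\lambda)=n\bar{\mathbf I}(\lambda)=E\mathbf J^{(n)}(\lambda)$, $\boldsymbol\Sigma(\lambda)=n\bar{\boldsymbol\Sigma}(\lambda)=\mathrm{Cov}(D_\lambda\ell^{(n)}(\lambda))$. *)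

(* Defs.v *)
From HB Require Import structures.
From mathcomp Require Import all_boot all_order all_algebra.
From mathcomp Require Import all_classical all_reals all_analysis.

Set Implicit Arguments.
Unset Strict Implicit.
Unset Printing Implicit Defensive.

Import Order.TTheory GRing.Theory Num.Theory.
Import numFieldNormedType.Exports.

Local Open Scope classical_set_scope.
Local Open Scope ring_scope.

Section Defs.
Variable R : realType.

Definition evec (p : nat) (j : 'I_p) : 'rV[R]_p := delta_mx 0 j.

Definition pderiv (p : nat) (j : 'I_p) (f : 'rV[R]_p -> R) : 'rV[R]_p -> R :=
  fun v => 'D_(evec j) f v.

Definition grad (p : nat) (f : 'rV[R]_p -> R) (v : 'rV[R]_p) : 'rV[R]_p :=
  \row_j pderiv j f v.

Definition hess (p : nat) (f : 'rV[R]_p -> R) (v : 'rV[R]_p) : 'M[R]_p :=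
  \matrix_(i, j) pderiv i (pderiv j f) v.

Definition C3 (p : nat) (f : 'rV[R]_p -> R) : Prop :=
  [/\ continuous f,
      forall i, (forall v, derivable f v (evec i)) /\ continuous (pderiv i f),
      forall i j, (forall v, derivable (pderiv j f) v (evec i)) /\
                  continuous (pderiv i (pderiv j f)) &
      forall i j l, (forall v, derivable (pderiv j (pderiv l f)) v (evec i)) /\
                    continuous (pderiv i (pderiv j (pderiv l f)))].

Definition posdef (p : nat) (A : 'M[R]_p) : Prop :=
  forall v : 'rV[R]_p, v != 0 -> 0 < (v *m A *m v^T) 0 0.

(** gamma_k of lambda = (theta, gammastar), with gamma_0 := 0 ; k >= 1 read from the last K coordinates *)
Definition gam (S K : nat) (lam : 'rV[R]_(S + K)) (k : 'I_K.+1) : R :=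
  match unlift ord0 k with
  | Some j => rsubmx lam 0 j
  | None => 0
  end.

Definition pstar (TX TY : Type) (S K : nat) (psi : 'rV[R]_S -> TX -> TY -> R)
    (y : 'I_K.+1 -> TY) (k : 'I_K.+1) (x : TX) (lam : 'rV[R]_(S + K)) : R :=
  expR (gam lam k + psi (lsubmx lam) x (y k)) /
  \sum_(l < K.+1) expR (gam lam l + psi (lsubmx lam) x (y l)).

Definition logpstar (TX TY : Type) (S K : nat) (psi : 'rV[R]_S -> TX -> TY -> R)
    (y : 'I_K.+1 -> TY) (k : 'I_K.+1) (x : TX) : 'rV[R]_(S + K) -> R :=
  fun lam => ln (pstar psi y k x lam).

Definition mutually_independent {dO dX : measure_display} {TO : measurableType dO}
    {TX : measurableType dX} (P : probability TO R) (I : eqType) (X : I -> TO -> TX) : Prop :=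
  forall (s : seq I), uniq s ->
  forall (A : I -> set TX), (forall j, measurable (A j)) ->
    P (\bigcap_(j in [set j | j \in s]) (X j @^-1` A j)) =
    (\prod_(j <- s) P (X j @^-1` A j))%E.

(** Convergence in (outer) probability of random matrices Z_n to a constant c *)
Definition cvg_in_prob {dO : measure_display} {TO : measurableType dO}
    (P : probability TO R) (a b : nat) (Z : nat -> TO -> 'M[R]_(a, b)) (c : 'M[R]_(a, b))
    : Prop :=
  forall e : R, 0 < e -> forall delta : R, 0 < delta ->
  \forall n \near \oo, exists A : set TO,
     [/\ measurable A, (P A <= delta%:E)%E & [set w | e <= `|Z n w - c|] `<=` A].

Definition normal_law (v : R) (B : set R) : \bar R :=
  if v == 0 then (\1_B (0 : R))%:E else normal_prob 0 (Num.sqrt v) B.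

Definition gaussian_vector {dW : measure_display} {TW : measurableType dW}
    (PW : probability TW R) (q : nat) (W : TW -> 'rV[R]_q) (V : 'M[R]_q) : Prop :=
  forall t : 'rV[R]_q, forall B : set R, measurable B ->
    PW ((fun w => (W w *m t^T) 0 0) @^-1` B) = normal_law ((t *m V *m t^T) 0 0) B.

Definition cvg_in_dist_normal {dO : measure_display} {TO : measurableType dO}
    (P : probability TO R) (q : nat) (Z : nat -> TO -> 'rV[R]_q) (V : 'M[R]_q) : Prop :=
  exists (dW : measure_display) (TW : measurableType dW) (PW : probability TW R)
         (W : TW -> 'rV[R]_q),
  [/\ forall i, measurable_fun setT (fun w => W w 0 i),
      gaussian_vector PW W V &
      forall g : 'rV[R]_q -> R, continuous g -> (exists M : R, forall v, `|g v| <= M) ->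
        (fun n => (\int[P]_w (g (Z n w))%:E)%E) @ \oo --> (\int[PW]_w (g (W w))%:E)%E].

End Defs.

(* Main.v *)
(** Expanding the score along the segment from [lam0] to the estimator gives
    [N^(-1/2) grad ell (lamhat) = U - Z *m M], where [U] is the normalised score at
    [lam0], [Z = sqrt N (lamhat - lam0)] and [M] is the averaged observed information.
    The left-hand side is negligible by (N1) and [M] converges to [I = Ibar lam0] by
    (N3), so that [Z] is close to [U I^(-1)] as soon as [U] is tight, and (a) follows
    from the central limit theorem for [U].  The convergence in law of [U] is obtained
    through cosine transforms: bounded continuous functions are approximated on boxes
    by trigonometric polynomials.

    For (b), the posterior weights [p_k = r_k f_k / sum_l r_l f_l] satisfy
    [sum_k p_k grad lp_k = 0] and its derivative, so that [I = sum_k r_k E_k (g_k^T g_k)]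
    with [g_k = grad lp_k]; as the coordinate of [g_k] along [gamma_j] is
    [(k == j) - p_j], the vector [r_j E_j g_j] is the image by [I] of the
    [gamma_j]-axis.  Hence [Sigma = I - sum_k r_k (E_k g_k)^T (E_k g_k) = I - I A I] with
    [A] supported on the [gamma]-block, and [I^(-1) Sigma I^(-1) = I^(-1) - A] has
    the same [theta]-block as [I^(-1)]. *)
Require Import Defs.
From HB Require Import structures.
From mathcomp Require Import all_boot all_order all_algebra.
From mathcomp Require Import all_classical all_reals all_analysis.
From mathcomp Require Import measurable_realfun ring lra.

Set Implicit Arguments.
Unset Strict Implicit.
Unset Printing Implicit Defensive.

Import Order.TTheory GRing.Theory Num.Theory.
Import numFieldNormedType.Exports.

Local Open Scope classical_set_scope.
Local Open Scope ring_scope.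

(** * Trigonometric approximation of bounded continuous functions *)

(** Characteristic functions are kept real: the means of [cos (dot v t + c)] over all [t] and all
    phases [c] carry both the real and the imaginary part, and the span of these functions is closed
    under products. An approximant of a bounded [g] must obey the bound of [g] on the whole space,
    since tightness controls only the mass outside a box; hence the choice of Bernstein averages of
    values of [g], in sines of the coordinates. The limit in [cvg_in_dist_normal] is existential and
    described by its projections, so a Gaussian vector with a possibly singular covariance has to be
    built and recognised from its transforms. Independence is given on preimages of measurable sets;
    the product formula is only applied to bounded functions (cosines and sines), and second moments
    enter through Taylor remainders under a single law. The score at [lam0] need not be centred
    inside each group: the group means cancel only in the total weighted by [rbar k]. Centring every
    group leaves the total unchanged and explains why its covariance is [Sigbar] and not [Ibar]. *)

Section dot.
Context {R : realType} {q : nat}.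
Implicit Types u v t : 'rV[R]_q.

Definition dot u v : R := (u *m v^T) 0 0.

Lemma dotE u v : dot u v = \sum_j u 0 j * v 0 j.
Proof. by rewrite /dot mxE; apply: eq_bigr => j _; rewrite mxE. Qed.

Lemma dotC u v : dot u v = dot v u.
Proof. by rewrite !dotE; apply: eq_bigr => j _; rewrite mulrC. Qed.

Lemma dotDl u v t : dot (u + v) t = dot u t + dot v t.
Proof. by rewrite /dot mulmxDl mxE. Qed.

Lemma dotDr u v t : dot t (u + v) = dot t u + dot t v.
Proof. by rewrite dotC dotDl !(dotC t). Qed.

Lemma dotZl a u v : dot (a *: u) v = a * dot u v.
Proof. by rewrite /dot -scalemxAl mxE. Qed.

Lemma dotZr a u v : dot v (a *: u) = a * dot v u.
Proof. by rewrite dotC dotZl dotC. Qed.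

Lemma dotNr u v : dot u (- v) = - dot u v.
Proof. by rewrite -scaleN1r dotZr mulN1r. Qed.

Lemma dot0r u : dot u 0 = 0.
Proof. by rewrite -(scale0r 0) dotZr mul0r. Qed.

Lemma dot_delta u j : dot u (delta_mx 0 j) = u 0 j.
Proof.
rewrite dotE (bigD1 j)//= mxE !eqxx mulr1 big1 ?addr0// => i /negPf ij.
by rewrite mxE ij andbF mulr0.
Qed.

Lemma mx_coord_le (m n : nat) (A : 'M[R]_(m, n)) i j : `|A i j| <= `|A|.
Proof.
rewrite [leRHS]/Num.norm /= mx_normrE; apply/bigmax_geP; right => /=.
by exists (i, j).
Qed.

Lemma mx_norm_le (m n : nat) (A : 'M[R]_(m, n)) (e : R) : 0 <= e ->
  (forall i j, `|A i j| <= e) -> `|A| <= e.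
Proof.
move=> e0 h; rewrite [leLHS]/Num.norm /= mx_normrE.
by apply/bigmax_leP; split => // -[i j] _ /=.
Qed.

End dot.

Section trigpoly.
Context {R : realType} {q : nat}.
Implicit Types f g : 'rV[R]_q -> R.

(** The phase [c] brings in the sines, so this is the real span of cosines and sines of linear
    forms; [t = 0] gives the constants. *)
Inductive trigpoly : ('rV[R]_q -> R) -> Prop :=
| trig_cos t c : trigpoly (fun v => cos (dot v t + c))
| trig_add f g : trigpoly f -> trigpoly g -> trigpoly (fun v => f v + g v)
| trig_scale a f : trigpoly f -> trigpoly (fun v => a * f v).

Lemma trig_cst a : trigpoly (cst a).
Proof.
suff -> : cst a = (fun v : 'rV[R]_q => a * cos (dot v 0 + 0)).
  exact/trig_scale/trig_cos.
by apply/funext => v; rewrite dot0r addr0 cos0 mulr1.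
Qed.

(** Product-to-sum formula: the two nested inductions use bilinearity to come down to a pair of
    cosines. *)
Lemma trig_mul f g : trigpoly f -> trigpoly g -> trigpoly (fun v => f v * g v).
Proof.
move=> tf; elim: tf g => {f} [t c|f f' _ IHf _ IHf'|a f _ IHf] g tg.
- elim: tg => {g} [t' c'|g g' _ IHg _ IHg'|a g _ IHg].
  + rewrite (_ : (fun v => _) = (fun v => 2^-1 * (cos (dot v (t + t') + (c + c')) +
      cos (dot v (t - t') + (c - c'))))).
      exact/trig_scale/trig_add/trig_cos/trig_cos.
    apply/funext => v; rewrite !dotDr dotNr.
    rewrite (_ : dot v t + dot v t' + (c + c') = (dot v t + c) + (dot v t' + c')); last by ring.
    rewrite (_ : dot v t - dot v t' + (c - c') = (dot v t + c) - (dot v t' + c')); last by ring.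
    by rewrite [cos (_ + _ + _)]cosD [cos (_ - _)]cosB; lra.
  + rewrite (_ : (fun v => _) = (fun v => cos (dot v t + c) * g v + cos (dot v t + c) * g' v)).
      exact: trig_add.
    by apply/funext => v; rewrite mulrDr.
  + rewrite (_ : (fun v => _) = (fun v => a * (cos (dot v t + c) * g v))).
      exact: trig_scale.
    by apply/funext => v; rewrite mulrCA.
- rewrite (_ : (fun v => _) = (fun v => f v * g v + f' v * g v)).
    by apply: trig_add; [exact: IHf|exact: IHf'].
  by apply/funext => v; rewrite mulrDl.
- rewrite (_ : (fun v => _) = (fun v => a * (f v * g v))).
    exact/trig_scale/IHf.
  by apply/funext => v; rewrite mulrA.
Qed.

(** The variable of the Bernstein averages: it sends the coordinate into [0, 1], injectively when
    |v_i| <= L, where the argument of the sine stays in [-1, 1]. *)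
Lemma trig_coord (L : R) i : trigpoly (fun v => 2^-1 * (1 + sin (L^-1 * v 0 i))).
Proof.
apply: trig_scale; apply: trig_add; first exact: trig_cst.
rewrite (_ : (fun v => _) =
  (fun v => cos (dot v (L^-1 *: delta_mx 0 i) + - (pi / 2)))).
  exact: trig_cos.
by apply/funext => v; rewrite dotZr dot_delta cosBpihalf.
Qed.

(* Bernstein operators, one Bernoulli step of size [h] at a time: each step on
   coordinate [i] averages [F] with weights [x i], [1 - x i]. *)
Fixpoint bern (h : R) (x : 'I_q -> R) (s : seq 'I_q) F (u : 'rV[R]_q) : R :=
  if s is i :: s' then
    x i * bern h x s' F (u + h *: delta_mx 0 i) + (1 - x i) * bern h x s' F u
  else F u.

Lemma bern_trig h (x : 'rV[R]_q -> 'I_q -> R) s F u :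
  (forall i, trigpoly (fun v => x v i)) ->
  trigpoly (fun v => bern h (x v) s F u).
Proof.
move=> tx; elim: s u => [|i s IH] u /=; first exact: trig_cst.
apply: trig_add; apply: trig_mul => //.
rewrite (_ : (fun v => _) = (fun v => 1 + (-1) * x v i)).
  by apply: trig_add; [exact: trig_cst|exact: trig_scale].
by apply/funext => v; rewrite mulN1r.
Qed.

Lemma bern_bounded h x s F u (M : R) : (forall i, 0 <= x i <= 1) ->
  (forall u, `|F u| <= M) -> `|bern h x s F u| <= M.
Proof.
move=> x01 FM; elim: s u => [|i s IH] u //=.
have /andP[x0 x1] := x01 i.
rewrite (le_trans (ler_normD _ _))// !normrM (ger0_norm x0).
rewrite (@ger0_norm _ (1 - x i)) ?subr_ge0//.
rewrite [leRHS](_ : M = x i * M + (1 - x i) * M); last by ring.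
by apply: lerD; apply: ler_wpM2l => //; rewrite subr_ge0.
Qed.

(** A quadratic majorant survives each step: averaging (u_i - m)^2 over a move of size [h] made with
    weight x_i gives (u_i + h x_i - m)^2 plus the variance h^2 x_i (1 - x_i) <= h^2. So each step
    shifts the centre by [- h * x i] and costs [C * h ^+ 2], as in the Chebyshev argument for
    Bernstein polynomials. *)
Lemma bern_approx h (x : 'I_q -> R) s (F : 'rV[R]_q -> R) (y a C : R) (sg : 'I_q -> R) (u : 'rV[R]_q) :
  0 <= C -> (forall i, 0 <= x i <= 1) ->
  (forall u, `|F u - y| <= a + C * \sum_j (u 0 j - sg j) ^+ 2) ->
  `|bern h x s F u - y| <= a + C * h ^+ 2 * (size s)%:R +
     C * \sum_j (u 0 j - (sg j - h * x j * (count_mem j s)%:R)) ^+ 2.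
Proof.
move=> C0 x01 HF; elim: s u => [|i s IH] u /=.
  rewrite mulr0 addr0; under eq_bigr do rewrite mulr0 subr0.
  exact: HF.
have /andP[x0 x1] := x01 i.
have x1' : 0 <= 1 - x i by rewrite subr_ge0.
set b1 := bern _ _ _ _ _; set b0 := bern _ _ _ _ u.
rewrite (_ : _ - y = x i * (b1 - y) + (1 - x i) * (b0 - y)); last by ring.
rewrite (le_trans (ler_normD _ _))// !normrM (ger0_norm x0) (ger0_norm x1').
apply: (le_trans (lerD (ler_wpM2l x0 (IH _)) (ler_wpM2l x1' (IH _)))).
set S1 := \sum_j _; set S0 := \sum_j _; set S2 := \sum_j _.
suff HS : x i * S1 + (1 - x i) * S0 <= S2 + h ^+ 2.
  rewrite -subr_ge0 in HS; have := mulr_ge0 C0 HS.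
  by rewrite -subr_ge0 -[(size s).+1]addn1 natrD; lra.
rewrite /S1 /S0 !mulr_sumr -big_split/=.
rewrite (_ : h ^+ 2 = \sum_j (if j == i then h ^+ 2 else 0)); last first.
  by rewrite -big_mkcond big_pred1_eq.
rewrite -big_split/=; apply: ler_sum => j _; rewrite !mxE eqxx/=.
have [->|ji] := eqVneq j i.
  rewrite natrD /= mulr1.
  set N := (count_mem _ _)%:R.
  rewrite -subr_ge0 [leRHS](_ : _ = h ^+ 2 * (1 - x i * (1 - x i))); last by ring.
  rewrite mulr_ge0 ?sqr_ge0// subr_ge0 mulr_ile1//; lra.
rewrite /= mulr0 !addr0.
by rewrite -mulrDl addrC subrK mul1r.
Qed.

End trigpoly.

Section uniform_cont.
Context {R : realType} {q : nat}.

Lemma unif_cont_box (g : 'rV[R]_q -> R) (L e : R) : continuous g -> 0 < e ->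
  exists2 d : R, 0 < d & forall u v : 'rV[R]_q, `|v| <= L -> `|u - v| < d ->
    `|g u - g v| < e.
Proof.
move=> cg e0.
have cB : compact [set v : 'rV[R]_q | `|v| <= L].
  apply: bounded_closed_compact.
    exists L; split; first exact: num_real.
    by move=> M LM v /= vL; exact: le_trans vL (ltW LM).
  apply: (@closed_comp _ _ (fun v : 'rV[R]_q => `|v|) [set x | x <= L]).
    by move=> x _; exact: norm_continuous.
  exact: closed_le.
(* Compactness in near-covering form: a radius that works near each point of the box, for all small
   positive values, works uniformly over the box. *)
have := (@compact_near_coveringP _ _).1 cB R (0^'+)
  (fun d v => forall u : 'rV[R]_q, `|u - v| < d -> `|g u - g v| < e) _.
case=> [v _|d /= d0 /(_ (d / 2))].
  have e20 : 0 < e / 2 by lra.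
  have /cvgr_dist_lt/(_ _ e20)/nbhs_ballP[d /= d0 dg] := cg v.
  exists (ball v (d / 2), [set x | 0 < x < d / 2]); first split => /=.
  - by apply: nbhsx_ballx; lra.
  - near=> x => /=; apply/andP; split; near: x; first exact: nbhs_right_gt.
    by apply: nbhs_right_lt; lra.
  move=> [w x]/= [wv /andP[x0 xd]] u uw.
  have wv' : `|v - w| < d / 2 by move: wv; rewrite -ball_normE.
  have h1 : `|g v - g w| < e / 2.
    by apply: dg; rewrite -ball_normE/=; lra.
  have h2 : `|g v - g u| < e / 2.
    apply: dg; rewrite -ball_normE/=.
    rewrite (_ : v - u = (v - w) - (u - w)); last by rewrite opprB addrA subrK.
    by apply: (le_lt_trans (ler_normB _ _)); lra.
  rewrite (_ : g u - g w = (g v - g w) - (g v - g u)); last by ring.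
  by apply: (le_lt_trans (ler_normB _ _)); lra.
rewrite /= sub0r normrN gtr0_norm; last by lra.
move=> h; exists (d / 2); first by lra.
move=> u v vL uv.
have d2 : d / 2 < d by lra.
by apply: (h d2 _ v vL u uv); lra.
Unshelve. all: by end_near.
Qed.

(** A clipped arcsine. It must be defined at every real [z], since Bernstein nodes fall outside the
    range of [sin] on [-1, 1]; there [b] is the nearest endpoint. The constant [cos 1] is the
    minimum of the derivative of [sin] on [-1, 1]. *)
Lemma sin_inv (z : R) : exists b : R, `|b| <= 1 /\
  forall a, `|a| <= 1 -> cos 1 * `|b - a| <= `|z - sin a|.
Proof.
have c1 := @cos1_gt0 R.
have cosge (c : R) : `|c| <= 1 -> cos 1 <= cos c.
  move=> c1'; rewrite -(cos_norm c).
  have [<-//|ne] := eqVneq `|c| 1.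
  apply: ltW; rewrite ltr_cos ?in_itv/= ?normr_ge0//; first by rewrite lt_neqAle ne.
  - by rewrite (le_trans c1')// (le_trans _ (@pi_ge2 R))// ler1n.
  - by rewrite ler01 (le_trans _ (@pi_ge2 R))// ler1n.
have key (b a : R) : `|b| <= 1 -> `|a| <= 1 -> b <= a -> cos 1 * (a - b) <= sin a - sin b.
  move=> b1 a1 ba.
  have [|c /itvP cab ->] := @MVT_segment R sin cos b a ba.
  - by apply: continuous_subspaceT => x; exact: continuous_sin.
  apply: ler_wpM2r; first by rewrite subr_ge0.
  apply: cosge; move: a1 b1; rewrite !ler_norml => /andP[? ?] /andP[? ?].
  have : b <= c by rewrite cab.
  have : c <= a by rewrite cab.
  by move=> ? ?; apply/andP; split; lra.
have n1 : `|-1 : R| <= 1 by rewrite normrN normr1.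
have p1 : `|1 : R| <= 1 by rewrite normr1.
have [zl|zl] := leP z (sin (-1)).
  exists (-1); split => // a a1.
  have a1' : -1 <= a by move: a1; rewrite ler_norml => /andP[].
  have := key _ _ n1 a1 a1'.
  rewrite distrC ger0_norm ?subr_ge0// distrC.
  by move=> h; rewrite (le_trans h)// (le_trans _ (ler_norm _))//; lra.
have [zr|zr] := leP (sin 1) z.
  exists 1; split => // a a1.
  have a1' : a <= 1 by move: a1; rewrite ler_norml => /andP[].
  have := key _ _ a1 p1 a1'.
  rewrite ger0_norm ?subr_ge0//.
  by move=> h; rewrite (le_trans h)// (le_trans _ (ler_norm _))//; lra.
have le11 : -1 <= 1 :> R by lra.
have [||b /itvP bi <-] := @IVT R sin (-1) 1 z le11.
- by apply: continuous_subspaceT => x; exact: continuous_sin.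
- rewrite minEle maxEle; case: ifPn => [_|/negP]; first by rewrite !ltW.
  by have := lt_trans zl zr; move=> /ltW.
have b1 : `|b| <= 1 by rewrite ler_norml !bi.
exists b; split=> // a a1.
have [ab|/ltW ba] := leP a b.
  rewrite ger0_norm ?subr_ge0// (le_trans (key _ _ a1 b1 ab))//.
  exact: ler_norm.
rewrite distrC ger0_norm ?subr_ge0// (le_trans (key _ _ b1 a1 ba))//.
by rewrite distrC ler_norm.
Qed.

End uniform_cont.

Section trig_approx.
Context {R : realType} {q : nat}.

Lemma count_flatten_nseq n (j : 'I_q) :
  count_mem j (flatten [seq nseq n i | i <- index_enum 'I_q]) = n.
Proof.
rewrite count_flatten sumnE !big_map (bigD1 j)//= count_nseq/= eqxx mul1n.
by rewrite big1 ?addn0// => i ij; rewrite count_nseq /= (negPf ij) mul0n.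
Qed.

Lemma size_flatten_nseq n : size (flatten [seq nseq n i | i <- index_enum 'I_q]) = (q * n)%N.
Proof.
rewrite size_flatten sumnE !big_map.
under eq_bigr do rewrite size_nseq.
by rewrite sum_nat_const card_ord.
Qed.

(** Weierstrass approximation after the change of variable v_i = L arcsin(2 x_i - 1). The global
    bound by [M] holds because the approximant is an average of values of [g]. *)
Theorem trig_approx (g : 'rV[R]_q -> R) (M L e : R) : continuous g ->
  (forall v, `|g v| <= M) -> 0 < L -> 0 < e ->
  exists h, [/\ trigpoly h, forall v, `|h v| <= M &
    forall v, `|v| <= L -> `|h v - g v| <= e].
Proof.
move=> cg gM L0 e0.
have M0 : 0 <= M := le_trans (normr_ge0 _) (gM 0).
have e20 : 0 < e / 2 by lra.
have [d d0 dg] := unif_cont_box L cg e20.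
have c1 := @cos1_gt0 R.
pose x (v : 'rV[R]_q) i := 2^-1 * (1 + sin (L^-1 * v 0 i)).
pose b (u : R) := projT1 (cid (sin_inv (2 * u - 1))).
have bP u : `|b u| <= 1 /\
    forall a, `|a| <= 1 -> cos 1 * `|b u - a| <= `|2 * u - 1 - sin a|.
  exact: projT2 (cid (sin_inv (2 * u - 1))).
(* [F] is [g] read in the variable [x v], extended to all arguments by the clipping in [b]. *)
pose F (u : 'rV[R]_q) := g (\row_j (L * b (u 0 j))).
(* If the pulled-back point is at distance at least [d] from [v], some coordinate satisfies |u_j - x
   v j| >= cos 1 * d / (2 L), and then [C] times its square is at least [2 * M], the trivial bound
   on the difference. *)
pose C := 2 * M * (2 * L / (cos 1 * d)) ^+ 2.
have C0 : 0 <= C by rewrite mulr_ge0 ?sqr_ge0// mulr_ge0.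
have x01 v i : 0 <= x v i <= 1.
  have := sin_geN1 (L^-1 * v 0 i); have := sin_le1 (L^-1 * v 0 i).
  by rewrite /x => ? ?; apply/andP; split; lra.
have FM u : `|F u| <= M by exact: gM.
have Fg v : `|v| <= L -> forall u, `|F u - g v| <= e / 2 + C * \sum_j (u 0 j - x v j) ^+ 2.
  move=> vL u; have S0 : 0 <= \sum_j (u 0 j - x v j) ^+ 2.
    by apply: sumr_ge0 => j _; exact: sqr_ge0.
  set w := \row_j (L * b (u 0 j)).
  have bd j : cos 1 * `|w 0 j - v 0 j| <= 2 * L * `|u 0 j - x v j|.
    have aL : `|L^-1 * v 0 j| <= 1.
      rewrite normrM gtr0_norm ?invr_gt0// mulrC ler_pdivrMr// mul1r.
      exact: le_trans (mx_coord_le _ _ _) vL.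
    have := (bP (u 0 j)).2 _ aL.
    rewrite mxE (_ : L * _ - v 0 j = L * (b (u 0 j) - L^-1 * v 0 j)); last first.
      by field; exact: lt0r_neq0.
    rewrite (_ : _ - sin _ = 2 * (u 0 j - x v j)); last by rewrite /x; field.
    rewrite !normrM (gtr0_norm L0) ger0_norm// => h.
    rewrite mulrCA [leRHS](_ : _ = L * (2 * `|u 0 j - x v j|)); last by ring.
    by rewrite ler_pM2l.
  have [wv|] := ltP `|w - v| d.
    apply: (le_trans (ltW (dg _ _ vL wv))).
    by rewrite lerDl mulr_ge0.
  move=> dw; have dw0 : `|w - v| != 0 by rewrite gt_eqF// (lt_le_trans d0).
  have [[i j] wvj] : exists ij : 'I_1 * 'I_q, `|w - v| = `|(w - v) ij.1 ij.2|.
    exact: (mx_norm_neq0 dw0).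
  rewrite /= ord1 !mxE in wvj.
  have := bd j; rewrite mxE -wvj => bdj.
  have h1 : 1 <= (2 * L / (cos 1 * d)) * `|u 0 j - x v j|.
    have cd : 0 < cos 1 * d by rewrite mulr_gt0.
    rewrite mulrAC ler_pdivlMr// mul1r (le_trans _ bdj)//.
    by rewrite ler_pM2l.
  have h2 : 1 <= (2 * L / (cos 1 * d)) ^+ 2 * \sum_j (u 0 j - x v j) ^+ 2.
    apply: (@le_trans _ _ ((2 * L / (cos 1 * d)) ^+ 2 * (u 0 j - x v j) ^+ 2)).
      by rewrite -[(u 0 j - _) ^+ 2]real_normK ?num_real// -exprMn exprn_ege1.
    rewrite ler_wpM2l ?sqr_ge0// (bigD1 j)//= lerDl.
    by apply: sumr_ge0 => k _; exact: sqr_ge0.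
  apply: (@le_trans _ _ (2 * M)).
    by rewrite (le_trans (ler_normB _ _))// mulr_natl mulr2n lerD.
  rewrite (@le_trans _ _ (C * \sum_j (u 0 j - x v j) ^+ 2))//; last by rewrite lerDr ltW.
  by rewrite /C -mulrA ler_peMr// mulr_ge0.
have [n0 n0P] : exists n : nat, C * q%:R / (e / 2) < n.+1%:R.
  exists (Num.truncn (C * q%:R / (e / 2))); exact: truncnS_gt.
set n := n0.+1 in n0P.
have n_gt0 : 0 < n%:R :> R by rewrite ltr0n.
(* Starting from 0, each coordinate makes [n] steps of size 1/n, so its mean is exactly [x v j] and
   the quadratic term of [bern_approx] vanishes; the remaining cost is C q / n. *)
pose s := flatten [seq nseq n i | i <- index_enum 'I_q].
exists (fun v => bern n%:R^-1 (x v) s F 0); split.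
- by apply: bern_trig => i; exact: trig_coord.
- by move=> v; exact: bern_bounded.
move=> v vL; have := bern_approx n%:R^-1 s 0 C0 (x01 v) (Fg v vL).
move=> /le_trans; apply.
rewrite [X in _ + C * X]big1 => [|j _]; last first.
  by rewrite count_flatten_nseq mxE mulrAC mulVf ?lt0r_neq0// mul1r subrr subr0 expr0n.
rewrite mulr0 addr0 size_flatten_nseq natrM.
rewrite (_ : C * _ * _ = C * q%:R / n%:R); last by field; exact: lt0r_neq0.
rewrite [leRHS](_ : e = e / 2 + e / 2); last by field.
rewrite lerD2l ler_pdivrMr// [leRHS]mulrC -ler_pdivrMr//.
exact: ltW.
Qed.

End trig_approx.

(** * Real-valued integrals *)

Section real_integral.
Import HBNNSimple.
Context {R : realType} {d : measure_display} {T : measurableType d}.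

Lemma Rint_dct (mu : {measure set T -> \bar R}) (f_ : nat -> T -> R) (f g : T -> R) :
  (forall n, measurable_fun setT (f_ n)) -> mu.-integrable setT (EFin \o g) ->
  (forall n x, `|f_ n x| <= g x) -> (forall x, f_ ^~ x @ \oo --> f x) ->
  (fun n => \int[mu]_x f_ n x) @ \oo --> \int[mu]_x f x.
Proof.
move=> mf ig fg ff.
have mf' : measurable_fun setT f by apply: (measurable_fun_cvg mf) => x _; exact: ff.
have [|||||intf _ h] := @dominated_convergence _ _ _ mu setT measurableT
    (fun n x => (f_ n x)%:E) (fun x => (f x)%:E) (EFin \o g).
- by move=> n; exact/measurable_EFinP.
- exact/measurable_EFinP.
- by apply: aeW => x _; apply: cvg_EFin; [exact: nearW|exact: ff].
- exact: ig.
- by apply: aeW => x n _; rewrite lee_fin.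
apply: fine_cvg; rewrite fineK//; exact: integrable_fin_num.
Qed.

Section finite.
Variable P : probability T R.

Lemma bint (f : T -> R) (M : R) : measurable_fun setT f -> (forall w, `|f w| <= M) ->
  P.-integrable setT (EFin \o f).
Proof.
move=> mf fM; apply: measurable_bounded_integrable => //.
  by rewrite [X in (X < _)%E](_ : _ = 1%E) ?ltry//; exact: probability_setT.
by exists M; split; [exact: num_real|move=> y /ltW My x _; exact: le_trans (fM x) My].
Qed.

Lemma Rint_cst (c : R) : \int[P]_x c = c.
Proof. rewrite Rintegral_cst// [X in fine X](_ : _ = 1%E) ?mulr1//.
exact: probability_setT. Qed.

Lemma Rint_indic (A : set T) : measurable A -> \int[P]_x \1_A x = fine (P A).
Proof. by move=> mA; rewrite /Rintegral integral_indic// setIT. Qed.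

Lemma Rint_bound (f : T -> R) (M : R) : measurable_fun setT f ->
  (forall w, `|f w| <= M) -> `|\int[P]_x f x| <= M.
Proof.
move=> mf fM; have intf := bint mf fM.
rewrite (le_trans (le_normr_Rintegral _ _))// -[leRHS]Rint_cst.
apply: le_Rintegral => //; first exact: integrable_norm.
apply: (@bint _ `|M|) => // w; exact: le_trans (ler_norm _).
Qed.

Lemma Rint_dist (f g : T -> R) (M e p : R) (A : set T) :
  measurable_fun setT f -> measurable_fun setT g ->
  (forall w, `|f w| <= M) -> (forall w, `|g w| <= M) ->
  measurable A -> (P A <= p%:E)%E -> 0 <= e ->
  (forall w, ~ A w -> `|f w - g w| <= e) ->
  `|\int[P]_x f x - \int[P]_x g x| <= e + 2 * M * p.
Proof.
move=> mf mg fM gM mA Ap e0 fg.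
have intf := bint mf fM; have intg := bint mg gM.
rewrite -RintegralB//.
have mfg : measurable_fun setT (fun x => f x - g x) by exact: measurable_funB.
have fg2 w : `|f w - g w| <= 2 * M.
  by rewrite (le_trans (ler_normB _ _))// mulr_natl mulr2n lerD.
have intfg := bint mfg fg2.
rewrite (le_trans (le_normr_Rintegral _ _))//.
have M0 (w : T) : 0 <= M := le_trans (normr_ge0 _) (fM w).
have intM : P.-integrable setT (EFin \o (fun x => e + 2 * M * \1_A x)).
  apply: (@bint _ (e + 2 * `|M|)) => [|w].
    by apply: measurable_funD => //; apply: measurable_funM => //.
  rewrite (le_trans (ler_normD _ _))// ger0_norm// lerD2l !normrM ger0_norm//.
  rewrite -[leRHS]mulr1 ler_wpM2l ?mulr_ge0// indicE.
  by case: (w \in A); rewrite ?normr1 ?normr0.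
apply: (@le_trans _ _ (\int[P]_x (e + 2 * M * \1_A x))).
  apply: le_Rintegral => //; first exact: (integrable_norm intfg).
  move=> w _; rewrite indicE; have [wA|wA] := boolP (w \in A).
    by rewrite mulr1 (le_trans (fg2 w))// lerDr.
  by rewrite mulr0 addr0 fg// => /mem_set; apply/negP.
rewrite RintegralD//; last 2 first.
- by apply: (@bint _ `|e|).
- apply: (@bint _ `|2 * M|); first by apply: measurable_funM.
  move=> w; rewrite normrM indicE; case: (w \in A); rewrite ?normr1 ?normr0 ?mulr1// mulr0.
  exact: normr_ge0.
rewrite Rint_cst lerD2l RintegralZl//; last first.
  apply: (@bint _ 1) => // w; rewrite indicE; case: (w \in A); rewrite ?normr1 ?normr0//.
rewrite Rint_indic//.
(* The sign of [M] is only known through a point of [T]; an empty [T] would contradict the total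
   mass 1. *)
have [w|T0] := pselect (exists w : T, True).
  rewrite ler_wpM2l//; first by case: w => w _; rewrite mulr_ge0// (M0 w).
  by rewrite -lee_fin fineK// fin_num_measure.
have -> : A = set0 by apply/seteqP; split => w // _; apply: T0; exists w.
have : (P setT = 0)%E.
  suff -> : [set: T] = set0 by rewrite measure0.
  by apply/seteqP; split => w // _; apply: T0; exists w.
by rewrite probability_setT => /eqP; rewrite onee_eq0.
Qed.

End finite.

(** The density is given through measures of sets, which settles simple functions; monotone
    convergence along [nnsfun_approx] does the rest. *)
Lemma ge0_int_density (mu nu : {measure set T -> \bar R}) (h : T -> R) :
  measurable_fun setT h -> (forall x, 0 <= h x) ->
  (forall A, measurable A -> nu A = \int[mu]_(x in A) (h x)%:E)%E ->
  forall g : T -> R, measurable_fun setT g -> (forall x, 0 <= g x) ->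
  (\int[nu]_x (g x)%:E = \int[mu]_x (g x * h x)%:E)%E.
Proof.
move=> mh h0 nuE g mg g0.
have mg' : measurable_fun setT (EFin \o g) by exact/measurable_EFinP.
pose s := nnsfun_approx measurableT mg'.
have s_nd x : {homo (fun n => s n x) : m n / (m <= n)%N >-> m <= n}.
  by move=> m n mn; exact/lefP/nd_nnsfun_approx.
have s_cvg x : (EFin \o s ^~ x) @ \oo --> (g x)%:E.
  by apply: (cvg_nnsfun_approx measurableT mg') => // y _; rewrite lee_fin.
have eqs n : (\int[nu]_x (s n x)%:E = \int[mu]_x (s n x * h x)%:E)%E.
  rewrite integralT_nnsfun sintegralE.
  transitivity (\int[mu]_x (\sum_(y \in range (s n))
      (y * (\1_(s n @^-1` [set y]) x * h x))%:E))%E.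
    rewrite ge0_integral_fsum//; last 2 first.
    - move=> y; apply/measurable_EFinP/measurable_funM => //.
      by apply: measurable_funM.
    - move=> y x _; rewrite lee_fin indicE; have [|] := boolP (x \in _).
        by rewrite inE/= => <-; rewrite mul1r mulr_ge0.
      by rewrite mul0r mulr0.
    apply: eq_fsbigr => y; rewrite inE => -[x0 _ <-].
    under eq_integral do rewrite EFinM.
    rewrite ge0_integralZl//; last 3 first.
    - by apply/measurable_EFinP/measurable_funM.
    - by move=> x _; rewrite lee_fin mulr_ge0.
    - by rewrite lee_fin.
    congr (_ * _)%E; rewrite nuE// [LHS]integral_mkcond; apply: eq_integral => x _.
    by rewrite patchE indicE; case: (x \in _); rewrite ?mul1r ?mul0r.
  apply: eq_integral => x _; rewrite fsumEFin//; congr EFin.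
  rewrite [in RHS](fimfunE (s n)) mulr_fsuml.
  by apply: eq_fsbigr => y _; rewrite mulrA.
have h1 : (\int[nu]_x (s n x)%:E @[n --> \oo] --> \int[nu]_x (g x)%:E)%E.
  rewrite (_ : (\int[nu]_x (g x)%:E)%E = (\int[nu]_x (limn (fun n => (s n x)%:E)))%E).
    apply: cvg_monotone_convergence => //.
    - by move=> n; exact/measurable_EFinP.
    - by move=> n x _; rewrite lee_fin.
    - by move=> x _ m n mn; rewrite lee_fin s_nd.
  apply: eq_integral => x _; apply/esym/cvg_lim => //; exact: s_cvg.
have h2 : (\int[mu]_x (s n x * h x)%:E @[n --> \oo] --> \int[mu]_x (g x * h x)%:E)%E.
  rewrite (_ : (\int[mu]_x (g x * h x)%:E)%E =
               (\int[mu]_x (limn (fun n => (s n x * h x)%:E)))%E).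
    apply: cvg_monotone_convergence => //.
    - by move=> n; apply/measurable_EFinP/measurable_funM.
    - by move=> n x _; rewrite lee_fin mulr_ge0.
    - by move=> x _ m n mn; rewrite lee_fin ler_wpM2r// s_nd.
  apply: eq_integral => x _; apply/esym/cvg_lim => //.
  rewrite EFinM; under eq_fun do rewrite EFinM.
  by apply: cvgeZr => //; exact: s_cvg.
rewrite -(cvg_lim _ h1)// -(cvg_lim _ h2)//; congr (lim (_ @ \oo)%classic).
exact/funext.
Qed.

Lemma int_density (mu nu : {measure set T -> \bar R}) (h : T -> R) :
  measurable_fun setT h -> (forall x, 0 <= h x) ->
  (forall A, measurable A -> nu A = \int[mu]_(x in A) (h x)%:E)%E ->
  forall g : T -> R, measurable_fun setT g ->
  mu.-integrable setT (fun x => (g x * h x)%:E) ->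
  nu.-integrable setT (EFin \o g) /\ \int[nu]_x g x = \int[mu]_x (g x * h x).
Proof.
move=> mh h0 nuE g mg intg.
have H := ge0_int_density mh h0 nuE.
have ing : nu.-integrable setT (EFin \o g).
  apply/integrableP; split; first exact/measurable_EFinP.
  move/integrableP : intg => [_]; apply: le_lt_trans.
  rewrite /= H//; last exact: measurableT_comp.
  by apply: ge0_le_integral => //=; try (apply/measurable_EFinP; do ?apply: measurable_funM => //;
    do ?apply: measurableT_comp => //; by apply: measurable_funM);
    move=> x _; rewrite ?abse_EFin lee_fin ?mulr_ge0// normrM (ger0_norm (h0 _)).
split => //; rewrite /Rintegral; congr fine.
rewrite integralE [RHS]integralE; congr (_ - _)%E.
- transitivity (\int[nu]_x (Num.max (g x) 0)%:E)%E.
    by apply: eq_integral => x _; rewrite funeposE/= EFin_max.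
  rewrite H//; last 2 first.
  - exact: measurable_maxr.
  - by move=> x; rewrite le_max lexx orbT.
  by apply: eq_integral => x _; rewrite funeposE/= -EFin_max maxr_pMl// mul0r.
- transitivity (\int[nu]_x (Num.max (- g x) 0)%:E)%E.
    by apply: eq_integral => x _; rewrite funenegE/= EFin_max.
  rewrite H//; last 2 first.
  - by apply: measurable_maxr => //; exact: measurableT_comp.
  - by move=> x; rewrite le_max lexx orbT.
  by apply: eq_integral => x _; rewrite funenegE/= -mulNr -EFin_max maxr_pMl// mul0r.
Qed.

End real_integral.

(** * Gaussian characteristic functions *)

Section gauss_char.
Context {R : realType}.
Notation mu := lebesgue_measure.
Implicit Types t c x : R.
Variable sg : R.
Hypothesis sg0 : sg != 0.

Let ph x : R := expR (- x ^+ 2 / (sg ^+ 2 *+ 2)).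

Let sg2 : 0 < sg ^+ 2. Proof. by rewrite exprn_even_gt0. Qed.

Let phE x : normal_pdf 0 sg x = normal_peak sg * ph x.
Proof.
by rewrite normal_pdfE// /normal_fun subr0.
Qed.

Let is_derive_ph x : is_derive x 1 ph (- x / sg ^+ 2 * ph x).
Proof.
have h : is_derive x 1 (fun y : R => - y ^+ 2 / (sg ^+ 2 *+ 2)) (- x / sg ^+ 2).
  by apply: is_derive_eq; rewrite /GRing.scale/= -mulr_natr; field.
by rewrite mulrC; exact: is_derive1_comp.
Qed.

Let ph_ge0 x : 0 <= ph x. Proof. exact: expR_ge0. Qed.

Let cont_ph : continuous ph.
Proof.
by move=> x; apply: differentiable_continuous; apply/derivable1_diffP; have [] := is_derive_ph x.
Qed.

Let meas_ph : measurable_fun setT ph.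
Proof. exact: continuous_measurable_fun. Qed.

Let int_ph s (k : R) : s != 0 -> mu.-integrable setT (EFin \o (fun x => k * normal_fun 0 s x)).
Proof.
move=> s0; have := integrable_normal_pdf (0 : R) s.
move/(integrableZl measurableT (k / normal_peak s)).
apply: eq_integrable => // x _ /=; rewrite normal_pdfE// -EFinM mulrA divfK//.
by rewrite gt_eqF// normal_peak_gt0.
Qed.

Let int_ph1 (k : R) : mu.-integrable setT (EFin \o (fun x => k * ph x)).
Proof.
have := @int_ph sg k sg0; apply: eq_integrable => // x _ /=.
by rewrite /normal_fun subr0.
Qed.

(** Half of the exponent absorbs [|x|]; the other half is the Gaussian of doubled variance, hence
    the scale [Num.sqrt 2 * sg]. With t = |x| / |sg| the absorption reads t <= 1 + t^2 / 4 <=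
    exp(t^2 / 4), from (t / 2 - 1)^2 >= 0. *)
Let int_xph : mu.-integrable setT (EFin \o (fun x => `|x| * ph x)).
Proof.
have s2 : Num.sqrt 2 * sg != 0 :> R by rewrite mulf_neq0// sqrtr_eq0 -ltNge.
have mxph : measurable_fun setT (fun x : R => `|x| * ph x).
  by apply: measurable_funM => //; exact: measurableT_comp.
apply: (le_integrable _ _ _ (int_ph `|sg| s2)) => //; first exact/measurable_EFinP.
move=> x _ /=; rewrite lee_fin [leRHS]ger0_norm ?mulr_ge0 ?normal_fun_ge0//.
rewrite [leLHS]ger0_norm ?mulr_ge0//.
rewrite /normal_fun subr0 exprMn sqr_sqrtr//.
rewrite (_ : ph x = expR (- (x ^+ 2 / (4 * sg ^+ 2))) *
    expR (- x ^+ 2 / (2 * sg ^+ 2 *+ 2))); last first.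
  rewrite /ph -expRD; congr expR.
  by rewrite -[sg ^+ 2 *+ 2]mulr_natr -[2 * sg ^+ 2 *+ 2]mulr_natr; field.
rewrite mulrA ler_wpM2r ?expR_ge0// expRN ler_pdivrMr ?expR_gt0//.
have asg : 0 < `|sg| by rewrite normr_gt0.
rewrite -ler_pdivrMl//.
apply: (@le_trans _ _ (1 + x ^+ 2 / (4 * sg ^+ 2))); last exact: expR_ge1Dx.
rewrite (_ : x ^+ 2 / _ = (`|sg|^-1 * `|x|) ^+ 2 / 4); last first.
  by rewrite exprMn exprVn !real_normK ?num_real//; field.
have : 0 <= (`|sg|^-1 * `|x| / 2 - 1) ^+ 2 by exact: sqr_ge0.
by nra.
Qed.

Let meas_cos_lin t c : measurable_fun setT (fun x => cos (t * x + c)).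
Proof.
apply: continuous_measurable_fun => x; apply: (@continuous_comp _ _ _ (fun x => t * x + c) cos).
  by apply: cvgD; [apply: cvgM; [exact: cvg_cst|exact: cvg_id]|exact: cvg_cst].
exact: continuous_cos.
Qed.

Let meas_sin_lin t c : measurable_fun setT (fun x => sin (t * x + c)).
Proof.
rewrite (_ : (fun x => _) = (fun x => cos (t * x + (c - pi / 2)))).
  exact: meas_cos_lin.
by apply/funext => x; rewrite addrA cosBpihalf.
Qed.

Let int_cos t c : mu.-integrable setT (EFin \o (fun x => cos (t * x + c) * ph x)).
Proof.
apply: (le_integrable _ _ _ (int_ph1 1)) => //.
  by apply/measurable_EFinP/measurable_funM => //; exact: meas_cos_lin.
move=> x _ /=; rewrite lee_fin mul1r normrM ler_piMl//; exact: cos_max.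
Qed.

Let int_xsin t c : mu.-integrable setT (EFin \o (fun x => x * sin (t * x + c) * ph x)).
Proof.
apply: (le_integrable _ _ _ int_xph) => //.
  apply/measurable_EFinP/measurable_funM => //; apply: measurable_funM => //.
  exact: meas_sin_lin.
move=> x _ /=; rewrite lee_fin !normrM normr_id ler_wpM2r// ler_piMr//; exact: sin_max.
Qed.

(** Integration by parts on the line: [k] is the derivative of sin(t x + c) * ph x, whose boundary
    terms at -(n+1) and n+1 vanish in the limit, while dominated convergence identifies the limit of
    the truncated integrals. *)
Let parts t c : \int[mu]_x (x * sin (t * x + c) * ph x) =
  sg ^+ 2 * (t * \int[mu]_x (cos (t * x + c) * ph x)).
Proof.
pose k x := t * (cos (t * x + c) * ph x) - (sg ^+ 2)^-1 * (x * sin (t * x + c) * ph x).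
have dH x : is_derive x 1 (fun x => sin (t * x + c) * ph x) (k x).
  have h1 : is_derive x 1 (fun y : R => t * y + c) t.
    apply: is_derive_eq; rewrite /GRing.scale/=; lra.
  have h2 : is_derive x 1 (fun y : R => sin (t * y + c)) (cos (t * x + c) * t).
    exact: (@is_derive1_comp _ sin).
  have h3 := is_derive_ph x.
  by apply: is_derive_eq; rewrite /GRing.scale/= /k; field.
have cH : continuous (fun x => sin (t * x + c) * ph x).
  set Hf := (fun x => _); move=> x.
  by apply: (@differentiable_continuous _ _ _ x Hf); apply/derivable1_diffP; have [] := dH x.
have intk : mu.-integrable setT (EFin \o k).
  have := integrableB measurableT (integrableZl measurableT t (int_cos t c))
    (integrableZl measurableT (sg ^+ 2)^-1 (int_xsin t c)).
  by apply: eq_integrable => // x _ /=; rewrite EFinB !EFinM.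
have ck : continuous k.
  have csin y : {for y, continuous (fun x => sin (t * x + c))}.
    apply: (@continuous_comp _ _ _ (fun x => t * x + c) sin); last exact: continuous_sin.
    by apply: cvgD; [apply: cvgM; [exact: cvg_cst|exact: cvg_id]|exact: cvg_cst].
  have ccos y : {for y, continuous (fun x => cos (t * x + c))}.
    apply: (@continuous_comp _ _ _ (fun x => t * x + c) cos); last exact: continuous_cos.
    by apply: cvgD; [apply: cvgM; [exact: cvg_cst|exact: cvg_id]|exact: cvg_cst].
  move=> x; apply: cvgB.
    by apply: cvgM; [exact: cvg_cst|apply: cvgM; [exact: ccos|exact: cont_ph]].
  apply: cvgM; first exact: cvg_cst.
  by apply: cvgM; [apply: cvgM; [exact: cvg_id|exact: csin]|exact: cont_ph].
suff : \int[mu]_x k x = 0.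
  have i1 : mu.-integrable setT (EFin \o (fun x => t * (cos (t * x + c) * ph x))).
    have := integrableZl measurableT t (int_cos t c).
    by apply: eq_integrable => // x _ /=; rewrite EFinM.
  have i2 : mu.-integrable setT
      (EFin \o (fun x => (sg ^+ 2)^-1 * (x * sin (t * x + c) * ph x))).
    have := integrableZl measurableT (sg ^+ 2)^-1 (int_xsin t c).
    by apply: eq_integrable => // x _ /=; rewrite EFinM.
  rewrite (RintegralB measurableT i1 i2) (RintegralZl _ measurableT (int_cos t c)).
  rewrite (RintegralZl _ measurableT (int_xsin t c)) => /eqP; rewrite subr_eq0 => /eqP ->.
  by rewrite mulrA mulfV ?mul1r// lt0r_neq0.
have h1 : (fun n : nat => \int[mu]_x (k x * \1_`[(- n.+1%:R)%R, n.+1%:R] x)) @ \oo --> \int[mu]_x k x.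
  apply: (@Rint_dct R _ (measurableTypeR R) mu
    (fun (n : nat) x => k x * \1_`[(- n.+1%:R)%R, n.+1%:R] x) k (fun x => `|k x|)).
  - move=> n; apply: measurable_funM => //; exact: continuous_measurable_fun.
  - exact: (integrable_norm intk).
  - move=> n x; rewrite normrM indicE; case: (_ \in _); rewrite ?normr1 ?normr0 ?mulr1 ?mulr0//.
  - move=> x; apply: cvg_near_cst; near=> n.
    rewrite indicE mem_set ?mulr1//= in_itv/= -ler_norml.
    near: n; exists (Num.truncn `|x|) => // n /= xn.
    by rewrite ltW// (lt_le_trans (truncnS_gt _))// ler_nat.
have h2 n : \int[mu]_x (k x * \1_`[(- n.+1%:R)%R, n.+1%:R] x) =
    sin (t * n.+1%:R + c) * ph n.+1%:R - sin (t * - n.+1%:R + c) * ph (- n.+1%:R).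
  have ltn : (- n.+1%:R)%R < n.+1%:R :> R by rewrite -subr_gt0 opprK addr_gt0 ?ltr0n.
  have := @continuous_FTC2 R k (fun x => sin (t * x + c) * ph x) _ _ ltn.
  rewrite /Rintegral => H; rewrite -[RHS]/(fine (_%:E - _%:E)%E) -H; last first.
  - by move=> x _; rewrite derive1E; apply: derive_val.
  - split; first by move=> x _; have [] := dH x.
    + exact/cvg_at_right_filter/cH.
    + exact/cvg_at_left_filter/cH.
  - exact: continuous_subspaceT.
  congr fine; rewrite [RHS]integral_mkcond; apply: eq_integral => x _.
  by rewrite patchE indicE; case: (_ \in _); rewrite ?mulr1 ?mulr0.
have h3 : (fun n : nat => \int[mu]_x (k x * \1_`[(- n.+1%:R)%R, n.+1%:R] x)) @ \oo --> 0.
  apply/cvgr0Pnorm_le => e e0; near=> n.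
  rewrite h2.
  have phN y : ph (- y) = ph y by rewrite /ph sqrrN.
  have bnd y a : `|sin a * ph y| <= ph y.
    by rewrite normrM (ger0_norm (ph_ge0 y)) ler_piMl// sin_max.
  rewrite (le_trans (ler_normB _ _))// (le_trans (lerD (bnd _ _) (bnd _ _)))// phN.
  suff : ph n.+1%:R <= 2^-1 * e by lra.
  rewrite /ph mulNr expRN invf_ple ?posrE ?expR_gt0 ?mulr_gt0 ?invr_gt0//.
  apply: (@le_trans _ _ (1 + n.+1%:R ^+ 2 / (sg ^+ 2 *+ 2))); last exact: expR_ge1Dx.
  apply: (@le_trans _ _ (n.+1%:R ^+ 2 / (sg ^+ 2 *+ 2))); last by rewrite lerDr.
  rewrite ler_pdivlMr ?mulrn_wgt0//.
  apply: (@le_trans _ _ n.+1%:R); last by rewrite expr2 ler_peMl// ler1n.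
  near: n; exists (Num.truncn ((2^-1 * e)^-1 * (sg ^+ 2 *+ 2))) => // n /= xn.
  by rewrite ltW// (lt_le_trans (truncnS_gt _))// ler_nat.
exact: (cvg_unique _ h1 h3).
Unshelve. all: by end_near.
Qed.

Let G c t := \int[mu]_x (cos (t * x + c) * ph x).

(** Differentiation under the integral on ]t - 1, t + 1[, dominated by [|x| * ph x]; [parts] then
    turns the derivative back into a multiple of [G c t], which gives a linear differential equation
    in [t]. *)
Let is_derive_G c t : is_derive t 1 (G c) (- (sg ^+ 2 * t) * G c t).
Proof.
have dc (s x : R) : is_derive s 1 (fun s => cos (s * x + c) * ph x)
    (- (x * sin (s * x + c) * ph x)).
  have h1 : is_derive s 1 (fun y : R => y * x + c) x.
    apply: is_derive_eq; rewrite /GRing.scale/=; lra.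
  have h2 : is_derive s 1 (fun y : R => cos (y * x + c)) (- sin (s * x + c) * x).
    exact: (@is_derive1_comp _ cos).
  apply: is_derive_eq; rewrite /GRing.scale/=; ring.
have dcE s x : partial1of2 (fun s x => cos (s * x + c) * ph x) s x =
    - (x * sin (s * x + c) * ph x).
  by rewrite partial1of2E; apply: derive_val.
have It : `](t - 1), (t + 1)[%classic t by rewrite /= in_itv/=; apply/andP; split; lra.
have H1 x : `](t - 1), (t + 1)[%classic x -> mu.-integrable setT
  (EFin \o (fun y => cos (x * y + c) * ph y)) by move=> _; exact: int_cos.
have H2 x y : `](t - 1), (t + 1)[%classic x -> [set: R] y ->
   derivable (fun s : R => cos (s * y + c) * ph y) x 1 by move=> _ _; have [] := dc x y.
have H3 y : 0 <= `|y| * ph y by rewrite mulr_ge0.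
have H4 (x y : R) : `](t - 1), (t + 1)[%classic x -> [set: R] y ->
    `|partial1of2 (fun s x => cos (s * x + c) * ph x) x y| <= `|y| * ph y.
  move=> _ _; rewrite dcE normrN !normrM (ger0_norm (ph_ge0 _)) ler_wpM2r//.
  by rewrite ler_piMr// sin_max.
have D1 := @derivable_under_integral R _ _ mu _ setT measurableT t _ _ It H1 H2 _ H3 int_xph H4.
have D2 := @differentiation_under_integral R _ _ mu _ setT measurableT t _ _ It H1 H2 _ H3 int_xph H4.
apply: DeriveDef; first exact: D1.
rewrite derive1E in D2; rewrite D2.
under eq_Rintegral do rewrite dcE.
rewrite (_ : - (sg ^+ 2 * t) * G c t = -1 * \int[mu]_x (x * sin (t * x + c) * ph x)); last first.
  by rewrite parts mulN1r mulNr mulrA.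
rewrite -(RintegralZl (-1) measurableT (int_xsin t c)).
by apply: eq_Rintegral => x _; rewrite mulN1r.
Qed.

(** The integrating factor exp(sg^2 s^2 / 2) makes the solution of the equation for [G c] constant;
    its value at 0 is [cos c], up to the normalisation of the density. *)
Lemma gauss_char t c :
  \int[normal_prob (0 : R) sg]_x cos (t * x + c) = expR (- (sg ^+ 2 * t ^+ 2) / 2) * cos c.
Proof.
have GE : \int[normal_prob (0 : R) sg]_x cos (t * x + c) = normal_peak sg * G c t.
  have [|_ ->] := @int_density R _ _ mu (normal_prob (0 : R) sg) (normal_pdf 0 sg)
    (measurable_normal_pdf 0 sg) (normal_pdf_ge0 0 sg) (fun A _ => erefl)
    (fun x => cos (t * x + c)) (meas_cos_lin t c).
    have := integrableZl measurableT (normal_peak sg) (int_cos t c).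
    by apply: eq_integrable => // x _ /=; rewrite phE -EFinM mulrCA.
  rewrite /G -RintegralZl//; apply: eq_Rintegral => x _.
  by rewrite phE mulrCA.
have G0 : normal_peak sg * G c 0 = cos c.
  have := integral_normal_pdf (0 : R) sg.
  under eq_integral do rewrite phE EFinM.
  rewrite integralZl//=; last first.
    by have := int_ph1 1; apply: eq_integrable => // x _; rewrite /= mul1r.
  move=> /(congr1 fine); rewrite fineM//; last first.
    apply: integrable_fin_num => //.
    by have := int_ph1 1; apply: eq_integrable => // x _; rewrite /= mul1r.
  rewrite /= -/(Rintegral mu setT ph) => e1.
  rewrite /G (_ : (fun x => _) = (fun x => cos c * ph x)); last first.
    by apply/funext => x; rewrite mul0r add0r.
  rewrite RintegralZl; first by rewrite mulrCA e1 mulr1.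
    exact: measurableT.
  by have := int_ph1 1; apply: eq_integrable => // x _; rewrite /= mul1r.
have dE (s : R) : is_derive s 1 (fun s : R => expR (sg ^+ 2 * s ^+ 2 / 2) * G c s) 0.
  have h1 : is_derive s 1 (fun s : R => sg ^+ 2 * s ^+ 2 / 2) (sg ^+ 2 * s).
    apply: is_derive_eq; rewrite /GRing.scale/=; lra.
  have h2 : is_derive s 1 (fun s : R => expR (sg ^+ 2 * s ^+ 2 / 2))
      (expR (sg ^+ 2 * s ^+ 2 / 2) * (sg ^+ 2 * s)).
    exact: (@is_derive1_comp _ expR).
  have h3 := is_derive_G c s.
  apply: is_derive_eq; rewrite /GRing.scale/=; ring.
have := is_derive_0_is_cst t 0 dE.
rewrite expr0n/= mulr0 mul0r expR0 mul1r => E.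
rewrite GE -G0 -E mulNr expRN mulrCA mulrA.
by rewrite mulrA mulrVK// unitfE gt_eqF// expR_gt0.
Qed.

End gauss_char.

(** * Taylor remainders of sine and cosine *)

Section taylor.
Context {R : realType}.
Implicit Types x : R.

Lemma norm_sin_le x : `|sin x| <= `|x|.
Proof.
wlog x0 : x / 0 <= x => [h|].
  have [|/ltW x0] := leP 0 x; first exact: h.
  by rewrite -normrN -sinN -[leRHS]normrN h// oppr_ge0.
have [|c _] := @MVT_segment R sin cos 0 x x0.
- by apply: continuous_subspaceT => y; exact: continuous_sin.
by rewrite sin0 !subr0 => ->; rewrite normrM ler_piMl// cos_max.
Qed.

Lemma cos_ge x : 1 - cos x <= x ^+ 2 / 2.
Proof.
have -> : cos x = 1 - 2 * sin (x / 2) ^+ 2.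
  rewrite {1}(_ : x = (x / 2) *+ 2); last by rewrite -mulr_natr; field.
  by rewrite cos_mulr2n sin2cos2 -mulr_natr; ring.
have := norm_sin_le (x / 2); rewrite -(@ler_pXn2r _ 2)// ?nnegrE//.
rewrite !real_normK ?num_real// => h; nra.
Qed.

Lemma cos_dist1 x : `|cos x - 1| <= x ^+ 2 / 2 /\ `|cos x - 1| <= 2.
Proof.
have := cos_ge x; have := cos_le1 x; have := cos_geN1 x => ? ? ?.
rewrite distrC ger0_norm; last by lra.
by split => //; lra.
Qed.

(** Two bounds for two purposes: the cubic one yields pointwise convergence of the rescaled
    remainder, the quadratic one a dominating function that is integrable under a second moment
    assumption. *)
Lemma sin_taylor x : `|sin x - x| <= `|x| * (x ^+ 2 / 2) /\ `|sin x - x| <= 2 * x ^+ 2.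
Proof.
wlog x0 : x / 0 <= x => [h|].
  have [|/ltW x0] := leP 0 x; first exact: h.
  have := h (- x); rewrite oppr_ge0 sinN sqrrN normrN -opprD normrN; exact.
have [|c cx] := @MVT_segment R (fun y => sin y - y) (fun y => cos y - 1) 0 x x0.
- apply: continuous_subspaceT => y; apply: cvgB; last exact: cvg_id.
  exact: continuous_sin.
have /andP[c0 cx'] : 0 <= c <= x by rewrite !(itvP cx).
have cx2 : c ^+ 2 <= x ^+ 2 by rewrite ler_pXn2r ?nnegrE.
rewrite sin0 !subr0 => ->; rewrite normrM.
have [h1 h2] := cos_dist1 c.
split; first by rewrite mulrC ler_wpM2l//; lra.
have h3 : `|cos c - 1| <= 2 * x.
  have [x1|x1] := leP x 1; first by rewrite (le_trans h1)//; nra.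
  by rewrite (le_trans h2)//; lra.
by rewrite (ger0_norm x0) expr2 mulrA ler_wpM2r.
Qed.

(** By the half-angle formula the remainder is 2 ((x/2)^2 - sin(x/2)^2); factoring the difference of
    squares leaves one factor to [sin_taylor]. *)
Lemma cos_taylor x : `|cos x - 1 + x ^+ 2 / 2| <= x ^+ 2 /\
  `|cos x - 1 + x ^+ 2 / 2| <= `|x| ^+ 3 * `|x|.
Proof.
have -> : cos x = 1 - 2 * sin (x / 2) ^+ 2.
  rewrite {1}(_ : x = (x / 2) *+ 2); last by rewrite -mulr_natr; field.
  by rewrite cos_mulr2n sin2cos2 -mulr_natr; ring.
have h := norm_sin_le (x / 2); have [h' _] := sin_taylor (x / 2).
have e : 1 - 2 * sin (x / 2) ^+ 2 - 1 + x ^+ 2 / 2 =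
    2 * ((x / 2) ^+ 2 - sin (x / 2) ^+ 2) by field.
have hs : sin (x / 2) ^+ 2 <= (x / 2) ^+ 2.
  by rewrite -(real_normK (num_real (sin _))) -(real_normK (num_real (x / 2))) ler_pXn2r ?nnegrE.
rewrite e ger0_norm; last by lra.
split; first by have := sqr_ge0 (sin (x / 2)); have := sqr_ge0 x; nra.
rewrite subr_sqr.
apply: (@le_trans _ _ (2 * (`|x / 2| * ((x / 2) ^+ 2 / 2) * (`|x / 2| + `|x / 2|)))).
  rewrite ler_wpM2l// (le_trans (ler_norm _))// normrM ler_pM// 1?distrC//.
  by rewrite (le_trans (ler_normD _ _))// lerD.
rewrite normrM (@ger0_norm _ 2^-1)//.
have -> : (x / 2) ^+ 2 = `|x| ^+ 2 / 4 by rewrite real_normK ?num_real//; field.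
have := normr_ge0 x; set a := `|x| => a0.
have : 0 <= a ^+ 4 by exact: exprn_ge0.
by rewrite -subr_ge0 -[in X in _ -> X]subr_ge0; nra.
Qed.

End taylor.

(** * Levy's continuity theorem *)

Lemma meas_cont {R : realType} {d : measure_display} {T : measurableType d} (h : R -> R)
    (Y : T -> R) :
  continuous h -> measurable_fun setT Y -> measurable_fun setT (fun w => h (Y w)).
Proof. by move=> ch; exact: measurableT_comp (continuous_measurable_fun ch). Qed.

Lemma meas_cos {R : realType} {d : measure_display} {T : measurableType d} (Y : T -> R) :
  measurable_fun setT Y -> measurable_fun setT (fun w => cos (Y w)).
Proof. exact/meas_cont/continuous_cos. Qed.

(** * Measurability of functions of a random vector *)

Section measurable_vector.
Context {R : realType} {d : measure_display} {T : measurableType d} {q : nat}.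
Implicit Types Z : T -> 'rV[R]_q.

Definition mcoord Z := forall i, measurable_fun setT (fun w => Z w 0 i).

Lemma meas_dot Z t : mcoord Z -> measurable_fun setT (fun w => dot (Z w) t).
Proof.
move=> mZ; under eq_fun do rewrite dotE.
by apply: measurable_sum => j; apply: measurable_funM.
Qed.

Lemma meas_cos_dot Z t c : mcoord Z -> measurable_fun setT (fun w => cos (dot (Z w) t + c)).
Proof.
by move=> mZ; apply: meas_cos; apply: measurable_funD => //; exact: meas_dot.
Qed.

Lemma meas_trig Z h : mcoord Z -> trigpoly h -> measurable_fun setT (fun w => h (Z w)).
Proof.
move=> mZ; elim => [t c|f g _ mf _ mg|a f _ mf].
- exact: meas_cos_dot.
- exact: measurable_funD.
- exact: measurable_funM.
Qed.

(** [mcoord] gives measurability coordinate by coordinate, which passes to trigonometric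
    polynomials; [g] is their pointwise limit, with box n+1 and error 1/(n+1). *)
Lemma meas_bcont Z (g : 'rV[R]_q -> R) M : mcoord Z -> continuous g ->
  (forall v, `|g v| <= M) -> measurable_fun setT (fun w => g (Z w)).
Proof.
move=> mZ cg gM.
have n0 n : (0 : R) < n.+1%:R by rewrite ltr0n.
have n1 n : (0 : R) < n.+1%:R^-1 by rewrite invr_gt0.
pose h n := projT1 (cid (trig_approx cg gM (n0 n) (n1 n))).
have hP n : [/\ trigpoly (h n), forall v, `|h n v| <= M &
    forall v, `|v| <= n.+1%:R -> `|h n v - g v| <= n.+1%:R^-1].
  exact: projT2 (cid (trig_approx cg gM (n0 n) (n1 n))).
apply: (@measurable_fun_cvg _ _ _ _ (fun n w => h n (Z w))).
  by move=> n; have [th _ _] := hP n; exact: meas_trig.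
move=> w _; apply/cvgrPdist_le => e e0; near=> n.
have [_ _ hn] := hP n; rewrite distrC (le_trans (hn _ _))//.
- near: n; exists (Num.truncn `|Z w|) => // n /= xn.
  by rewrite ltW// (lt_le_trans (truncnS_gt _))// ler_nat.
- rewrite invf_ple ?posrE//; near: n; exists (Num.truncn e^-1) => // n /= xn.
  by rewrite ltW// (lt_le_trans (truncnS_gt _))// ler_nat.
Unshelve. all: by end_near.
Qed.

End measurable_vector.

Lemma trig_bounded {R : realType} {q} (h : 'rV[R]_q -> R) : trigpoly h ->
  exists M, forall v, `|h v| <= M.
Proof.
elim => [t c|f g _ [M HM] _ [N HN]|a f _ [M HM]].
- by exists 1 => v; exact: cos_max.
- by exists (M + N) => v; rewrite (le_trans (ler_normD _ _))// lerD.
- by exists (`|a| * M) => v; rewrite normrM ler_wpM2l.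
Qed.

(** * Product of two probabilities and Fubini for bounded functions *)

Section product.
Context {R : realType} {d1 d2 : measure_display} {T1 : measurableType d1}
  {T2 : measurableType d2} (P1 : probability T1 R) (P2 : probability T2 R).

Let prodT : ((P1 \x P2) setT = 1)%E.
Proof.
rewrite -setXTT product_measure1E// -[RHS]mule1; congr (_ * _)%E; exact: probability_setT.
Qed.

Definition prod_prob : set (T1 * T2) -> \bar R := (P1 \x P2)%E.

HB.instance Definition _ := Measure.on prod_prob.

HB.instance Definition _ := @Measure_isProbability.Build _ _ _ prod_prob prodT.

Variables (f : T1 * T2 -> R) (M : R).
Hypotheses (mf : measurable_fun setT f) (fM : forall z, `|f z| <= M).

Let intf : (P1 \x P2)%E.-integrable setT (EFin \o f).
Proof. exact: (@bint _ _ _ prod_prob f M). Qed.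

Let E1 : (\int[P1]_x \int[P2]_y (f (x, y))%:E)%E = (\int[P1]_x (\int[P2]_y f (x, y))%:E)%E.
Proof.
apply: eq_integral => x _; rewrite /Rintegral fineK//; apply: integrable_fin_num => //.
by apply: (@bint _ _ _ _ _ M) => //; exact: measurable_fun_pair2.
Qed.

Let E2 : (\int[P2]_y \int[P1]_x (f (x, y))%:E)%E = (\int[P2]_y (\int[P1]_x f (x, y))%:E)%E.
Proof.
apply: eq_integral => x _; rewrite /Rintegral fineK//; apply: integrable_fin_num => //.
by apply: (@bint _ _ _ _ _ M) => //; exact: measurable_fun_pair1.
Qed.

Lemma Rint_prod : \int[prod_prob]_z f z = \int[P1]_x \int[P2]_y f (x, y).
Proof.
rewrite [RHS]/Rintegral -E1; congr fine.
by rewrite -[LHS](integral12_prod_meas1 intf).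
Qed.

Lemma Rint_swap : \int[P1]_x \int[P2]_y f (x, y) = \int[P2]_y \int[P1]_x f (x, y).
Proof. by rewrite [LHS]/Rintegral [RHS]/Rintegral -E1 -E2; congr fine; exact: (Fubini intf). Qed.

Lemma meas_Rint : measurable_fun setT (fun x => \int[P2]_y f (x, y)).
Proof.
have := measurable_fubini_F intf.
move=> h; apply/measurable_EFinP; apply: eq_measurable_fun h => x _.
rewrite /fubini_F/= /Rintegral fineK//; apply: integrable_fin_num => //.
by apply: (@bint _ _ _ _ _ M) => //; exact: measurable_fun_pair2.
Qed.

End product.

(** * Tightness from cosine transforms *)

Section tight.
Context {R : realType}.

Lemma prob_bigsetU {d} {T : measurableType d} (P : probability T R) (I : Type) (s : seq I)
    (A : I -> set T) : (forall i, measurable (A i)) ->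
  (P (\big[setU/set0]_(i <- s) A i) <= \sum_(i <- s) P (A i))%E.
Proof.
move=> mA; elim: s => [|i s IH]; first by rewrite !big_nil measure0.
rewrite !big_cons (le_trans (measureU2 _ _ _))//; first exact: bigsetU_measurable.
by rewrite leeD2l.
Qed.

(* [1 - E exp (- (u Y)^2 / 2)], the mean of [1 - E cos (u s Y)] over a standard
   normal [s], controls the tails of [Y]. *)
Lemma gauss_tail {d} {T : measurableType d} (P : probability T R) (Y : T -> R) (u : R) :
  measurable_fun setT Y ->
  \int[P]_w expR (- (u * Y w) ^+ 2 / 2) =
  \int[normal_prob (0 : R) 1]_s \int[P]_w cos (s * u * Y w).
Proof.
move=> mY.
rewrite -(@Rint_swap _ _ _ _ _ _ _ (fun z : T * measurableTypeR R => cos (z.2 * u * Y z.1)) 1); last 2 first.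
- apply: meas_cos; apply: measurable_funM; last exact: measurableT_comp.
  by apply: measurable_funM => //; exact: measurable_snd.
- by move=> z; exact: cos_max.
apply: eq_Rintegral => w _.
have := gauss_char (oner_neq0 R) (u * Y w) 0; rewrite cos0 mulr1 expr1n mul1r => <-; apply: eq_Rintegral => s _ /=.
by congr cos; rewrite addr0; ring.
Qed.

(** Markov's inequality: where |u Y| >= 2, the variable 1 - exp(-(u Y)^2 / 2) is at least 1/2,
    because exp 2 >= 1 + 2. *)
Lemma tail_le {d} {T : measurableType d} (P : probability T R) (Y : T -> R) (u : R) :
  measurable_fun setT Y -> 0 < u ->
  (P [set w | 2 / u <= `|Y w|]%R <=
    (2 * (1 - \int[P]_w expR (- (u * Y w) ^+ 2 / 2)))%:E)%E.
Proof.
move=> mY u0; set A := [set w | _].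
have mA : measurable A.
  have mN : measurable_fun setT (fun w => `|Y w|) by exact: measurableT_comp.
  have := mN measurableT _ (measurable_itv `[2 / u, +oo[); rewrite setTI.
  by congr measurable; apply/seteqP; split => w /=; rewrite in_itv/= andbT.
have mE : measurable_fun setT (fun w => expR (- (u * Y w) ^+ 2 / 2)).
  apply: measurableT_comp => //; apply: measurable_funM => //.
  apply: measurableT_comp => //; apply: measurable_funX.
  exact: measurable_funM.
have E1 w : 0 <= expR (- (u * Y w) ^+ 2 / 2) <= 1.
  rewrite expR_ge0 -expR0 ler_expR mulNr oppr_le0.
  by rewrite mulr_ge0 ?sqr_ge0.
have iE : P.-integrable setT (EFin \o (fun w => expR (- (u * Y w) ^+ 2 / 2))).
  by apply: (@bint _ _ _ _ _ 1) => // w; have /andP[? ?] := E1 w; rewrite ger0_norm.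
have i1 : P.-integrable setT (EFin \o (cst (1 : R))).
  by apply: (@bint _ _ _ _ _ 1) => // w; rewrite normr1.
have iA : P.-integrable setT (EFin \o (\1_A : T -> R)).
  by apply: (@bint _ _ _ _ _ 1) => // w; rewrite indicE; case: (_ \in _); rewrite ?normr0 ?normr1.
rewrite -[leLHS]fineK ?fin_num_measure// lee_fin -Rint_indic// -{2}(Rint_cst P 1).
rewrite -RintegralB// -RintegralZl//; last first.
  by have := integrableB measurableT i1 iE; apply: eq_integrable => // w _; rewrite /= EFinB.
apply: le_Rintegral => //.
  have := integrableZl measurableT 2 (integrableB measurableT i1 iE).
  by apply: eq_integrable => // w _; rewrite /= EFinM EFinB.
move=> w _; have /andP[e0 e1] := E1 w; rewrite indicE.
have [|_] := boolP (w \in A); last by rewrite mulr_ge0// subr_ge0.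
rewrite inE /A/= => Aw; rewrite mulr1n.
suff : expR (- (u * Y w) ^+ 2 / 2) <= 2^-1 by move=> h; lra.
have uY : 2 <= `|u * Y w| by rewrite normrM (gtr0_norm u0) mulrC -ler_pdivrMr.
have uY2 : 4 <= (u * Y w) ^+ 2.
  by rewrite -(real_normK (num_real (u * Y w))); nra.
rewrite mulNr expRN lef_pV2 ?posrE ?expR_gt0//.
by apply: (le_trans _ (expR_ge1Dx _)); lra.
Qed.

(** A small [u] makes the mean of exp(-(u V)^2 / 2) close to 1 for the limit variable. By
    [gauss_tail] this mean is a Gaussian average of cosine transforms, so it passes to [Y n] by
    dominated convergence. The two errors e/4 and the factor 2 of [tail_le] add up to [e]. *)
Lemma tight_cf {d dW} {T : measurableType d} {TW : measurableType dW}
    (P : probability T R) (PW : probability TW R) (Y : nat -> T -> R) (V : TW -> R) :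
  (forall n, measurable_fun setT (Y n)) -> measurable_fun setT V ->
  (forall s : R, (fun n => \int[P]_w cos (s * Y n w)) @ \oo --> \int[PW]_w cos (s * V w)) ->
  forall e : R, 0 < e -> exists2 L : R, 0 < L &
    \forall n \near \oo, (P [set w | L <= `|Y n w|]%R <= e%:E)%E.
Proof.
move=> mY mV cf e e0.
have h1 : (fun n : nat => \int[PW]_w expR (- (n.+1%:R^-1 * V w) ^+ 2 / 2)) @ \oo --> (1 : R).
  rewrite -[X in _ --> X](Rint_cst PW).
  apply: (@Rint_dct _ _ _ PW _ (cst 1) (cst 1)).
  - move=> n; apply: measurableT_comp => //; apply: measurable_funM => //.
    apply: measurableT_comp => //; apply: measurable_funX.
    exact: measurable_funM.
  - by apply: (@bint _ _ _ _ _ 1) => // w; rewrite normr1.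
  - move=> n w /=; rewrite ger0_norm ?expR_ge0// -expR0 ler_expR mulNr oppr_le0.
    by rewrite mulr_ge0 ?sqr_ge0.
  - move=> w; rewrite -[X in _ --> X](expR0 R).
    apply: (@cvg_comp _ _ _ (fun n : nat => - (n.+1%:R^-1 * V w) ^+ 2 / 2) expR _ (nbhs (0 : R)));
      last exact: continuous_expR.
    have : (fun n : nat => - (n.+1%:R^-1 * V w) ^+ 2 / 2) @ \oo --> - (0 * V w) ^+ 2 / 2.
      under eq_fun do rewrite expr2.
      rewrite expr2; apply: cvgMl; apply: cvgN.
      by apply: cvgM; apply: cvgMl; exact: cvg_harmonic.
    by rewrite mul0r expr0n/= oppr0 mul0r.
have e4 : 0 < e / 4 by lra.
have /cvgrPdist_le/(_ _ e4)[N _ /(_ N (leqnn N))/= hN] := h1.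
set u := N.+1%:R^-1 in hN.
have u0 : 0 < u by rewrite invr_gt0.
exists (2 / u); first by rewrite divr_gt0.
have h2 : (fun n => \int[P]_w expR (- (u * Y n w) ^+ 2 / 2)) @ \oo -->
    \int[PW]_w expR (- (u * V w) ^+ 2 / 2).
  rewrite gauss_tail//; under eq_fun do rewrite gauss_tail//.
  apply: (@Rint_dct _ _ (measurableTypeR R) (normal_prob (0 : R) 1)
    (fun n s => \int[P]_w cos (s * u * Y n w)) _ (cst 1)).
  - move=> n.
    apply: (@meas_Rint _ _ _ _ _ (normal_prob (0 : R) 1) P (fun z : measurableTypeR R * T => cos (z.1 * u * Y n z.2)) 1).
      apply: meas_cos; apply: measurable_funM; last exact: measurableT_comp.
      by apply: measurable_funM => //; exact: measurable_fst.
    by move=> z; exact: cos_max.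
  - by apply: (@bint _ _ _ _ _ 1) => // w; rewrite normr1.
  - by move=> n s /=; apply: Rint_bound => [|w]; [apply: meas_cos; exact: measurable_funM|exact: cos_max].
  - by move=> s; exact: cf.
have /cvgrPdist_le/(_ _ e4) := h2; apply: filterS => n hn.
rewrite (le_trans (tail_le _ (mY n) u0))// lee_fin.
move: hN hn; rewrite !ler_norml => /andP[? ?] /andP[? ?]; lra.
Qed.

End tight.

Section levy.
Context {R : realType} {q : nat} {d dW : measure_display} {T : measurableType d}
  {TW : measurableType dW} (P : probability T R) (PW : probability TW R).
Variables (Z : nat -> T -> 'rV[R]_q) (W : TW -> 'rV[R]_q).
Hypotheses (mZ : forall n, mcoord (Z n)) (mW : mcoord W).
Hypothesis cf : forall t c, (fun n => \int[P]_w cos (dot (Z n w) t + c)) @ \oo -->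
  \int[PW]_w cos (dot (W w) t + c).

Lemma trig_cvg h : trigpoly h ->
  (fun n => \int[P]_w h (Z n w)) @ \oo --> \int[PW]_w h (W w).
Proof.
have int d' (T' : measurableType d') (Q : probability T' R) (Y : T' -> 'rV[R]_q) g :
    mcoord Y -> trigpoly g -> Q.-integrable setT (EFin \o (fun w => g (Y w))).
  move=> mY tg; have [M gM] := trig_bounded tg.
  by apply: (@bint _ _ _ _ _ M) => //; exact: meas_trig.
elim => [//|f g tf IHf tg IHg|a f tf IHf].
- rewrite RintegralD//; [|exact: int..].
  rewrite (_ : (fun n => _) = (fun n => \int[P]_w f (Z n w) + \int[P]_w g (Z n w))).
    exact: cvgD.
  by apply/funext => n; rewrite RintegralD//; exact: int.
- rewrite RintegralZl//; last exact: int.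
  rewrite (_ : (fun n => _) = (fun n => a * \int[P]_w f (Z n w))).
    exact: cvgMr.
  by apply/funext => n; rewrite RintegralZl//; exact: int.
Qed.

Lemma tight_vec (e : R) : 0 < e -> exists2 L : R, 0 < L & \forall n \near \oo,
  exists A, [/\ measurable A, (P A <= e%:E)%E & forall w, ~ A w -> `|Z n w| <= L].
Proof.
(* A union bound over the coordinates; [q.+1], like the [1 +] in the radius below, covers the case q
   = 0. *)
move=> e0; have e1 : 0 < e / q.+1%:R by rewrite divr_gt0.
have h j : {L : R | 0 < L /\ \forall n \near \oo,
    (P [set w | L <= `|Z n w 0 j|]%R <= (e / q.+1%:R)%:E)%E}.
  apply: cid; have [|||L L0 hL] := @tight_cf R _ _ _ _ P PW (fun n w => Z n w 0 j)
    (fun w => W w 0 j) _ _ _ _ e1; last by exists L.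
  - by move=> n; exact: mZ.
  - exact: mW.
  - move=> s; have := @cf (s *: delta_mx 0 j) 0.
    under eq_fun => n.
      under eq_Rintegral => w _ do rewrite dotZr dot_delta addr0.
      over.
    by under [X in _ --> X]eq_Rintegral => w _ do rewrite dotZr dot_delta addr0.
pose L j := projT1 (h j).
exists (1 + \sum_j L j); first by rewrite ltr_pwDl// sumr_ge0// => j _; have [/ltW] := projT2 (h j).
have H : \forall n \near \oo, forall j, (P [set w | L j <= `|Z n w 0 j|]%R <= (e / q.+1%:R)%:E)%E.
  by apply: filter_forall => j; have [] := projT2 (h j).
apply: filterS H => n Hn.
have mA j : measurable [set w | L j <= `|Z n w 0 j|].
  have mN : measurable_fun setT (fun w => `|Z n w 0 j|) by apply: measurableT_comp => //; exact: mZ.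
  have := mN measurableT _ (measurable_itv `[L j, +oo[); rewrite setTI.
  by congr measurable; apply/seteqP; split => w /=; rewrite in_itv/= andbT.
exists (\big[setU/set0]_j [set w | L j <= `|Z n w 0 j|]); split.
- exact: bigsetU_measurable.
- rewrite (le_trans (prob_bigsetU _ _ mA))//.
  apply: (le_trans (lee_sum _ (fun j _ => Hn j))).
  rewrite sumEFin lee_fin sumr_const card_ord -[_ *+ q]mulr_natr mulrAC ler_pdivrMr//.
  by rewrite ler_pM2l// ler_nat.
- move=> w nA; have LS j : L j <= \sum_j L j.
    rewrite (bigD1 j)//= lerDl sumr_ge0// => i _; by have [/ltW] := projT2 (h i).
  apply: mx_norm_le => [|i j].
    by rewrite addr_ge0// sumr_ge0// => j _; have [/ltW] := projT2 (h j).
  rewrite ord1 leNgt; apply/negP => lt; apply: nA.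
  rewrite -bigcup_seq; exists j; first by rewrite /= mem_index_enum.
  by rewrite /= ltW// (le_lt_trans _ lt)// (le_trans (LS j))// lerDr.
Qed.

End levy.

Theorem levy_continuity {R : realType} {q : nat} {d dW : measure_display}
    {T : measurableType d} {TW : measurableType dW} (P : probability T R)
    (PW : probability TW R) (Z : nat -> T -> 'rV[R]_q) (W : TW -> 'rV[R]_q) :
  (forall n, mcoord (Z n)) -> mcoord W ->
  (forall t c, (fun n => \int[P]_w cos (dot (Z n w) t + c)) @ \oo -->
    \int[PW]_w cos (dot (W w) t + c)) ->
  forall (g : 'rV[R]_q -> R) (M : R), continuous g -> (forall v, `|g v| <= M) ->
  (fun n => \int[P]_w g (Z n w)) @ \oo --> \int[PW]_w g (W w).
Proof.
move=> mZ mW cf g M cg gM; apply/cvgrPdist_le => e e0.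
have M0 : 0 <= M := le_trans (normr_ge0 _) (gM 0).
(* One [e'] for the convergence of the means of [h], and [e' + 2 * M * e'] under each of the two
   laws for replacing [g] by [h]. *)
pose e' := e / (3 + 4 * M).
have M4 : 0 < 3 + 4 * M by rewrite ltr_wpDr// mulr_ge0.
have e'0 : 0 < e' by rewrite divr_gt0.
have [L1 L10 tZ] := tight_vec mZ mW cf e'0.
(* Tightness of the limit [W] itself is read off the constant sequence equal to [W]. *)
have cW t c : (fun n : nat => \int[PW]_w cos (dot (W w) t + c)) @ \oo -->
    \int[PW]_w cos (dot (W w) t + c) by exact: cvg_cst.
have [L2 L20 [n0 _ /(_ n0 (leqnn n0))[B [mB PB hB]]]] :=
  @tight_vec _ _ _ _ _ _ PW PW (fun _ => W) W (fun _ => mW) mW cW _ e'0.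
have L0 : 0 < Num.max L1 L2 by rewrite lt_max L10.
have [h [th hM hg]] := trig_approx cg gM L0 e'0.
have /cvgrPdist_le/(_ _ e'0) hh := trig_cvg mZ mW cf th.
apply: filterS2 tZ hh => n [A [mA PA hA]] hh.
have dA : `|\int[P]_w h (Z n w) - \int[P]_w g (Z n w)| <= e' + 2 * M * e'.
  apply: (@Rint_dist _ _ _ _ _ _ _ _ _ A) => //; [exact: meas_trig|exact: meas_bcont|exact: ltW|].
  by move=> w nA; apply: hg; rewrite le_max hA.
have dB : `|\int[PW]_w h (W w) - \int[PW]_w g (W w)| <= e' + 2 * M * e'.
  apply: (@Rint_dist _ _ _ _ _ _ _ _ _ B) => //; [exact: meas_trig|exact: meas_bcont|exact: ltW|].
  by move=> w nB; apply: hg; rewrite le_max hB// orbT.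
have -> : e = e' + (e' + 2 * M * e') + (e' + 2 * M * e').
  by rewrite /e'; field; exact: lt0r_neq0.
set x := (\int[PW]_w g _); set y := (\int[P]_w g _).
set hx := (\int[PW]_w h _) in hh dB; set hy := (\int[P]_w h _) in hh dA.
rewrite (_ : x - y = (hx - hy) - (hx - x) + (hy - y)); last by ring.
by rewrite (le_trans (ler_normD _ _))// lerD// (le_trans (ler_normB _ _))// lerD.
Qed.

(** * Gaussian vectors *)

Section law_uniqueness.
Context {R : realType} {d d' : measure_display} {T : measurableType d}
  {T' : measurableType d'} (P : probability T R) (P' : probability T' R).
Variables (Y : T -> R) (Y' : T' -> R).
Hypotheses (mY : measurable_fun setT Y) (mY' : measurable_fun setT Y').
Hypothesis cf : forall s c : R, \int[P]_w cos (s * Y w + c) = \int[P']_w cos (s * Y' w + c).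

(** Levy's theorem for a constant sequence in dimension one: its means converge both to themselves
    and to those of [Y']. *)
Lemma cf_eq_bcont (g : R -> R) (M : R) : continuous g -> (forall x, `|g x| <= M) ->
  \int[P]_w g (Y w) = \int[P']_w g (Y' w).
Proof.
move=> cg gM.
pose Z (_ : nat) w : 'rV[R]_1 := \row__ Y w; pose W w : 'rV[R]_1 := \row__ Y' w.
have mZ n : mcoord (Z n) by move=> i; rewrite /Z; under eq_fun do rewrite mxE.
have mW : mcoord W by move=> i; rewrite /W; under eq_fun do rewrite mxE.
have dotr (y : R) (t : 'rV[R]_1) : dot (\row__ y) t = t 0 0 * y.
  by rewrite dotE big_ord1 mxE mulrC.
have cfZ t c : (fun n => \int[P]_w cos (dot (Z n w) t + c)) @ \oo -->
    \int[P']_w cos (dot (W w) t + c).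
  rewrite (_ : \int[P']_w cos (dot (W w) t + c) = \int[P']_w cos (t 0 0 * Y' w + c)).
    rewrite -cf (_ : (fun n => _) = fun _ : nat => \int[P]_w cos (t 0 0 * Y w + c)).
      exact: cvg_cst.
    by apply/funext => n; apply: eq_Rintegral => w _; rewrite dotr.
  by apply: eq_Rintegral => w _; rewrite dotr.
have := @levy_continuity _ _ _ _ _ _ P P' Z W mZ mW cfZ (fun v => g (v 0 0)) M.
have cg1 : continuous (fun v : 'rV[R]_1 => g (v 0 0)).
  by move=> v; apply: (@continuous_comp _ _ _ (fun v : 'rV[R]_1 => v 0 0) g);
    [exact: coord_continuous|exact: cg].
move=> /(_ cg1 (fun v => gM _)).
rewrite /Z /W; under eq_fun do under eq_Rintegral do rewrite mxE.
under [X in _ --> X]eq_Rintegral do rewrite mxE.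
by move=> h; apply: (cvg_unique _ _ h) => //; exact: cvg_cst.
Qed.

Let step (a : R) (n : nat) (x : R) : R := Num.min 1 (Num.max 0 (n%:R * (a - x))).

Let step_cvg a x : (fun n => step a n x) @ \oo --> (\1_`]-oo, a[ x : R).
Proof.
rewrite indicE; have [|] := boolP (x \in _).
  rewrite inE/= in_itv/= => xa; apply: cvg_near_cst; near=> n.
  rewrite /step max_r; last by rewrite mulr_ge0// subr_ge0 ltW.
  rewrite min_l// -ler_pdivrMr ?subr_gt0//.
  near: n; exists (Num.truncn (1 / (a - x))).+1 => // n /= xn.
  by rewrite ltW// (lt_le_trans (truncnS_gt _))// ler_nat.
rewrite notin_setE/= in_itv/= => /negP; rewrite -leNgt => ax; apply: cvg_near_cst; near=> n.
rewrite /step max_l; last by rewrite mulr_ge0_le0// subr_le0.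
by rewrite min_r.
Unshelve. all: by end_near.
Qed.

Let step_cont a n : continuous (step a n).
Proof.
move=> x; apply: (@continuous_min _ _ (cst 1) (fun x => Num.max 0 (n%:R * (a - x))) x).
  exact: cvg_cst.
apply: (@continuous_max _ _ (cst 0) (fun x => n%:R * (a - x)) x); first exact: cvg_cst.
by apply: cvgMr; apply: cvgB; [exact: cvg_cst|exact: cvg_id].
Qed.

Let step_le1 a n x : `|step a n x| <= 1.
Proof.
rewrite ger0_norm /step; first by rewrite ge_min lexx.
by rewrite le_min ler01 le_max lexx.
Qed.

Let law_itv a : P (Y @^-1` `]-oo, a[) = P' (Y' @^-1` `]-oo, a[).
Proof.
have key d0 (T0 : measurableType d0) (P0 : probability T0 R) (Y0 : T0 -> R) :
    measurable_fun setT Y0 ->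
    (fun n => \int[P0]_w step a n (Y0 w)) @ \oo --> fine (P0 (Y0 @^-1` `]-oo, a[)).
  move=> mY0.
  have mA : measurable (Y0 @^-1` `]-oo, a[) by rewrite -[X in measurable X]setTI; exact: mY0.
  rewrite -Rint_indic//.
  apply: (@Rint_dct _ _ _ P0 _ _ (cst 1)).
  - by move=> n; exact: (meas_cont (@step_cont a n) mY0).
  - by apply: (@bint _ _ _ _ _ 1) => // w; rewrite normr1.
  - by move=> n w; exact: step_le1.
  - by move=> w; exact: (@step_cvg a (Y0 w)).
have h1 := key _ _ P _ mY; have h2 := key _ _ P' _ mY'.
have mA : measurable (Y @^-1` `]-oo, a[) by rewrite -[X in measurable X]setTI; exact: mY.
have mA' : measurable (Y' @^-1` `]-oo, a[) by rewrite -[X in measurable X]setTI; exact: mY'.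
rewrite -[LHS]fineK ?fin_num_measure// -[RHS]fineK ?fin_num_measure//; congr EFin.
apply: (cvg_unique _ h1) => //.
rewrite (_ : (fun n => _) = (fun n => \int[P']_w step a n (Y' w))) //.
by apply/funext => n; exact: (cf_eq_bcont (@step_cont a n) (step_le1 a n)).
Qed.

(** Open half-lines form a generating pi-system, and their indicators are limits of the continuous
    ramps [step], to which [cf_eq_bcont] applies. *)
Lemma cf_eq_law (B : set R) : measurable B -> P (Y @^-1` B) = P' (Y' @^-1` B).
Proof.
move=> mB.
pose X : {RV P >-> measurableTypeR R} := HB.pack (Y : T -> measurableTypeR R)
  (isMeasurableFun.Build _ _ _ _ (Y : T -> measurableTypeR R) mY).
pose X' : {RV P' >-> measurableTypeR R} := HB.pack (Y' : T' -> measurableTypeR R)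
  (isMeasurableFun.Build _ _ _ _ (Y' : T' -> measurableTypeR R) mY').
pose m1 : {measure set (measurableTypeR R) -> \bar R} := distribution P X.
pose m2 : {measure set (measurableTypeR R) -> \bar R} := distribution P' X'.
apply: (@measure_unique _ R (measurableTypeR R) (@RGenInftyO.G R)
  (fun n => `]-oo, n%:R[%classic) _ _ _ _ m1 m2) => //.
- exact: RGenInftyO.measurableE.
- move=> A1 A2 [a ->] [b ->]; exists (Num.min a b).
  by apply/seteqP; split => x /=; rewrite !in_itv/= lt_min => /andP.
- by move=> n; exists n%:R.
- apply/seteqP; split => // x _; exists (Num.truncn x).+1 => //=.
  by rewrite in_itv/= truncnS_gt.
- by move=> A [a ->]; exact: law_itv.
- move=> k; rewrite (le_lt_trans (probability_le1 P _)) ?ltry//.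
  by rewrite -[X in measurable X]setTI; exact: mY.
Qed.

End law_uniqueness.

Section gauss_exists.
Context {R : realType} {q : nat}.
Implicit Types (V : 'M[R]_q) (u v w t : 'rV[R]_q).



Definition psd V := forall v, 0 <= dot (v *m V) v.

Lemma dotNl u v : dot (- u) v = - dot u v.
Proof. by rewrite dotC dotNr dotC. Qed.

Lemma dot_tr V u v : dot (u *m V) v = dot u (v *m V^T).
Proof. by rewrite /dot trmx_mul trmxK mulmxA. Qed.

Lemma psd_diag0 V i j : V^T = V -> psd V -> V i i = 0 -> V i j = 0.
Proof.
move=> sV pV Vii; apply/eqP/negPn/negP => Vij.
pose e k : 'rV[R]_q := delta_mx 0 k.
have eV k l : dot (e k *m V) (e l) = V k l.
  by rewrite dot_delta -rowE mxE.
(* With V i i = 0 the form at s e_i + e_j is 2 s V i j + V j j; this [s] makes it -1. *)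
pose s := - (V j j + 1) / (2 * V i j).
have := pV (s *: e i + e j).
rewrite mulmxDl -scalemxAl dotDl !dotDr !dotZl !dotZr !eV Vii.
rewrite (_ : V j i = V i j); last by rewrite -{1}sV mxE.
rewrite (_ : _ + _ = -1); first by rewrite ler0N1.
by rewrite /s; field.
Qed.

(** Symmetric Gaussian elimination: only the rows of index below [k] may be nonzero, and the
    induction removes row k-1. If its pivot [a] is positive with row [u], the Schur complement V' =
    V - a^-1 u^T u has one row less, and adding an independent (xi / sqrt a) u, with xi standard
    normal, to a vector of covariance V' restores V. A zero pivot forces a zero row. *)
Lemma gauss_exists (k : nat) V : V^T = V -> psd V ->
  (forall i j : 'I_q, (k <= i)%N -> V i j = 0) ->
  exists (dW : measure_display) (TW : measurableType dW) (PW : probability TW R)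
    (W : TW -> 'rV[R]_q), mcoord W /\
    forall t c, \int[PW]_w cos (dot (W w) t + c) = expR (- dot (t *m V) t / 2) * cos c.
Proof.
elim: k V => [|k IH] V sV pV V0.
  exists _, (measurableTypeR R), (normal_prob (0 : R) 1), (fun=> 0); split.
    by move=> i; rewrite (_ : (fun _ => _) = cst 0)//; apply/funext => w; rewrite mxE.
  move=> t c; have -> : V = 0 by apply/matrixP => i j; rewrite V0 ?mxE.
  rewrite mulmx0 dotC dot0r oppr0 mul0r expR0 mul1r.
  under eq_Rintegral do rewrite add0r.
  by rewrite Rint_cst.
have [qk|kq] := leqP q k.
  apply: IH => // i j ki; have := ltn_ord i; rewrite ltnNge.
  by rewrite (leq_trans qk ki).
pose i0 := Ordinal kq.
have a0 : 0 <= V i0 i0.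
  by have := pV (delta_mx 0 i0); rewrite dot_delta -rowE mxE.
have [a00|an0] := eqVneq (V i0 i0) 0.
  apply: IH => // i j; rewrite leq_eqVlt => /predU1P[ki|]; last exact: V0.
  have -> : i = i0 by apply: val_inj.
  exact: psd_diag0.
have {a0}a0 : 0 < V i0 i0 by rewrite lt_neqAle eq_sym an0.
set a := V i0 i0 in a0 an0.
pose u := row i0 V.
have uE j : u 0 j = V i0 j by rewrite mxE.
pose V' := V - a^-1 *: (u^T *m u).
have V'E i j : V' i j = V i j - a^-1 * (V i0 i * V i0 j).
  by rewrite !mxE big_ord1 !mxE.
have VC i j : V i j = V j i by rewrite -{1}sV mxE.
have dotV' t s : dot (t *m V') s = dot (t *m V) s - a^-1 * (dot t u * dot u s).
  rewrite mulmxBr -scalemxAr mulmxA dotDl dotNl dotZl.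
  by congr (_ - _ * _); rewrite (mx11_scalar (t *m u^T)) mul_scalar_mx dotZl.
have [|||dW [TW [PW [W [mW cfW]]]]] := IH V'.
- by rewrite /V' linearB linearZ/= trmx_mul trmxK sV.
- move=> v; set b := dot v u.
  (* Completing the square: the form of [V] at this vector equals the form of [V'] at [v]. *)
  have := pV (v - (b / a) *: delta_mx 0 i0).
  have dV : dot (delta_mx 0 i0 *m V) v = b by rewrite -rowE dotC.
  have dV' : dot (v *m V) (delta_mx 0 i0) = b by rewrite dot_tr sV -rowE.
  have dVi : dot (delta_mx 0 i0 *m V) (delta_mx 0 i0) = a by rewrite dot_delta -rowE mxE.
  rewrite mulmxBl -scalemxAl dotDl dotNl !dotDr !dotNr !dotZl !dotZr dV dV' dVi dotV'.
  rewrite (dotC u) -/b.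
  by rewrite (_ : _ - _ = dot (v *m V) v - a^-1 * (b * b)) //; field.
- move=> i j; rewrite leq_eqVlt => /predU1P[ki|ki]; rewrite V'E.
    have -> : i = i0 by apply: val_inj.
    by rewrite mulrA mulVf ?mul1r ?subrr.
  by rewrite V0// (VC i0 i) V0// mul0r mulr0 subrr.
pose W' (z : TW * measurableTypeR R) := W z.1 + (z.2 / Num.sqrt a) *: u.
have sa0 : Num.sqrt a != 0 by rewrite sqrtr_eq0 -ltNge.
have mW' : mcoord W'.
  move=> i; rewrite /W'; under eq_fun do rewrite !mxE.
  apply: measurable_funD; first exact: (measurableT_comp (mW i)).
  by apply: measurable_funM => //; apply: measurable_funM => //; exact: measurable_snd.
exists _, _, (prod_prob PW (normal_prob (0 : R) 1)), W'; split => // t c.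
rewrite (@Rint_prod _ _ _ _ _ _ _ _ 1); last 2 first.
- exact: meas_cos_dot.
- by move=> z; exact: cos_max.
pose b := dot u t / Num.sqrt a.
transitivity (\int[PW]_x (expR (- b ^+ 2 / 2) * cos (dot (W x) t + c))).
  apply: eq_Rintegral => x _.
  have := gauss_char (oner_neq0 R) b (dot (W x) t + c).
  rewrite expr1n mul1r => <-; apply: eq_Rintegral => s _.
  by congr cos; rewrite /W' dotDl dotZl /b/=; ring.
rewrite RintegralZl//; last first.
  by apply: (@bint _ _ _ _ _ 1); [exact: meas_cos_dot|move=> w; exact: cos_max].
rewrite cfW mulrA -expRD; congr (expR _ * _).
rewrite dotV' (dotC t u) /b exprMn exprVn sqr_sqrtr ?ltW//; field.
exact: lt0r_neq0.
Qed.

(** Along a fixed [t], the transforms at [s *: t] are those of a centred normal variable of variance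
    [dot (t *m V) t], and the law on the line is determined by them. *)
Lemma cf_gaussian_vector {dW} {TW : measurableType dW} (PW : probability TW R)
    (W : TW -> 'rV[R]_q) V : mcoord W -> psd V ->
  (forall t c, \int[PW]_w cos (dot (W w) t + c) = expR (- dot (t *m V) t / 2) * cos c) ->
  gaussian_vector PW W V.
Proof.
move=> mW pV cfW t B mB.
rewrite -/(dot (t *m V) t) /normal_law; set v := dot _ _.
have cfv (s c : R) : \int[PW]_w cos (s * dot (W w) t + c) = expR (- (s ^+ 2 * v) / 2) * cos c.
  have := cfW (s *: t) c; rewrite -scalemxAl dotZl dotZr mulrA -expr2 => <-.
  by apply: eq_Rintegral => w _; rewrite dotZr.
case: eqVneq => [v0|v0].
  (* Zero variance: the comparison is with the constant 0, for which [normal_prob 0 1] is just some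
     probability space. *)
  rewrite (@cf_eq_law R _ _ _ _ PW (normal_prob (0 : R) 1) (fun w : TW => dot (W w) t) (cst 0)) //.
  - rewrite indicE; have [|] := boolP ((0 : R) \in B); rewrite ?inE ?notin_setE => B0.
      rewrite (_ : _ @^-1` _ = setT) ?probability_setT//.
      by apply/seteqP; split.
    rewrite (_ : _ @^-1` _ = set0) ?measure0//.
    by apply/seteqP; split.
  - exact: meas_dot.
  - move=> s c; rewrite cfv v0 mulr0 oppr0 mul0r expR0 mul1r.
    by under eq_Rintegral do rewrite mulr0 add0r; rewrite Rint_cst.
have vp : 0 < v by rewrite lt_neqAle eq_sym v0 pV.
have sv : Num.sqrt v != 0 by rewrite sqrtr_eq0 -ltNge.
rewrite (@cf_eq_law R _ _ _ _ PW (normal_prob (0 : R) (Num.sqrt v)) (fun w : TW => dot (W w) t) idfun) //.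
- exact: meas_dot.
- exact: measurable_id.
- by move=> s c; rewrite cfv (gauss_char sv) sqr_sqrtr ?ltW// [v * _]mulrC.
Qed.

End gauss_exists.

(** * Central limit theorem *)

Lemma cvg_sumR {R : realType} {T : Type} (F : set_system T) (I : Type) (s : seq I)
    (f : I -> T -> R) (l : I -> R) : Filter F ->
  (forall i, f i x @[x --> F] --> l i) ->
  \sum_(i <- s) f i x @[x --> F] --> \sum_(i <- s) l i.
Proof.
move=> FF fl; elim: s => [|i s IH].
  by rewrite big_nil; under eq_fun do rewrite big_nil; exact: cvg_cst.
by rewrite big_cons; under eq_fun do rewrite big_cons; exact: cvgD.
Qed.

(** * Independence and the cosine transform of a sum *)

Section independence.
Import HBNNSimple.
Context {R : realType} {dO dX : measure_display} {TO : measurableType dO}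
  {TX : measurableType dX} (P : probability TO R).

(** The identity is linear in [g], so it extends from indicators to simple functions and, by
    dominated convergence, to bounded measurable functions. *)
Lemma cst_indic_bounded (X : TO -> TX) (Y : TO -> R) (M c : R) :
  measurable_fun setT X -> measurable_fun setT Y -> (forall w, `|Y w| <= M) ->
  (forall B, measurable B -> \int[P]_w (Y w * \1_B (X w)) = c * fine (P (X @^-1` B))) ->
  forall (g : TX -> R) (N : R), measurable_fun setT g -> (forall x, `|g x| <= N) ->
  \int[P]_w (Y w * g (X w)) = c * \int[P]_w g (X w).
Proof.
move=> mX mY YM H.
have mXB B : measurable B -> measurable (X @^-1` B).
  by move=> mB; rewrite -[X in measurable X]setTI; exact: mX.
have HB B : measurable B -> \int[P]_w (Y w * \1_B (X w)) = c * \int[P]_w \1_B (X w).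
  by move=> mB; rewrite H// -Rint_indic//; exact: mXB.
pose Q (g : TX -> R) := measurable_fun setT g /\ (exists N : R, forall x, `|g x| <= N).
have iY g : Q g -> P.-integrable setT (EFin \o (fun w => Y w * g (X w))).
  move=> [mg [N gN]]; apply: (@bint _ _ _ _ _ (M * N)).
    by apply: measurable_funM => //; exact: measurableT_comp.
  by move=> w; rewrite normrM ler_pM.
have ig g : Q g -> P.-integrable setT (EFin \o (fun w => g (X w))).
  by move=> [mg [N gN]]; apply: (@bint _ _ _ _ _ N) => //; exact: measurableT_comp.
pose E g := \int[P]_w (Y w * g (X w)) = c * \int[P]_w g (X w).
have ED f g : Q f -> Q g -> E f -> E g -> E (fun x => f x + g x).
  move=> Qf Qg Ef Eg; rewrite /E.
  rewrite (RintegralD measurableT (ig _ Qf) (ig _ Qg)) mulrDr -Ef -Eg.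
  rewrite -(RintegralD measurableT (iY _ Qf) (iY _ Qg)).
  by apply: eq_Rintegral => w _; rewrite mulrDr.
have EZ a g : Q g -> E g -> E (fun x => a * g x).
  move=> Qg Eg; rewrite /E (RintegralZl a measurableT (ig _ Qg)) mulrCA -Eg.
  rewrite -(RintegralZl a measurableT (iY _ Qg)).
  by apply: eq_Rintegral => w _; rewrite mulrCA.
have QI B : measurable B -> Q (\1_B).
  move=> mB; split; first exact: measurable_indic.
  by exists 1 => x; rewrite indicE; case: (_ \in _); rewrite ?normr1 ?normr0.
have Qsum (s : seq R) (B : R -> set TX) : (forall y, measurable (B y)) ->
    Q (fun x => \sum_(y <- s) y * \1_(B y) x) /\
    E (fun x => \sum_(y <- s) y * \1_(B y) x).
  move=> mB; elim: s => [|y s [[m1 [N1 h1]] E1]].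
    rewrite /E; under eq_fun do rewrite big_nil; split; first by split => //; exists 0 => x; rewrite normr0.
    under eq_Rintegral do rewrite big_nil mulr0.
    under [in RHS]eq_Rintegral do rewrite big_nil.
    by rewrite !Rint_cst mulr0.
  have [m2 [N2 h2]] := QI _ (mB y).
  rewrite (_ : (fun x => _) = (fun x => y * \1_(B y) x + \sum_(y <- s) y * \1_(B y) x)); last first.
    by apply/funext => x; rewrite big_cons.
  have Q2 : Q (fun x => y * \1_(B y) x).
    split; first exact: measurable_funM.
    by exists (`|y| * N2) => x; rewrite normrM ler_wpM2l.
  split.
    case: Q2 => m3 [N3 h3]; split; first exact: measurable_funD.
    by exists (N3 + N1) => x; rewrite (le_trans (ler_normD _ _))// lerD.
  apply: ED => //; first by split => //; exists N1.
  by apply: EZ; [exact: QI|exact: HB].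
have Enn (g : TX -> R) (N : R) : measurable_fun setT g -> (forall x, 0 <= g x <= N) -> E g.
  move=> mg gN; have mg' : measurable_fun setT (EFin \o g) by exact/measurable_EFinP.
  have g0 x : setT x -> (0 <= (g x)%:E)%E by move=> _; rewrite lee_fin; have /andP[] := gN x.
  pose s := nnsfun_approx measurableT mg'.
  have s_cvg x : (fun n => s n x) @ \oo --> g x.
    have h := cvg_nnsfun_approx measurableT mg' g0 (I : setT x).
    by have /fine_cvg := h.
  have sle n x : `|s n x| <= N.
    rewrite ger0_norm//; have /andP[_] := gN x; apply: le_trans.
    rewrite -(cvg_lim _ (s_cvg x))//; apply: nondecreasing_cvgn_le.
      by move=> m k mk; exact/lefP/nd_nnsfun_approx.
    by apply/cvg_ex; exists (g x); exact: s_cvg.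
  have Es n : E (s n).
    have sE : (fun x => \sum_(y <- finmap.enum_fset (fset_set (range (s n))))
        y * \1_(s n @^-1` [set y]) x) = s n.
      by apply/funext => x; rewrite [RHS](fimfunE (s n)) fsbig_finite.
    have [|_] := Qsum (finmap.enum_fset (fset_set (range (s n)))) (fun y => s n @^-1` [set y]).
      by move=> y; exact: measurable_sfunP.
    by rewrite sE.

  have h1 : (fun n => \int[P]_w (Y w * s n (X w))) @ \oo --> \int[P]_w (Y w * g (X w)).
    apply: (@Rint_dct _ _ _ P _ _ (fun w => `|M| * `|N|)).
    - move=> n; apply: measurable_funM => //; apply: measurableT_comp => //.
    - by apply: (@bint _ _ _ _ _ `| `|M| * `|N| |).
    - move=> n w; rewrite normrM ler_pM//; first by rewrite (le_trans (YM w))// ler_norm.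
      by rewrite (le_trans (sle _ _))// ler_norm.
    - by move=> w; apply: cvgMr; exact: s_cvg.
  have h2 : (fun n => c * \int[P]_w (s n (X w))) @ \oo --> c * \int[P]_w (g (X w)).
    apply: cvgMr; apply: (@Rint_dct _ _ _ P _ _ (fun w => `|N|)).
    - by move=> n; apply: measurableT_comp.
    - by apply: (@bint _ _ _ _ _ `| `|N| |).
    - by move=> n w; rewrite (le_trans (sle _ _))// ler_norm.
    - by move=> w; exact: s_cvg.
  apply: (cvg_unique _ h1) => //.
  by rewrite (_ : (fun n => _) = (fun n => c * \int[P]_w (s n (X w)))) //; apply/funext => n; exact: Es.
move=> g N mg gN.
(* Adding [N] makes the function nonnegative, as the simple approximation requires; linearity
   removes the constant afterwards. *)
have mgN : measurable_fun setT (fun x => g x + N) by exact: measurable_funD.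
have := Enn (fun x => g x + N) (N + N) mgN; move=> /(_ _)-E1.
have Qc : Q (cst (- N)) by split => //; exists `|N| => x; rewrite normrN.
have QgN : Q (fun x => g x + N).
  split => //; exists (N + `|N|) => x.
  by rewrite (le_trans (ler_normD _ _))// lerD2r.
have Ec : E (cst (- N)).
  have := EZ (- N) _ (QI _ measurableT) (HB _ measurableT).
  by rewrite /E; under eq_Rintegral do rewrite indicT mulr1;
    under [in RHS]eq_Rintegral do rewrite indicT mulr1.
have := ED _ _ QgN Qc (E1 _) Ec.
rewrite /E; under eq_Rintegral do rewrite addrK.
under [in RHS]eq_Rintegral do rewrite addrK.
apply => x; have := gN x; rewrite ler_norml => /andP[? ?].
by apply/andP; split; lra.
Qed.

Context {I : eqType} (X : I -> TO -> TX).
Hypothesis mX : forall i, measurable_fun setT (X i).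
Hypothesis indX : mutually_independent P X.

(** A test-function form of independence between [Y] and the family of all [X j] with [j] outside
    [s]. It is an invariant suited to induction: multiplying [Y] by a function of one further [X j]
    just adds [j] to [s]. *)
Definition indep_off (s : seq I) (Y : TO -> R) :=
  forall s', uniq s' -> (forall j, j \in s' -> j \notin s) ->
  forall A : I -> set TX, (forall j, measurable (A j)) ->
  \int[P]_w (Y w * \prod_(j <- s') \1_(A j) (X j w)) =
  \int[P]_w Y w * \prod_(j <- s') fine (P (X j @^-1` A j)).

Let meas_pre j B : measurable B -> measurable (X j @^-1` B).
Proof. by move=> mB; rewrite -[X in measurable X]setTI; exact: mX. Qed.

Let meas_prod s (A : I -> set TX) : (forall j, measurable (A j)) ->
  measurable_fun setT (fun w => \prod_(j <- s) \1_(A j) (X j w) : R).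
Proof.
move=> mA; apply: measurable_prod => j _.
by apply: measurableT_comp => //; exact: measurable_indic.
Qed.

Let prod_le1 s (A : I -> set TX) w : `|\prod_(j <- s) \1_(A j) (X j w) : R| <= 1.
Proof.
elim: s => [|j s IH]; first by rewrite big_nil normr1.
rewrite big_cons normrM mulr_ile1// indicE.
by case: (_ \in _); rewrite ?normr1 ?normr0.
Qed.

Lemma indep_off_cst c : indep_off [::] (cst c).
Proof.
move=> s us _ A mA.
have iP : P.-integrable setT (EFin \o (fun w => \prod_(j <- s) \1_(A j) (X j w) : R)).
  by apply: (@bint _ _ _ _ _ 1); [exact: meas_prod|move=> w; exact: prod_le1].
rewrite (RintegralZl c measurableT iP) Rint_cst; congr (_ * _).
have := indX us mA.
pose B := \bigcap_(j in [set j | j \in s]) (X j @^-1` A j).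
have BE w : \prod_(j <- s) \1_(A j) (X j w) = \1_B w :> R.
  rewrite indicE; have [|] := boolP (w \in B).
    rewrite inE => Bw; rewrite big1_seq// => j /andP[_ js].
    by rewrite indicE mem_set//; exact: Bw.
  rewrite notin_setE => nB.
  have [j js nA] : exists2 j, j \in s & ~ A j (X j w).
    apply: contrapT => h; apply: nB => j /= js.
    by apply: contrapT => nA; apply: h; exists j.
  apply/eqP; rewrite prodf_seq_eq0; apply/hasP; exists j => //=.
  by rewrite indicE memNset.
under eq_Rintegral do rewrite BE.
have mB : measurable B.
  have := meas_prod s mA measurableT (measurable_set1 (1 : R)); rewrite setTI.
  congr measurable; apply/seteqP; split => w /=; rewrite BE indicE.
    by have [/set_mem//|_ /esym/eqP] := boolP (w \in B); rewrite oner_eq0.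
  by move=> /mem_set ->.
rewrite Rint_indic// -/B => ->.
elim: (s) => [|j s' IH]; first by rewrite !big_nil.
rewrite !big_cons fineM ?IH ?fin_num_measure//; first exact: meas_pre.
rewrite (_ : (\prod_(j <- s') _)%E = (\prod_(j <- s') fine (P (X j @^-1` A j)))%:E)//.
elim: (s') => [|i s'' IH']; first by rewrite !big_nil.
by rewrite !big_cons IH' EFinM fineK ?fin_num_measure//; exact: meas_pre.
Qed.

Lemma indep_offB s (Y Y' : TO -> R) M M' :
  measurable_fun setT Y -> (forall w, `|Y w| <= M) ->
  measurable_fun setT Y' -> (forall w, `|Y' w| <= M') ->
  indep_off s Y -> indep_off s Y' -> indep_off s (fun w => Y w - Y' w).
Proof.
move=> mY YM mY' YM' iY iY' s' us' ss' A mA.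
have int (V : TO -> R) N : measurable_fun setT V -> (forall w, `|V w| <= N) ->
    P.-integrable setT (EFin \o (fun w => V w * \prod_(j <- s') \1_(A j) (X j w))).
  move=> mV VN; apply: (@bint _ _ _ _ _ N).
    by apply: measurable_funM => //; exact: meas_prod.
  move=> w; rewrite normrM -[leRHS]mulr1 ler_pM//; exact: prod_le1.
rewrite (RintegralB measurableT (bint P mY YM) (bint P mY' YM')) mulrBl -iY// -iY'//.
rewrite -(RintegralB measurableT (int _ _ mY YM) (int _ _ mY' YM')).
by apply: eq_Rintegral => w _; rewrite mulrBl.
Qed.

(** For fixed events the claim is linear in [g], and for [g] an indicator it is the hypothesis on
    [Y] tested with one more index [j]. *)
Lemma indep_offM s j (Y : TO -> R) (g : TX -> R) M N :
  measurable_fun setT Y -> (forall w, `|Y w| <= M) ->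
  measurable_fun setT g -> (forall x, `|g x| <= N) ->
  indep_off s Y -> j \notin s ->
  \int[P]_w (Y w * g (X j w)) = \int[P]_w Y w * \int[P]_w g (X j w) /\
  indep_off (j :: s) (fun w => Y w * g (X j w)).
Proof.
move=> mY YM mg gN iY js.
have key s' (A : I -> set TX) : uniq s' -> (forall i, i \in s' -> i \notin j :: s) ->
    (forall i, measurable (A i)) ->
    \int[P]_w ((Y w * \prod_(i <- s') \1_(A i) (X i w)) * g (X j w)) =
    (\int[P]_w Y w * \prod_(i <- s') fine (P (X i @^-1` A i))) * \int[P]_w g (X j w).
  move=> us' ss' mA; apply: (@cst_indic_bounded _ _ M _ _ _ _ _ _ N) => //.
  - by apply: measurable_funM => //; exact: meas_prod.
  - by move=> w; rewrite normrM -[leRHS]mulr1 ler_pM//; exact: prod_le1.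
  (* The event at [j] becomes [B]; as [j] is not in [s'], the other factors are unchanged. *)
  - move=> B mB; pose A' i := if i == j then B else A i.
    have js' : j \notin s'.
      by apply/negP => /ss'; rewrite inE eqxx.
    have A'E i : i \in s' -> A' i = A i.
      by move=> is'; rewrite /A'; case: eqP => // ij; rewrite -ij is' in js'.
    have := iY (j :: s') _ _ A' _; rewrite /= js' us' => /(_ isT) h.
    rewrite -mulrA [X in _ = _ * X](_ : _ = \prod_(i <- j :: s') fine (P (X i @^-1` A' i))).
      rewrite -h; last 2 first.
      + move=> i; rewrite inE => /predU1P[->//|/ss'].
        by rewrite inE negb_or => /andP[].
      + by move=> i; rewrite /A'; case: eqP.
      apply: eq_Rintegral => w _; rewrite big_cons.
      have -> : \1_(A' j) (X j w) = \1_B (X j w) :> R by rewrite /A' eqxx.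
      have -> : \prod_(i <- s') \1_(A' i) (X i w) = \prod_(i <- s') \1_(A i) (X i w) :> R.
        by rewrite !big_seq; apply: eq_bigr => i /A'E ->.
      by rewrite (mulrC (\1_B _)) mulrA.
    rewrite big_cons mulrC; congr (_ * _); first by rewrite /A' eqxx.
    by rewrite !big_seq; apply: eq_bigr => i /A'E ->.
split.
  have := key [::] (fun=> setT) isT _ _; rewrite big_nil mulr1 => <- //.
  by apply: eq_Rintegral => w _; rewrite big_nil mulr1.
move=> s' us' ss' A mA.
have := key [::] (fun=> setT) isT _ _; rewrite big_nil mulr1.
under eq_Rintegral do rewrite big_nil mulr1.
move=> -> //; rewrite mulrAC -key//.
by apply: eq_Rintegral => w _; rewrite mulrAC.
Qed.

Variables (h : I -> TX -> R).
Hypothesis mh : forall i, measurable_fun setT (h i).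

Let S s w := \sum_(i <- s) h i (X i w).

Let mS s : measurable_fun setT (S s).
Proof. by apply: measurable_sum => i; apply: measurableT_comp. Qed.

Let mC s c : measurable_fun setT (fun w => cos (S s w + c)).
Proof. by apply: meas_cos; exact: measurable_funD. Qed.

Let mhs i : measurable_fun setT (fun x => sin (h i x)).
Proof. exact: (meas_cont (@continuous_sin R)). Qed.

(** The sine of the partial sum is written as a cosine with phase shifted by pi/2, so that the
    inductions over all phases [c] involve cosines only. *)
Let stepE i s c w : cos (S (i :: s) w + c) = cos (S s w + c) * cos (h i (X i w)) -
  cos (S s w + (c - pi / 2)) * sin (h i (X i w)).
Proof.
rewrite addrA cosBpihalf /S big_cons -/(S s w).
by rewrite (_ : _ + _ + c = (S s w + c) + h i (X i w)) ?cosD//; ring.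
Qed.

Let indep_cos s c : uniq s -> indep_off s (fun w => cos (S s w + c)).
Proof.
elim: s c => [c _|i s IH c /= /andP[nis us]].
  have := indep_off_cst (cos c); rewrite (_ : cst _ = fun w => cos (S [::] w + c))//.
  by apply/funext => w; rewrite /S big_nil add0r.
rewrite (_ : (fun w => _) = (fun w => cos (S s w + c) * cos (h i (X i w)) -
  cos (S s w + (c - pi / 2)) * sin (h i (X i w)))); last by apply/funext => w; exact: stepE.
have [_ i1] := indep_offM (mC s c) (fun w => cos_max _) (meas_cos (mh i)) (fun x => cos_max _) (IH c us) nis.
have [_ i2] := indep_offM (mC s (c - pi / 2)) (fun w => cos_max _) (mhs i) (fun x => sin_max _)
  (IH (c - pi / 2) us) nis.
apply: (@indep_offB _ _ _ 1 1) => //.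
- by apply: measurable_funM; [exact: mC|apply: meas_cos; exact: measurableT_comp].
- by move=> w; rewrite normrM mulr_ile1// cos_max.
- by apply: measurable_funM; [exact: mC|exact: (measurableT_comp (mhs i))].
- by move=> w; rewrite normrM mulr_ile1// ?cos_max// sin_max.
Qed.

(** Telescoping: peeling off one variable multiplies the transform by its mean cosine, compared with
    [b i], and adds a term with its mean sine, compared with 0. Both errors are in [dl i], and the
    earlier error is not amplified since 0 <= b i <= 1. *)
Lemma cf_sum_approx (b dl : I -> R) s c : uniq s -> (forall i, 0 <= b i <= 1) ->
  (forall i, i \in s -> `|\int[P]_w cos (h i (X i w)) - b i| + `|\int[P]_w sin (h i (X i w))| <= dl i) ->
  `|\int[P]_w cos (\sum_(i <- s) h i (X i w) + c) - (\prod_(i <- s) b i) * cos c| <=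
  \sum_(i <- s) dl i.
Proof.
move=> + b01; elim: s c => [c _ _|i s IH c /= /andP[nis us] hd].
  under eq_Rintegral do rewrite big_nil add0r.
  by rewrite Rint_cst !big_nil mul1r subrr normr0.
have [e1 i1] := indep_offM (mC s c) (fun w => cos_max _) (meas_cos (mh i)) (fun x => cos_max _)
  (indep_cos c us) nis.
have [e2 i2] := indep_offM (mC s (c - pi / 2)) (fun w => cos_max _) (mhs i) (fun x => sin_max _)
  (indep_cos (c - pi / 2) us) nis.
have -> : \int[P]_w cos (\sum_(i <- i :: s) h i (X i w) + c) =
    \int[P]_w cos (S s w + c) * \int[P]_w cos (h i (X i w)) -
    \int[P]_w cos (S s w + (c - pi / 2)) * \int[P]_w sin (h i (X i w)).
  rewrite -e1 -e2 -RintegralB//; first by apply: eq_Rintegral => w _; rewrite -stepE.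
  - apply: (@bint _ _ _ _ _ 1).
      by apply: measurable_funM; [exact: mC|apply: meas_cos; exact: measurableT_comp].
    by move=> w; rewrite normrM mulr_ile1// cos_max.
  - apply: (@bint _ _ _ _ _ 1).
      by apply: measurable_funM; [exact: mC|exact: (measurableT_comp (mhs i))].
    by move=> w; rewrite normrM mulr_ile1// ?cos_max// sin_max.
have IHs : `|\int[P]_w cos (S s w + c) - (\prod_(i <- s) b i) * cos c| <= \sum_(i <- s) dl i.
  by apply: IH => // j js; apply: hd; rewrite inE js orbT.
have := hd i (mem_head _ _).
have c1 : `|\int[P]_w cos (S s w + c)| <= 1.
  by apply: Rint_bound; [exact: mC|move=> w; exact: cos_max].
have c2 : `|\int[P]_w cos (S s w + (c - pi / 2))| <= 1.
  by apply: Rint_bound; [exact: mC|move=> w; exact: cos_max].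
rewrite !big_cons.
move: c1 c2 IHs; set A := \int[P]_w _; set B := \int[P]_w _; set C := \int[P]_w _.
set D := \int[P]_w _; set p := \prod_(i <- s) b i => c1 c2 IHs hi.
rewrite (_ : _ - _ = A * (C - b i) - B * D + b i * (A - p * cos c)); last by ring.
rewrite (le_trans (ler_normD _ _))// lerD//.
  rewrite (le_trans (ler_normB _ _))// (le_trans _ hi)// !normrM lerD// ler_piMl//.
have /andP[bi0 bi1] := b01 i.
by rewrite normrM (ger0_norm bi0) (le_trans _ IHs)// ler_piMl.
Qed.

End independence.

Section law.
Context {R : realType} {dO dX : measure_display} {TO : measurableType dO}
  {TX : measurableType dX} (P : probability TO R) (m : probability TX R) (X : TO -> TX).
Hypothesis mX : measurable_fun setT X.
Hypothesis lawX : forall A, measurable A -> P (X @^-1` A) = m A.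

Lemma Rint_law (g : TX -> R) (M : R) : measurable_fun setT g -> (forall x, `|g x| <= M) ->
  \int[P]_w g (X w) = \int[m]_x g x.
Proof.
move=> mg gM.
have ig : P.-integrable setT (EFin \o (fun w => g (X w))).
  by apply: (@bint _ _ _ _ _ M) => //; exact: measurableT_comp.
rewrite /Rintegral; congr fine.
rewrite -[LHS](@integral_pushforward _ _ _ _ _ X mX P setT (EFin \o g)) //; last first.
  exact/measurable_EFinP.
by apply: eq_measure_integral => A mA _; exact: lawX.
Qed.

End law.

(** * Second-order expansion of the transform of one centred variable *)

Section one_variable.
Context {R : realType} {dX : measure_display} {TX : measurableType dX}
  (m : probability TX R) (z : TX -> R).
Hypothesis mz : measurable_fun setT z.
Hypothesis z2 : m.-integrable setT (EFin \o (fun x => z x ^+ 2)).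
Hypothesis z0 : \int[m]_x z x = 0.
Let s2 := \int[m]_x z x ^+ 2.

Let iz : m.-integrable setT (EFin \o z).
Proof.
have h : m.-integrable setT (EFin \o (fun x => 1 + z x ^+ 2)).
  have := integrableD measurableT (@bint _ _ _ m (cst 1) 1 _ (fun _ => _)) z2.
  by apply => // x; rewrite normr1.
apply: (le_integrable _ _ _ h) => //; first exact/measurable_EFinP.
move=> x _; rewrite /= lee_fin [leRHS]ger0_norm; last by rewrite addr_ge0// sqr_ge0.
by rewrite -(real_normK (num_real (z x))); nra.
Qed.

Let int_f a (f : R -> R) : continuous f -> (exists C : R, forall y, `|f y| <= C * y ^+ 2) ->
  m.-integrable setT (EFin \o (fun x => f (a * z x))).
Proof.
move=> cf [C fC].
have h := integrableZl measurableT (C * a ^+ 2) z2.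
apply: (le_integrable _ _ _ h) => //.
  by apply/measurable_EFinP/meas_cont => //; exact: measurable_funM.
move=> x _; rewrite /= lee_fin (le_trans (fC _))// exprMn mulrA ler_norm//.
Qed.

(* [f] is a second-order Taylor remainder of [cos] or [sin]. *)
Lemma taylor_cvg (f : R -> R) (N : nat -> nat) : continuous f ->
  (forall k, (k <= N k)%N) ->
  (forall y, `|f y| <= 2 * y ^+ 2) -> (forall y, `|f y| <= `|y| ^+ 3 * (1 + `|y|)) ->
  (fun k => (N k)%:R * \int[m]_x f ((Num.sqrt (N k)%:R)^-1 * z x)) @ \oo --> (0 : R).
Proof.
move=> cf Nk f2 f3; pose a k : R := (Num.sqrt (N k)%:R)^-1.
have a0 k : 0 <= a k by rewrite invr_ge0.
have Na k : (N k)%:R * a k ^+ 2 <= 1.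
  rewrite /a exprVn sqr_sqrtr ?ler0n//.
  have [->|N0] := eqVneq ((N k)%:R : R) 0; first by rewrite mul0r.
  by rewrite mulfV.
rewrite (_ : (fun k => _) = (fun k => \int[m]_x ((N k)%:R * f (a k * z x)))); last first.
  apply/funext => k; rewrite RintegralZl//.
  by apply: int_f => //; exists 2.
rewrite -[X in _ --> X](Rint_cst m).
have i2 := integrableZl measurableT 2 z2.
apply: (@Rint_dct _ _ _ m _ _ (fun x => 2 * z x ^+ 2)).
- move=> k; apply: measurable_funM => //; apply: meas_cont => //.
  exact: measurable_funM.
- exact: i2.
- move=> k x; rewrite normrM ger0_norm ?ler0n//.
  apply: (@le_trans _ _ ((N k)%:R * (2 * (a k * z x) ^+ 2))); first exact: ler_wpM2l.
  rewrite exprMn [leLHS](_ : _ = ((N k)%:R * a k ^+ 2) * (2 * z x ^+ 2)); last by ring.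
  by rewrite ler_piMl// mulr_ge0 ?sqr_ge0.
move=> x /=.
have ac : a @ \oo --> (0 : R).
  apply/cvgrPdist_le => e e0; near=> k.
  rewrite sub0r normrN ger0_norm// /a.
  have k0 : (0 < N k)%N by rewrite (leq_trans _ (Nk k))//; near: k; exists 1%N.
  rewrite invf_ple ?posrE ?sqrtr_gt0 ?ltr0n//.
  rewrite -[leLHS]gtr0_norm ?invr_gt0// -sqrtr_sqr ler_wsqrtr//.
  apply: (@le_trans _ _ k%:R); last by rewrite ler_nat.
  near: k; exists (Num.truncn (e^-1 ^+ 2)).+1 => // n /= xn.
  by rewrite ltW// (lt_le_trans (truncnS_gt _))// ler_nat.
have h : (fun k => a k * `|z x| ^+ 3 * (1 + a k * `|z x|)) @ \oo --> (0 : R).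
  rewrite [X in _ --> X](_ : 0 = 0 * `|z x| ^+ 3 * (1 + 0 * `|z x|)); last by rewrite !mul0r.
  apply: cvgM; first by apply: cvgMl.
  by apply: cvgD; [exact: cvg_cst|exact: cvgMl].
apply: norm_cvg0; apply: (@squeeze_cvgr _ _ _ _ (cst 0) _ _ _ _ _ h); last exact: cvg_cst.
apply: nearW => k; rewrite normr_ge0/= normrM ger0_norm ?ler0n//.
apply: (@le_trans _ _ ((N k)%:R * (`|a k * z x| ^+ 3 * (1 + `|a k * z x|)))).
  exact: ler_wpM2l.
rewrite normrM (ger0_norm (a0 k)).
rewrite [leLHS](_ : _ = ((N k)%:R * a k ^+ 2) * (a k * `|z x| ^+ 3 * (1 + a k * `|z x|))); last by ring.
by rewrite ler_piMl// !mulr_ge0 ?addr_ge0 ?mulr_ge0 ?exprn_ge0.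
Unshelve. all: by end_near.
Qed.

(** The error for one summand is o(1/N), so that it may be added of order N times. As [z] is
    centred, its mean sine is the mean of the remainder sin y - y. *)
Lemma cf_one_variable (N : nat -> nat) : (forall k, (k <= N k)%N) ->
  (fun k => (N k)%:R * (`|\int[m]_x cos ((Num.sqrt (N k)%:R)^-1 * z x) -
      expR (- s2 / (2 * (N k)%:R))| + `|\int[m]_x sin ((Num.sqrt (N k)%:R)^-1 * z x)|))
    @ \oo --> (0 : R).
Proof.
move=> Nk; pose a k : R := (Num.sqrt (N k)%:R)^-1.
pose f1 (y : R) := cos y - 1 + y ^+ 2 / 2; pose f2 (y : R) := sin y - y.
have cf1 : continuous f1.
  move=> y; apply: cvgD; first by apply: cvgB; [exact: continuous_cos|exact: cvg_cst].
  by apply: cvgM; [exact: exprn_continuous|exact: cvg_cst].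
have cf2 : continuous f2 by move=> y; apply: cvgB; [exact: continuous_sin|exact: cvg_id].
have b1 y : `|f1 y| <= 2 * y ^+ 2.
  by have [h _] := cos_taylor y; rewrite (le_trans h)// ler_peMl ?sqr_ge0// ler1n.
have b1' y : `|f1 y| <= `|y| ^+ 3 * (1 + `|y|).
  have [_ h] := cos_taylor y; rewrite (le_trans h)// ler_wpM2l ?exprn_ge0//.
  by rewrite lerDr.
have b2 y : `|f2 y| <= 2 * y ^+ 2 by have [_ ] := sin_taylor y.
have b2' y : `|f2 y| <= `|y| ^+ 3 * (1 + `|y|).
  have [h _] := sin_taylor y; rewrite (le_trans h)//.
  rewrite -(real_normK (num_real y)); have := normr_ge0 y; set t := `|y| => t0.
  by have := mulr_ge0 t0 (sqr_ge0 t); have := sqr_ge0 (t ^+ 2); nra.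
have C1 := taylor_cvg cf1 Nk b1 b1'; have C2 := taylor_cvg cf2 Nk b2 b2'.
(* This dominates N u^2 = s2^2 / (4 N) with u = s2 / (2 N), the cost of replacing 1 - u by exp(-u);
   indeed k + 1 <= 4 N when N >= k >= 1. *)
have C3 : (fun k => s2 ^+ 2 * k.+1%:R^-1) @ \oo --> (0 : R).
  rewrite [X in _ --> X](_ : 0 = s2 ^+ 2 * 0); last by rewrite mulr0.
  by apply: cvgMr; exact: cvg_harmonic.
have s20 : 0 <= s2 by apply: Rintegral_ge0 => x _; exact: sqr_ge0.
have I1 k : (N k)%:R != 0 :> R -> \int[m]_x f1 (a k * z x) =
    \int[m]_x cos (a k * z x) - 1 + s2 / (2 * (N k)%:R).
  move=> N0.
  have iA : m.-integrable setT (EFin \o (fun x => cos (a k * z x) - 1)).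
    apply: (@bint _ _ _ _ _ 2) => [|x]; last by have [] := cos_dist1 (a k * z x).
    by apply: measurable_funB => //; apply: meas_cos; exact: measurable_funM.
  have ic : m.-integrable setT (EFin \o (fun x => cos (a k * z x))).
    by apply: (@bint _ _ _ _ _ 1) => [|x]; [apply: meas_cos; exact: measurable_funM|exact: cos_max].
  have i1 : m.-integrable setT (EFin \o (cst (1 : R))).
    by apply: (@bint _ _ _ _ _ 1) => // x; rewrite normr1.
  have iB : m.-integrable setT (EFin \o (fun x => (2 * (N k)%:R)^-1 * z x ^+ 2)).
    exact: (integrableZl measurableT _ z2).
  transitivity (\int[m]_x ((cos (a k * z x) - 1) + (2 * (N k)%:R)^-1 * z x ^+ 2)).
    apply: eq_Rintegral => x _; rewrite /f1 exprMn /a exprVn sqr_sqrtr ?ler0n//.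
    by field.
  rewrite (RintegralD measurableT iA iB) (RintegralB measurableT ic i1) Rint_cst.
  by rewrite (RintegralZl _ measurableT z2) -/s2 [_ * s2]mulrC.
have I2 k : \int[m]_x f2 (a k * z x) = \int[m]_x sin (a k * z x).
  have isn : m.-integrable setT (EFin \o (fun x => sin (a k * z x))).
    by apply: (@bint _ _ _ _ _ 1) => [|x]; [exact: (meas_cont (@continuous_sin R) (measurable_funM _ _))|exact: sin_max].
  rewrite RintegralB//; last exact: (integrableZl measurableT (a k) iz).
  by rewrite (RintegralZl _ measurableT iz) z0 mulr0 subr0.
have H : (fun k => `|(N k)%:R * \int[m]_x f1 (a k * z x)| + s2 ^+ 2 * k.+1%:R^-1 +
    `|(N k)%:R * \int[m]_x f2 (a k * z x)|) @ \oo --> (0 : R).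
  rewrite [X in _ --> X](_ : 0 = `|0 : R| + 0 + `|0 : R|); last by rewrite !normr0 !addr0.
  by apply: cvgD; [apply: cvgD => //; exact: cvg_norm|exact: cvg_norm].
apply: (@squeeze_cvgr _ _ _ _ (cst 0) _ _ _ _ _ H); last exact: cvg_cst.
near=> k; have k0 : (0 < k)%N by near: k; exists 1%N.
have N0 : (0 : R) < (N k)%:R by rewrite ltr0n (leq_trans k0).
apply/andP; split; first by rewrite mulr_ge0 ?addr_ge0.
rewrite mulrDr [X in _ <= _ + X]normrM (ger0_norm (ltW N0)) I2 lerD2r//.
set C := \int[m]_x _; set u := s2 / (2 * (N k)%:R).
have u0 : 0 <= u by rewrite divr_ge0// mulr_ge0// ltW.
(* From 1 - u <= exp(-u) <= 1/(1 + u) <= 1 - u + u^2. *)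
have e1 : `|1 - u - expR (- s2 / (2 * (N k)%:R))| <= u ^+ 2.
  rewrite mulNr -/u; have h1 := expR_ge1Dx (- u).
  have h2 : expR (- u) <= 1 - u + u ^+ 2.
    rewrite expRN invf_ple ?posrE ?expR_gt0//; last by nra.
    apply: (@le_trans _ _ (1 + u)); last exact: expR_ge1Dx.
    by rewrite invf_ple ?posrE//; [|nra|nra]; rewrite -[leLHS]mul1r ler_pdivrMr; nra.
  rewrite distrC ger0_norm; lra.
rewrite (_ : C - _ = \int[m]_x f1 (a k * z x) + (1 - u - expR (- s2 / (2 * (N k)%:R)))); last first.
  by rewrite I1 ?lt0r_neq0// -/C -/u; ring.
rewrite (le_trans (ler_wpM2l (ltW N0) (ler_normD _ _)))// mulrDr lerD//.
  by rewrite normrM ger0_norm// ltW.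
apply: (@le_trans _ _ ((N k)%:R * u ^+ 2)); first by rewrite ler_pM2l.
rewrite (_ : _ * u ^+ 2 = s2 ^+ 2 / 4 * (N k)%:R^-1); last by rewrite /u; field; exact: lt0r_neq0.
rewrite -mulrA ler_wpM2l ?sqr_ge0// -invfM lef_pV2 ?posrE ?mulr_gt0 ?ltr0Sn//.
by rewrite -natrM ler_nat (leq_ltn_trans (Nk k))// ltn_Pmull// (leq_trans k0).
Unshelve. all: by end_near.
Qed.

End one_variable.

Section clt.
Context {R : realType} {dO dX : measure_display} {TO : measurableType dO}
  {TX : measurableType dX} (P : probability TO R) (p : nat).
Variables (X : 'I_p -> nat -> TO -> TX) (m : 'I_p -> probability TX R).
Hypothesis mX : forall k i, measurable_fun setT (X k i).
Hypothesis indX : mutually_independent P (fun ki : 'I_p * nat => X ki.1 ki.2).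
Hypothesis lawX : forall k i A, measurable A -> P (X k i @^-1` A) = m k A.
Variables (r : 'I_p -> R) (N : nat -> nat) (n : 'I_p -> nat -> nat).
Hypothesis Nk : forall l, (l <= N l)%N.
Hypothesis nE : forall k l, (n k l)%:R = r k * (N l)%:R.
Variable z : 'I_p -> TX -> R.
Hypothesis mz : forall k, measurable_fun setT (z k).
Hypothesis z2 : forall k, (m k).-integrable setT (EFin \o (fun x => z k x ^+ 2)).
Hypothesis z0 : forall k, \int[m k]_x z k x = 0.

(** Comparing every summand of group [k] with the factor exp(- s2 k / (2 N)), the product of the r_k
    N factors of each group is exactly the limit, and the total error is a combination with weights
    r_k of the quantities of [cf_one_variable]. *)
Theorem clt_cf c :
  (fun l => \int[P]_w cos ((Num.sqrt (N l)%:R)^-1 *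
      \sum_k \sum_(i < n k l) z k (X k i w) + c)) @ \oo -->
  expR (- (\sum_k r k * \int[m k]_x z k x ^+ 2) / 2) * cos c.
Proof.
pose a l : R := (Num.sqrt (N l)%:R)^-1.
pose s2 k := \int[m k]_x z k x ^+ 2.
pose b l k : R := expR (- s2 k / (2 * (N l)%:R)).
pose dl l k : R := `|\int[m k]_x cos (a l * z k x) - b l k| + `|\int[m k]_x sin (a l * z k x)|.
pose s l := [seq (k, i) | k <- index_enum 'I_p, i <- iota 0 (n k l)].
have us l : uniq (s l).
  apply: allpairs_uniq_dep; first exact: index_enum_uniq.
    by move=> k _; exact: iota_uniq.
  by move=> [k i] [k' i'] _ _ /= [-> ->].
have sumE (V : nmodType) l (F : 'I_p -> nat -> V) :
    \sum_(j <- s l) F j.1 j.2 = \sum_k \sum_(i < n k l) F k i.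
  rewrite big_allpairs_dep; apply: eq_bigr => k _ /=.
  by rewrite -[in LHS](subn0 (n k l)) -/(index_iota 0 (n k l)) big_mkord.
have s20 k : 0 <= s2 k by apply: Rintegral_ge0 => x _; exact: sqr_ge0.
have bnd l : (0 < l)%N -> `|\int[P]_w cos (a l * \sum_k \sum_(i < n k l) z k (X k i w) + c) -
    expR (- (\sum_k r k * s2 k) / 2) * cos c| <= \sum_k r k * ((N l)%:R * dl l k).
  move=> l0; have N0 : (N l)%:R != 0 :> R by rewrite pnatr_eq0 -lt0n (leq_trans l0).
  have := @cf_sum_approx R _ _ TO TX P _ (fun ki : 'I_p * nat => X ki.1 ki.2)
    (fun ki => mX ki.1 ki.2) indX (fun ki x => a l * z ki.1 x) _ (fun ki => b l ki.1)
    (fun ki => dl l ki.1) (s l) c (us l) _ _.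
  have -> : \sum_(i <- s l) dl l i.1 = \sum_k r k * ((N l)%:R * dl l k).
    rewrite (sumE _ l (fun k _ => dl l k)); apply: eq_bigr => k _.
    by rewrite sumr_const card_ord -[_ *+ n k l]mulr_natl nE mulrA.
  have -> : \prod_(i <- s l) b l i.1 = expR (- (\sum_k r k * s2 k) / 2).
    rewrite /b -expR_sum (sumE _ l (fun k _ => - s2 k / (2 * (N l)%:R))).
    congr expR; rewrite -sumrN mulr_suml; apply: eq_bigr => k _.
    by rewrite sumr_const card_ord -[_ *+ n k l]mulr_natl nE; field.
  have -> : \int[P]_w cos (a l * \sum_k \sum_(i < n k l) z k (X k i w) + c) =
      \int[P]_w cos (\sum_(i <- s l) a l * z i.1 (X i.1 i.2 w) + c).
    apply: eq_Rintegral => w _; congr (cos (_ + _)).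
    rewrite (sumE _ l (fun k i => a l * z k (X k i w))) mulr_sumr.
    by apply: eq_bigr => k _; rewrite mulr_sumr.
  apply.
    - by move=> ki; exact: measurable_funM.
    - by move=> ki; rewrite expR_ge0 -[leRHS]expR0 ler_expR mulNr oppr_le0 divr_ge0.
    - move=> ki _; rewrite /dl.
      rewrite (@Rint_law _ _ _ _ _ P (m ki.1) _ (mX ki.1 ki.2) (lawX ki.1 ki.2)
        (fun x => cos (a l * z ki.1 x)) 1).
      rewrite (@Rint_law _ _ _ _ _ P (m ki.1) _ (mX ki.1 ki.2) (lawX ki.1 ki.2)
        (fun x => sin (a l * z ki.1 x)) 1)//.
      + exact: (meas_cont (@continuous_sin R) (measurable_funM _ _)).
      + by move=> x; exact: sin_max.
      + by apply: meas_cos; exact: measurable_funM.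
      + by move=> x; exact: cos_max.
have H : (fun l => \sum_k r k * ((N l)%:R * dl l k)) @ \oo --> (0 : R).
  rewrite [X in _ --> X](_ : 0 = \sum_(k < p) r k * 0); last first.
    by rewrite big1// => k _; rewrite mulr0.
  apply: cvg_sumR => k; apply: cvgMr.
  exact: (cf_one_variable (mz k) (z2 k) (z0 k) Nk).
apply/cvgrPdist_le => e e0; near=> l.
rewrite distrC (le_trans (bnd l _))//; first by near: l; exists 1%N.
rewrite (le_trans (ler_norm _))//; near: l.
by have /cvgr0Pnorm_le/(_ _ e0) := H.
Unshelve. all: by end_near.
Qed.

End clt.

(** * Differential calculus on row vectors *)

Lemma Rint_lincomb {R : realType} {d : measure_display} {T : measurableType d}
    (mu : {measure set T -> \bar R}) (D : set T) (I : Type) (s : seq I) (a : I -> R)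
    (u : I -> T -> R) : measurable D ->
  (forall i, mu.-integrable D (EFin \o u i)) ->
  mu.-integrable D (EFin \o (fun x => \sum_(i <- s) a i * u i x)) /\
  \int[mu]_(x in D) (\sum_(i <- s) a i * u i x) =
  \sum_(i <- s) a i * \int[mu]_(x in D) u i x.
Proof.
move=> mD iu; elim: s => [|i s [IH1 IH2]].
  rewrite big_nil (_ : (fun x => _) = cst 0).
    split; first exact: integrable0.
    by rewrite Rintegral_cst// mul0r.
  by apply/funext => x; rewrite big_nil.
have i1 : mu.-integrable D (EFin \o (fun x => a i * u i x)).
  exact: (integrableZl mD (a i) (iu i)).
rewrite (_ : (fun x => _) = (fun x => a i * u i x + \sum_(i <- s) a i * u i x)); last first.
  by apply/funext => x; rewrite big_cons.
split; first exact: (integrableD mD i1 IH1).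
by rewrite big_cons RintegralD// (RintegralZl (a i) mD (iu i)) IH2.
Qed.

Section directional.
Context {R : realType} {q : nat}.
Implicit Types (f g : 'rV[R]_q -> R) (v e h : 'rV[R]_q).

(** Reduces a directional derivative to a derivative on the real line, where the one-variable chain
    rule applies. *)
Lemma is_derive_line f v e df :
  is_derive v e f df <-> is_derive (0 : R) 1 (fun t : R => f (t *: e + v)) df.
Proof.
have E : (fun h : R => h^-1 *: ((fun t : R => f (t *: e + v)) (h *: (1 : R) + 0) -
      (fun t : R => f (t *: e + v)) 0)) =
    (fun h : R => h^-1 *: (f (h *: e + v) - f v)).
  by apply/funext => h; rewrite addr0 scale0r add0r /GRing.scale/= mulr1.
by split => -[D V]; split; move: D V; rewrite /derivable /derive E.
Qed.

Lemma is_derive_shift f v e t df : is_derive (t *: e + v) e f df ->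
  is_derive t 1 (fun t : R => f (t *: e + v)) df.
Proof.
have E : (fun h : R => h^-1 *: ((fun t : R => f (t *: e + v)) (h *: (1 : R) + t) -
      (fun t : R => f (t *: e + v)) t)) =
    (fun h : R => h^-1 *: (f (h *: e + (t *: e + v)) - f (t *: e + v))).
  by apply/funext => h; rewrite addrA -scalerDl /GRing.scale/= mulr1.
by move=> -[D V]; split; move: D V; rewrite /derivable /derive E.
Qed.

Lemma is_derive_comp_real f v e df (g : R -> R) dg :
  is_derive v e f df -> is_derive (f v) 1 g dg -> is_derive v e (fun v => g (f v)) (dg * df).
Proof.
move=> /is_derive_line Df Dg; apply/is_derive_line.
by apply: (@is_derive1_comp _ g (fun t => f (t *: e + v))); rewrite scale0r add0r.
Qed.

(** Phrased through partial derivatives, in the same shape as [C3]; differentiability along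
    arbitrary directions is recovered in [C1_increment]. *)
Definition C1 f := continuous f /\
  forall i, (forall v, derivable f v (evec R i)) /\ continuous (pderiv i f).

Definition C2 f := C1 f /\ forall i, C1 (pderiv i f).

Lemma C1_is_derive f i v : C1 f -> is_derive v (evec R i) f (pderiv i f v).
Proof. by move=> [_ /(_ i)[h _]]; exact: DeriveDef. Qed.

Lemma C1_intro f (df : 'I_q -> 'rV[R]_q -> R) : continuous f ->
  (forall i v, is_derive v (evec R i) f (df i v)) -> (forall i, continuous (df i)) ->
  C1 f /\ forall i, pderiv i f = df i.
Proof.
move=> cf Hd cd; have E i : pderiv i f = df i.
  by apply/funext => v; rewrite /pderiv; apply: derive_val.
by split => //; split => // i; split => [v|]; [case: (Hd i v)|rewrite E].
Qed.

Lemma C1_cst (a : R) : C1 (cst a) /\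
  forall i, pderiv i (cst a : 'rV[R]_q -> R) = cst 0.
Proof.
have c b : continuous (cst b : 'rV[R]_q -> R).
  exact: (@cst_continuous _ _ b).
by apply: C1_intro => // i v; exact: is_derive_cst.
Qed.

Lemma C1D f g : C1 f -> C1 g ->
  C1 (fun v => f v + g v) /\ forall i, pderiv i (fun v => f v + g v) = (fun v => pderiv i f v + pderiv i g v).
Proof.
move=> Cf Cg; have [cf hf] := Cf; have [cg hg] := Cg.
apply: C1_intro => [v|i v|i v].
- exact: cvgD (cf v) (cg v).
- by apply: is_deriveD; exact: C1_is_derive.
- exact: cvgD ((hf i).2 v) ((hg i).2 v).
Qed.

Lemma C1M f g : C1 f -> C1 g ->
  C1 (fun v => f v * g v) /\ forall i, pderiv i (fun v => f v * g v) =
    (fun v => f v * pderiv i g v + g v * pderiv i f v).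
Proof.
move=> Cf Cg; have [cf hf] := Cf; have [cg hg] := Cg.
apply: C1_intro => [v|i v|i v].
- exact: cvgM (cf v) (cg v).
- by apply: is_deriveM; exact: C1_is_derive.
- exact: cvgD (cvgM (cf v) ((hg i).2 v)) (cvgM (cg v) ((hf i).2 v)).
Qed.

Lemma C1_comp (g g' : R -> R) f : C1 f -> continuous (fun v => g (f v)) ->
  (forall v, is_derive (f v) 1 g (g' (f v))) -> continuous (fun v => g' (f v)) ->
  C1 (fun v => g (f v)) /\ forall i, pderiv i (fun v => g (f v)) = (fun v => g' (f v) * pderiv i f v).
Proof.
move=> Cf cgf Hd cg'; have [cf hf] := Cf.
apply: C1_intro => // [i v|i v].
- exact: is_derive_comp_real (C1_is_derive i v Cf) (Hd v).
- exact: cvgM (cg' v) ((hf i).2 v).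
Qed.

Lemma C1_exp f : C1 f -> C1 (fun v => expR (f v)) /\
  forall i, pderiv i (fun v => expR (f v)) = (fun v => expR (f v) * pderiv i f v).
Proof.
move=> Cf; have [cf _] := Cf.
have ce : continuous (fun v => expR (f v)).
  by move=> v; exact: continuous_comp (cf v) (@continuous_expR R (f v)).
exact: C1_comp.
Qed.

Lemma C1_ln f : C1 f -> (forall v, 0 < f v) -> C1 (fun v => ln (f v)) /\
  forall i, pderiv i (fun v => ln (f v)) = (fun v => (f v)^-1 * pderiv i f v).
Proof.
move=> Cf f0; have [cf _] := Cf.
apply: (C1_comp (g' := fun x => x^-1)) => //.
- by move=> v; exact: continuous_comp (cf v) (continuous_ln (f0 v)).
- by move=> v; exact: is_derive1_ln.
- by move=> v; apply: (cvgV _ (cf v)); rewrite gt_eqF.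
Qed.

Lemma C2_cst (a : R) : C2 (cst a).
Proof.
have [C E] := C1_cst a; split; first exact: C.
move=> i; rewrite E.
by have [] := C1_cst 0.
Qed.

Lemma C2D f g : C2 f -> C2 g -> C2 (fun v => f v + g v).
Proof.
move=> [Cf Df] [Cg Dg]; have [C E] := C1D Cf Cg; split; first exact: C.
move=> i; rewrite E.
by have [] := C1D (Df i) (Dg i).
Qed.

Lemma C2M f g : C2 f -> C2 g -> C2 (fun v => f v * g v).
Proof.
move=> [Cf Df] [Cg Dg]; have [C E] := C1M Cf Cg; split; first exact: C.
move=> i; rewrite E.
have [h1 _] := C1M Cf (Dg i); have [h2 _] := C1M Cg (Df i).
by have [] := C1D h1 h2.
Qed.

Lemma C2_exp f : C2 f -> C2 (fun v => expR (f v)).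
Proof.
move=> [Cf Df]; have [C E] := C1_exp Cf; split; first exact: C.
move=> i; rewrite E.
by have [] := C1M C (Df i).
Qed.

Lemma C2_ln f : C2 f -> (forall v, 0 < f v) -> C2 (fun v => ln (f v)).
Proof.
move=> [Cf Df] f0; have [C E] := C1_ln Cf f0; split; first exact: C.
move=> i; rewrite E.
(* The factor 1 / f is exp(- ln f), so its smoothness follows from that of [ln f] just obtained. *)
have [h1 _] := C1_cst (-1); have [h2 _] := C1M h1 C; have [h3 _] := C1_exp h2.
have [h4 _] := C1M h3 (Df i); move: h4; congr C1; apply/funext => v.
by rewrite mulN1r expRN lnK// posrE.
Qed.

Lemma C1_sum (I : Type) (s : seq I) (f : I -> 'rV[R]_q -> R) : (forall i, C1 (f i)) ->
  C1 (fun v => \sum_(i <- s) f i v) /\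
  forall j, pderiv j (fun v => \sum_(i <- s) f i v) = (fun v => \sum_(i <- s) pderiv j (f i) v).
Proof.
move=> Cf; elim: s => [|i s [IH1 IH2]].
  have -> : (fun v => \sum_(i <- [::]) f i v) = cst 0 by apply/funext => v; rewrite big_nil.
  split; first exact: (C1_cst 0).1.
  by move=> j; rewrite (C1_cst 0).2; apply/funext => v; rewrite big_nil.
have -> : (fun v => \sum_(i <- i :: s) f i v) = (fun v => f i v + \sum_(i <- s) f i v).
  by apply/funext => v; rewrite big_cons.
split; first exact: (C1D (Cf i) IH1).1.
move=> j; rewrite (C1D (Cf i) IH1).2 IH2.
by apply/funext => v; rewrite big_cons.
Qed.

Lemma C2_sum (I : Type) (s : seq I) (f : I -> 'rV[R]_q -> R) : (forall i, C2 (f i)) ->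
  C2 (fun v => \sum_(i <- s) f i v).
Proof.
move=> Cf; have [C E] := C1_sum s (fun i => (Cf i).1).
split; first exact: C.
move=> j; rewrite E.
by have [] := C1_sum s (fun i => (Cf i).2 j).
Qed.

Lemma C3_C2 f : C3 f -> C2 f.
Proof.
move=> [h0 h1 h2 _]; split; first by split.
by move=> i; split; [exact: (h1 i).2|move=> j; exact: h2].
Qed.

Lemma C2_coord i : C2 (fun v => v 0 i) /\
  forall j, pderiv j (fun v => v 0 i) = cst (i == j)%:R.
Proof.
have D j v : is_derive v (evec R j) (fun v : 'rV[R]_q => v 0 i) (i == j)%:R.
  apply/is_derive_line; rewrite /evec.
  rewrite (_ : (fun t : R => _) = (fun t => t * (i == j)%:R + v 0 i)); last first.
    by apply/funext => t; rewrite !mxE eqxx/= eq_sym.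
  by apply: is_derive_eq; rewrite /GRing.scale/= !mulr1 ?mulr0 ?addr0 ?add0r.
have [C E] := @C1_intro (fun v => v 0 i) (fun j => cst (i == j)%:R)
  (@coord_continuous _ _ _ 0 i) D (fun j v => cvg_cst _).
split; last exact: E.
split; first exact: C.
by move=> j; rewrite E; have [] := C1_cst (i == j)%:R.
Qed.

Lemma MVT_line f i v (c : R) : C1 f -> exists2 s : R, `|s| <= `|c| &
  f (c *: evec R i + v) - f v = pderiv i f (s *: evec R i + v) * c.
Proof.
move=> Cf; pose F (t : R) := f (t *: evec R i + v).
have dF (t : R) : is_derive t 1 F (pderiv i f (t *: evec R i + v)).
  exact/is_derive_shift/C1_is_derive.
have cF : continuous F.
  by move=> t; apply: differentiable_continuous; apply/derivable1_diffP; have [] := dF t.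
have F0 : F 0 = f v by rewrite /F scale0r add0r.
have [c0|c0] := leP 0 c.
  have [|s /itvP si E] := @MVT_segment R F (fun t => pderiv i f (t *: evec R i + v)) 0 c c0.
    exact: continuous_subspaceT.
  exists s; first by rewrite !ger0_norm ?si.
  by rewrite -F0 E subr0.
have [|s /itvP si E] := @MVT_segment R F (fun t => pderiv i f (t *: evec R i + v)) c 0 (ltW c0).
  exact: continuous_subspaceT.
exists s; first by rewrite !ler0_norm ?si ?(ltW c0)// lerN2 si.
by rewrite -F0 -/(F c) -opprB E sub0r mulrN opprK.
Qed.

Lemma norm_evec_le (i : 'I_q) (a : R) : `|a *: evec R i| <= `|a|.
Proof.
apply: mx_norm_le => // k l; rewrite !mxE normrM ler_piMr//.
by case: (_ && _); rewrite ?normr1 ?normr0.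
Qed.

(** Continuous partial derivatives give differentiability: the displacement is made one coordinate
    at a time, the mean value theorem evaluates each leg, and each intermediate derivative is within
    [e / H] of its value at [v]. *)
Lemma C1_increment f v h (e : R) : C1 f -> 0 < e ->
  exists2 d : R, 0 < d & forall t : R, `|t| < d ->
  `|f (t *: h + v) - f v - t * \sum_i h 0 i * pderiv i f v| <= `|t| * e.
Proof.
have shuffle (b x u y z : R) : b + x - u - (y + z) = b - u - z + (x - y) by ring.
(* All intermediate points lie within |t| H of [v]; the 1 keeps [H] positive when [h] is 0. *)
move=> Cf e0; pose H := 1 + \sum_i `|h 0 i|.
have S0 : 0 <= \sum_i `|h 0 i| by apply: sumr_ge0.
have H0 : 0 < H by rewrite ltr_pwDl.
have eH : 0 < e / H by rewrite divr_gt0.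
have [d d0 dP] : exists2 d : R, 0 < d & forall w, ball v d w ->
    forall i, `|pderiv i f v - pderiv i f w| < e / H.
  have [_ hf] := Cf.
  suff : forall l : seq 'I_q, exists2 d : R, 0 < d & forall w, ball v d w ->
      forall i, i \in l -> `|pderiv i f v - pderiv i f w| < e / H.
    move=> /(_ (enum 'I_q))[d d0 dP]; exists d => // w vw i.
    by apply: (dP _ vw); rewrite mem_enum.
  elim=> [|i l [d d0 dP]]; first by exists 1.
  have : \forall w \near v, `|pderiv i f v - pderiv i f w| < e / H.
    exact: (proj1 (cvgrPdist_lt _ _) ((hf i).2 v) _ eH).
  move=> /nbhs_ballP[d' /= d'0 dP'].
  exists (Num.min d d') => [|w vw j]; first by rewrite lt_min d0.
  rewrite inE => /orP[/eqP->|jl].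
    by apply: dP'; apply: le_ball vw; rewrite ge_min lexx orbT.
  by apply: dP jl; apply: le_ball vw; rewrite ge_min lexx.
exists (d / H); first by rewrite divr_gt0.
move=> t td.
have key (l : seq 'I_q) : \sum_(i <- l) `|h 0 i| <= \sum_i `|h 0 i| ->
    `|f (t *: (\sum_(i <- l) h 0 i *: evec R i) + v) - f v -
      t * \sum_(i <- l) h 0 i * pderiv i f v| <= `|t| * (\sum_(i <- l) `|h 0 i|) * (e / H).
  elim: l => [_|i l IH]; first by rewrite !big_nil scaler0 add0r mulr0 !subrr normr0 mulr0 mul0r.
  rewrite !big_cons => hl.
  have hl' : \sum_(i <- l) `|h 0 i| <= \sum_i `|h 0 i| by rewrite (le_trans _ hl)// lerDr.
  have {}IH := IH hl'.
  set w := \sum_(i <- l) h 0 i *: _ in IH *.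
  have [s ss E] := MVT_line i (t *: w + v) (t * h 0 i) Cf.
  have wl : `|w| <= \sum_(i <- l) `|h 0 i|.
    rewrite /w (le_trans (ler_norm_sum _ _ _))//; apply: ler_sum => j _.
    exact: norm_evec_le.
  have near_v : ball v d (s *: evec R i + (t *: w + v)).
    rewrite -ball_normE/=.
    rewrite (_ : v - _ = - (s *: evec R i + t *: w)); last by rewrite addrA opprD addrCA subrr addr0.
    rewrite normrN (le_lt_trans (ler_normD _ _))//.
    rewrite (@le_lt_trans _ _ (`|t| * \sum_i `|h 0 i|))//.
      rewrite (le_trans _ (ler_wpM2l (normr_ge0 t) hl))// mulrDr lerD//.
        by rewrite (le_trans (norm_evec_le _ _))// (le_trans ss)// normrM.
      by rewrite normrZ ler_wpM2l.
    rewrite (@le_lt_trans _ _ (`|t| * H))//; first by rewrite ler_wpM2l// lerDr.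
    by rewrite -ltr_pdivlMr.
  have Ei := dP _ near_v i.
  rewrite (_ : t *: (h 0 i *: evec R i + w) + v = (t * h 0 i) *: evec R i + (t *: w + v)); last first.
    by rewrite scalerDr scalerA addrA.
  set A := f (_ + (_ + _)) in E *; set B := f (t *: w + v) in E IH.
  set S := \sum_(i <- l) h 0 i * _ in IH *.
  rewrite (_ : A - _ - _ = (B - f v - t * S) +
    t * h 0 i * (pderiv i f (s *: evec R i + (t *: w + v)) - pderiv i f v)); last first.
    have -> : A = B + pderiv i f (s *: evec R i + (t *: w + v)) * (t * h 0 i).
      by rewrite -E addrC subrK.
    rewrite mulrDr mulrBr [_ * (t * h 0 i)]mulrC [t * (h 0 i * _)]mulrA.
    exact: shuffle.
  rewrite (le_trans (ler_normD _ _))// [X in _ <= X * _]mulrDr [leRHS]mulrDl [leRHS]addrC lerD//.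
  by rewrite 2!normrM ler_wpM2l ?mulr_ge0// distrC ltW.
have := key (index_enum 'I_q) (lexx _).
have -> : \sum_(i <- index_enum 'I_q) h 0 i *: evec R i = h by rewrite /evec -row_sum_delta.
move=> h1; rewrite (le_trans h1)// -mulrA ler_wpM2l// mulrCA ler_piMr ?(ltW e0)//.
by rewrite ler_pdivrMr// mul1r lerDr.
Qed.

Lemma C1_chain f v h (t : R) : C1 f ->
  is_derive t 1 (fun t : R => f (v + t *: h)) (\sum_i h 0 i * pderiv i f (v + t *: h)).
Proof.
move=> Cf; have -> : (fun t : R => f (v + t *: h)) = (fun t : R => f (t *: h + v)).
  by apply/funext => s; rewrite addrC.
apply: is_derive_shift; rewrite addrC; set w := v + _; set L := \sum_i _.
have H : (fun s : R => s^-1 *: (f (s *: h + w) - f w)) @ 0^' --> L.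
  apply/cvgrPdist_le => e e0.
  have [d d0 dP] := C1_increment w h Cf e0.
  near=> s; have s0 : s != 0 by near: s; exact: nbhs_dnbhs_neq.
  have sd : `|s| < d.
    by near: s; apply: dnbhs0_lt.
  have := dP s sd; rewrite -/L => hs.
  rewrite (_ : L - _ = - (s^-1 * (f (s *: h + w) - f w - s * L))); last first.
    rewrite mulrBr mulrA mulVf// mul1r opprB.
    by [].
  by rewrite normrN normrM normfV ler_pdivrMl ?normr_gt0// .
apply: DeriveDef; first by apply/cvg_ex; exists L.
by apply/cvg_lim.
Unshelve. all: by end_near.
Qed.

(** The fundamental theorem of calculus for each component of the gradient along the segment. The
    first index of [hess] is the outer derivative, the one taken along the segment, so the
    displacement acts as a row vector on the left; the sign is that of the observed information. *)
Lemma grad_taylor f v w : C2 f ->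
  grad f w = grad f v - (w - v) *m
    (\matrix_(i, j) Rintegral lebesgue_measure `[0, 1]
       (fun t : R => (- hess f (v + t *: (w - v))) i j)).
Proof.
move=> [C1f C2f]; set h := w - v.
have line : continuous (fun t : R => v + t *: h).
  move=> t; apply: cvgD; first exact: cvg_cst.
  by apply: cvgZl; exact: cvg_id.
apply/rowP => j; rewrite !mxE.
pose k i (t : R) := pderiv i (pderiv j f) (v + t *: h).
have ck i : continuous (k i).
  move=> t; apply: (@continuous_comp _ _ _ (fun t : R => v + t *: h) (pderiv i (pderiv j f))).
    exact: line.
  by have [_ /(_ i)[_ c]] := C2f j; exact: c.
have ik i : lebesgue_measure.-integrable `[0, 1] (EFin \o k i).
  apply: continuous_compact_integrable; first exact: segment_compact.
  exact: continuous_subspaceT.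
pose F (t : R) := pderiv j f (v + t *: h).
have dF (t : R) : is_derive t 1 F (\sum_i h 0 i * k i t) by exact: C1_chain.
have cF : continuous F.
  by move=> t; apply: differentiable_continuous; apply/derivable1_diffP; have [] := dF t.
have FTC := @continuous_FTC2 R (fun t => \sum_i h 0 i * k i t) F 0 1 ltr01.
have E : \int[lebesgue_measure]_(t in `[0, 1]) (\sum_i h 0 i * k i t) = F 1 - F 0.
  rewrite /Rintegral FTC//.
  - apply: continuous_subspaceT => t; apply: cvg_sumR => i.
    by apply: cvgMr; exact: ck.
  - split; first by move=> t _; have [] := dF t.
    + exact/cvg_at_right_filter/cF.
    + exact/cvg_at_left_filter/cF.
  - by move=> t _; rewrite derive1E; apply: derive_val.
have -> : pderiv j f w = F 1 by rewrite /F scale1r /h addrC subrK.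
have -> : pderiv j f v = F 0 by rewrite /F scale0r addr0.

have mI : measurable ([set` `[0, 1]] : set (measurableTypeR R)) by exact: measurable_itv.
under eq_bigr => i _.
  rewrite [X in _ * X]mxE; under eq_Rintegral do rewrite !mxE -mulN1r.
  rewrite (RintegralZl (-1) mI (ik i)) mulN1r mulrN.
  over.
by rewrite sumrN opprK -(Rint_lincomb _ _ mI ik).2 E addrC subrK.
Qed.

End directional.

Section lsub.
Context {R : realType} {S K : nat}.

Lemma lsub_continuous : continuous (fun v : 'rV[R]_(S + K) => lsubmx v).
Proof.
move=> v; apply/(@cvgrPdist_le _ _ _ (nbhs v)) => e e0.
apply/nbhs_ballP; exists e => //= w.
rewrite -ball_normE/= => vw; apply: mx_norm_le => [|i j]; first exact: ltW.
rewrite !mxE (le_trans _ (ltW vw))//.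
by have := mx_coord_le (v - w) i (lshift K j); rewrite !mxE.
Qed.

Lemma C1_lsub (f : 'rV[R]_S -> R) : C1 f -> C1 (fun v : 'rV[R]_(S + K) => f (lsubmx v)) /\
  (forall i, pderiv (lshift K i) (fun v : 'rV[R]_(S + K) => f (lsubmx v)) =
     (fun v => pderiv i f (lsubmx v))) /\
  (forall j, pderiv (rshift S j) (fun v : 'rV[R]_(S + K) => f (lsubmx v)) = cst 0).
Proof.
move=> Cf; have [cf hf] := Cf.
pose df (i : 'I_(S + K)) (v : 'rV[R]_(S + K)) := match fintype.split i with
  | inl i' => pderiv i' f (lsubmx v) | inr _ => 0 end.
have line (i : 'I_(S + K)) (t : R) (v : 'rV[R]_(S + K)) : lsubmx (t *: evec R i + v) =
    t *: lsubmx (evec R i) + lsubmx v by rewrite linearP.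
have [C E] : C1 (fun v : 'rV[R]_(S + K) => f (lsubmx v)) /\
    forall i, pderiv i (fun v : 'rV[R]_(S + K) => f (lsubmx v)) = df i.
  apply: C1_intro => [v|i v|i v].
  - by apply: continuous_comp; [exact: lsub_continuous|exact: cf].
  - apply/is_derive_line; under eq_fun do rewrite line.
    rewrite /df; case: splitP => [i' ii'|j ij].
      rewrite (_ : lsubmx (evec R i) = evec R i'); last first.
        apply/rowP => l; rewrite !mxE; congr (_ %:R); congr (_ && _).
        by rewrite -!val_eqE/= ii'.
      by apply/is_derive_line; exact: C1_is_derive.
    rewrite (_ : lsubmx (evec R i) = 0); last first.
      apply/rowP => l; rewrite !mxE/= -val_eqE/= ij.
      by rewrite ltn_eqF// ltn_addr.
    by under eq_fun do rewrite scaler0 add0r; exact: is_derive_cst.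
  - rewrite /df; case: (fintype.split i) => [i'|j]; last exact: (@C1_cst R (S + K) 0).1.1.
    apply: (@continuous_comp _ _ _ (fun v : 'rV[R]_(S + K) => lsubmx v) (pderiv i' f)).
      exact: lsub_continuous.
    exact: (hf i').2.
split => //; split => [i|j]; rewrite E /df.
  by apply/funext => v; case: (unsplitK (inl i : 'I_S + 'I_K)) => ->.
by apply/funext => v; case: (unsplitK (inr j : 'I_S + 'I_K)) => ->.
Qed.

Lemma C2_lsub (f : 'rV[R]_S -> R) : C2 f -> C2 (fun v : 'rV[R]_(S + K) => f (lsubmx v)).
Proof.
move=> [Cf Df]; have [C [E1 E2]] := C1_lsub Cf; split => // i.
rewrite -[i]splitK; case: (fintype.split i) => j /=; rewrite ?E1 ?E2.
  by have [] := C1_lsub (Df j).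
by have [] := @C1_cst R (S + K) 0.
Qed.

End lsub.

(** A pointwise limit of difference quotients with steps 1/(n+1). *)
Lemma meas_pderiv {R : realType} {q : nat} {d : measure_display} {T : measurableType d}
    (F : T -> 'rV[R]_q -> R) i v :
  (forall v, measurable_fun setT (F ^~ v)) -> (forall x, derivable (F x) v (evec R i)) ->
  measurable_fun setT (fun x => pderiv i (F x) v).
Proof.
move=> mF dF.
pose h (n : nat) x := n.+1%:R * (F x (n.+1%:R^-1 *: evec R i + v) - F x v).
apply: (@measurable_fun_cvg _ _ _ _ h) => [n|x _].
  by apply: measurable_funM => //; exact: measurable_funB.
have := dF x => /cvg_ex[l hl].
have -> : pderiv i (F x) v = l by apply/cvg_lim.
rewrite (_ : h ^~ x = (fun n => (n.+1%:R^-1)^-1 *: (F x (n.+1%:R^-1 *: evec R i + v) - F x v))); last first.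
  by apply/funext => n; rewrite /h invrK.
have /cvgr_dnbhsP := hl; apply; split.
  by move=> n; rewrite invr_neq0// pnatr_eq0.
exact: cvg_harmonic.
Qed.

(** * Identities of the multinomial logit model *)

Section multinomial_logit.
Context {R : realType} {TX TY : Type} {S K : nat}.
Variables (psi : 'rV[R]_S -> TX -> TY -> R) (y : 'I_K.+1 -> TY).
Hypothesis psi2 : forall x k, C2 (fun th => psi th x (y k)).
Local Notation lp := (logpstar psi y).
Local Notation p := (pstar psi y).

Definition logit (k : 'I_K.+1) (x : TX) (lam : 'rV[R]_(S + K)) : R :=
  gam lam k + psi (lsubmx lam) x (y k).

Definition normalizer (x : TX) (lam : 'rV[R]_(S + K)) : R := \sum_(l < K.+1) expR (logit l x lam).

Lemma normalizer_gt0 x lam : 0 < normalizer x lam.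
Proof.
rewrite /normalizer big_ord_recl ltr_pwDl ?expR_gt0//.
by apply: sumr_ge0 => i _; exact: expR_ge0.
Qed.

Lemma pstar_gt0 k x lam : 0 < p k x lam.
Proof. by rewrite divr_gt0 ?expR_gt0//; exact: normalizer_gt0. Qed.

Lemma sum_pstar x lam : \sum_k p k x lam = 1.
Proof. by rewrite -mulr_suml divff// gt_eqF//; exact: normalizer_gt0. Qed.

Lemma expR_logpstar k x lam : expR (lp k x lam) = p k x lam.
Proof. by rewrite lnK// posrE pstar_gt0. Qed.

Lemma logpstarE k x : lp k x = (fun lam => logit k x lam + -1 * ln (normalizer x lam)).
Proof.
apply/funext => lam; rewrite /logpstar /pstar ln_div ?posrE ?expR_gt0 ?normalizer_gt0//.
by rewrite expRK mulN1r.
Qed.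

Lemma gamE k : (fun lam : 'rV[R]_(S + K) => gam lam k) =
  if unlift ord0 k is Some j then (fun lam => lam 0 (rshift S j)) else cst 0.
Proof.
by apply/funext => lam; rewrite /gam; case: unliftP => [j _|//]; rewrite mxE.
Qed.

Lemma C2_gam k : C2 (fun lam : 'rV[R]_(S + K) => gam lam k) /\
  forall j, pderiv (rshift S j) (fun lam : 'rV[R]_(S + K) => gam lam k) = cst (k == lift ord0 j)%:R.
Proof.
rewrite gamE; case: unliftP => [i ->|->].
  have [C E] := @C2_coord R (S + K) (rshift S i).
  split; first exact: C.
  by move=> j; rewrite E eq_rshift; congr (cst _%:R).
split; first exact: C2_cst.
by move=> j; rewrite (C1_cst 0).2; apply/funext.
Qed.

Lemma C2_logit k x : C2 (logit k x) /\
  forall j, pderiv (rshift S j) (logit k x) = cst (k == lift ord0 j)%:R.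
Proof.
have [C1g E1] := C2_gam k; have C2p := @C2_lsub R S K _ (psi2 x k).
have [C E] := C1D C1g.1 C2p.1.
split; first exact: C2D.
move=> j; rewrite E E1 (C1_lsub (psi2 x k).1).2.2.
by apply/funext => v /=; rewrite addr0.
Qed.

Lemma C2_normalizer x : C2 (normalizer x) /\ forall j, pderiv (rshift S j) (normalizer x) =
  (fun lam => expR (logit (lift ord0 j) x lam)).
Proof.
have C k : C2 (fun lam => expR (logit k x lam)) by apply: C2_exp; have [] := C2_logit k x.
split; first exact: C2_sum.
move=> j; rewrite (C1_sum _ (fun k => (C k).1)).2; apply/funext => lam.
under eq_bigr => k _ do rewrite (C1_exp (C2_logit k x).1.1).2 (C2_logit k x).2.
rewrite (bigD1 (lift ord0 j))//= eqxx mulr1 big1 ?addr0// => k /negbTE ->.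
by rewrite mulr0.
Qed.

Lemma C2_logpstar k x : C2 (lp k x) /\ forall j lam, pderiv (rshift S j) (lp k x) lam =
  (k == lift ord0 j)%:R - p (lift ord0 j) x lam.
Proof.
have [C1l E1] := C2_logit k x; have [C1n E2] := C2_normalizer x.
have C2l : C2 (fun lam => ln (normalizer x lam)).
  by apply: C2_ln => // lam; exact: normalizer_gt0.
have Cm : C2 (fun lam => -1 * ln (normalizer x lam)).
  exact: (C2M (C2_cst _) C2l).
rewrite logpstarE; split; first exact: C2D.
move=> j lam; rewrite (C1D C1l.1 Cm.1).2 E1; congr (_ + _).
rewrite (C1M (C1_cst _).1 C2l.1).2 (C1_cst _).2 mulr0 addr0.
rewrite (C1_ln C1n.1 (normalizer_gt0 x)).2 E2 mulN1r /pstar mulrC.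
by [].
Qed.

(** Differentiates [sum_pstar] with p_k = exp(lp_k). The sum over [k] plays the role of an
    expectation at each fixed [x], so the identity is pointwise and involves no derivative of an
    integral. *)
Lemma bartlett1 x lam i : \sum_k p k x lam * pderiv i (lp k x) lam = 0.
Proof.
have C k : C1 (lp k x) by have [[]] := C2_logpstar k x.
have := (C1_sum (index_enum 'I_K.+1) (fun k => (C1_exp (C k)).1)).2 i.
rewrite (_ : (fun v => \sum_(k < K.+1) _) = cst 1); last first.
  by apply/funext => v; under eq_bigr do rewrite expR_logpstar; exact: sum_pstar.
rewrite (C1_cst 1).2 => /(congr1 (fun f => f lam)) /= E.
rewrite [RHS]E; apply: eq_bigr => k _.
by rewrite (C1_exp (C k)).2 expR_logpstar.
Qed.

Lemma bartlett2 x lam i j : \sum_k p k x lam *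
  (hess (lp k x) lam i j + grad (lp k x) lam 0 i * grad (lp k x) lam 0 j) = 0.
Proof.
have swap (a b c : R) : a * (b * c) = c * (a * b) by ring.
have C k : C2 (lp k x) by have [] := C2_logpstar k x.
have Cp k := C1M (C1_exp (C k).1).1 ((C k).2 j).
have := (C1_sum (index_enum 'I_K.+1) (fun k => (Cp k).1)).2 i.
rewrite (_ : (fun v => \sum_(k < K.+1) _) = cst 0); last first.
  by apply/funext => v; under eq_bigr do rewrite expR_logpstar; exact: bartlett1.
rewrite (C1_cst 0).2 => /(congr1 (fun f => f lam)) /= E.
rewrite [RHS]E; apply: eq_bigr => k _.
rewrite (Cp k).2 (C1_exp (C k).1).2 expR_logpstar !mxE mulrDr.
move: (pderiv i (pderiv j (lp k x)) lam) (p k x lam) (pderiv i (lp k x) lam) (pderiv j (lp k x) lam) => d a b c.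
by rewrite [a * (b * c)]swap.
Qed.

End multinomial_logit.

(** * Information matrix and covariance of the score *)

Section information.
Context {R : realType} {d : measure_display} {TX : measurableType d}
  (nu : {measure set TX -> \bar R}) {S K : nat}.
Variables (f : 'I_K.+1 -> TX -> R) (g : 'I_K.+1 -> TX -> 'rV[R]_(S + K))
  (H : 'I_K.+1 -> TX -> 'M[R]_(S + K)) (p : 'I_K.+1 -> TX -> R) (h : TX -> R)
  (r : 'I_K.+1 -> R).
Hypotheses (mf : forall k, measurable_fun setT (f k))
  (mg : forall k i, measurable_fun setT (fun x => g k x 0 i))
  (mH : forall k i j, measurable_fun setT (fun x => H k x i j))
  (f0 : forall k x, 0 <= f k x) (intf : forall k, nu.-integrable setT (EFin \o f k))
  (f1 : forall k, \int[nu]_x f k x = 1)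
  (r0 : forall k, 0 < r k) (pE : forall k x, r k * f k x = h x * p k x)
  (g2 : forall k, nu.-integrable setT (fun x => (`|g k x| ^+ 2 * f k x)%:E))
  (H1 : forall k, nu.-integrable setT (fun x => (`|H k x| * f k x)%:E)).

Lemma int_gg k i j : nu.-integrable setT (EFin \o (fun x => g k x 0 i * g k x 0 j * f k x)).
Proof.
apply: le_integrable (g2 k) => //.
  apply/measurable_EFinP; apply: measurable_funM => //; exact: measurable_funM.
move=> x _; rewrite lee_fin !normrM normr_id ler_wpM2r//.
by apply: ler_pM => //; exact: mx_coord_le.
Qed.

Lemma int_g k i : nu.-integrable setT (EFin \o (fun x => g k x 0 i * f k x)).
Proof.
have i2 : nu.-integrable setT (EFin \o (fun x => `|g k x| ^+ 2 * f k x + f k x)).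
  exact: (integrableD measurableT (g2 k) (intf k)).
apply: le_integrable i2 => //.
  by apply/measurable_EFinP; exact: measurable_funM.
move=> x _; rewrite lee_fin -[X in _ + X]mul1r -mulrDl !normrM ler_wpM2r//.
have := mx_coord_le (g k x) 0 i; have := normr_ge0 (g k x).
move: (`|g k x 0 i|) (`|g k x|) => a b b0 ab; rewrite ger0_norm; last by rewrite addr_ge0 ?sqr_ge0.
apply: (le_trans ab); nra.
Qed.

Lemma int_H k i j : nu.-integrable setT (EFin \o (fun x => H k x i j * f k x)).
Proof.
apply: le_integrable (H1 k) => //.
  by apply/measurable_EFinP; exact: measurable_funM.
by move=> x _; rewrite lee_fin !normrM normr_id ler_wpM2r//; exact: mx_coord_le.
Qed.

(** Transfers pointwise identities to the sampling laws: since r_k f_k = h p_k, the weighted sum of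
    integrals is the integral of h times the vanishing sum. *)
Lemma mixture_integral0 (u : 'I_K.+1 -> TX -> R) :
  (forall k, nu.-integrable setT (EFin \o (fun x => u k x * f k x))) ->
  (forall x, \sum_k p k x * u k x = 0) -> \sum_k r k * \int[nu]_x (u k x * f k x) = 0.
Proof.
move=> iu u0; rewrite -(Rint_lincomb _ _ measurableT iu).2.
rewrite (_ : (fun x => _) = cst 0); first by rewrite Rintegral_cst// mul0r.
apply/funext => x /=; transitivity (h x * \sum_k p k x * u k x); last by rewrite u0 mulr0.
by rewrite mulr_sumr; apply: eq_bigr => k _; rewrite mulrCA pE mulrCA [u k x * _]mulrC.
Qed.

Hypotheses (score0 : forall x i, \sum_k p k x * g k x 0 i = 0)
  (score2 : forall x i j, \sum_k p k x * (H k x i j + g k x 0 i * g k x 0 j) = 0)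
  (scoreK : forall k x j, g k x 0 (rshift S j) = (k == lift ord0 j)%:R - p (lift ord0 j) x).

Definition second_moment k : 'M[R]_(S + K) :=
  \matrix_(i, j) \int[nu]_x (g k x 0 i * g k x 0 j * f k x).
Definition score_mean k : 'rV[R]_(S + K) := \row_i \int[nu]_x (g k x 0 i * f k x).
Definition info : 'M[R]_(S + K) :=
  \sum_k r k *: (\matrix_(i, j) \int[nu]_x (- H k x i j * f k x) : 'M[R]_(S + K)).
Definition score_cov : 'M[R]_(S + K) :=
  \sum_k r k *: (second_moment k - (score_mean k)^T *m score_mean k).

Lemma info_second_moment : info = \sum_k r k *: second_moment k.
Proof.
apply/matrixP => i j; rewrite !summxE; apply/eqP; rewrite -subr_eq0 -sumrB.
have iu k : nu.-integrable setT
    (EFin \o (fun x => (H k x i j + g k x 0 i * g k x 0 j) * f k x)).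
  rewrite (_ : _ \o _ = (fun x => (H k x i j * f k x)%:E +
      (g k x 0 i * g k x 0 j * f k x)%R%:E)%E); last first.
    by apply/funext => x /=; rewrite -EFinD mulrDl.
  exact: (integrableD measurableT (int_H k i j) (int_gg k i j)).
rewrite -oppr_eq0 -sumrN -[X in _ == X](mixture_integral0 iu (fun x => score2 x i j)).
apply/eqP; apply: eq_bigr => k _; rewrite !mxE -mulrBr -mulrN; congr (_ * _).
under [in RHS]eq_Rintegral do rewrite mulrDl.
rewrite (RintegralD measurableT (int_H k i j) (int_gg k i j)) opprB addrC; congr (_ + _).
under eq_Rintegral do rewrite mulNr -mulN1r.
by rewrite (RintegralZl (-1) measurableT (int_H k i j)) mulN1r opprK.
Qed.

Lemma info_sym : info^T = info.
Proof.
rewrite info_second_moment; apply/matrixP => i j; rewrite mxE !summxE.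
apply: eq_bigr => k _; rewrite !mxE; congr (_ * _).
by apply: eq_Rintegral => x _; rewrite [X in X * _]mulrC.
Qed.

Lemma score_mean_sum0 : \sum_k r k *: score_mean k = 0.
Proof.
apply/rowP => i; rewrite summxE [RHS]mxE.
transitivity (\sum_k r k * \int[nu]_x (g k x 0 i * f k x)).
  by apply: eq_bigr => k _; rewrite !mxE.
exact: (mixture_integral0 (int_g ^~ i) (fun x => score0 x i)).
Qed.

Lemma score_mean_lift j :
  r (lift ord0 j) *: score_mean (lift ord0 j) = delta_mx 0 (rshift S j) *m info.
Proof.
rewrite -rowE; apply/rowP => i; rewrite !mxE info_second_moment summxE.
(* By [scoreK] this is - p_j g_k,i, whose sum weighted by p_k vanishes by [score0]. After
   integration the first term is an entry of the information and the second survives only for k =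
   j. *)
pose u k x := g k x 0 (rshift S j) * g k x 0 i - (k == lift ord0 j)%:R * g k x 0 i.
have iu k : nu.-integrable setT (EFin \o (fun x => u k x * f k x)).
  rewrite (_ : _ \o _ = (fun x => (g k x 0 (rshift S j) * g k x 0 i * f k x)%R%:E -
      ((k == lift ord0 j)%:R * (g k x 0 i * f k x))%R%:E)%E); last first.
    by apply/funext => x /=; rewrite -EFinB mulrBl [in RHS]mulrA.
  apply: (integrableB measurableT (int_gg _ _ _)).
  exact: (integrableZl measurableT _ (int_g k i)).
have u0 x : \sum_k p k x * u k x = 0.
  transitivity (- p (lift ord0 j) x * \sum_k p k x * g k x 0 i); last by rewrite score0 mulr0.
  rewrite mulr_sumr; apply: eq_bigr => k _; rewrite /u -mulrBl scoreK mulrCA; congr (_ * _).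
  by rewrite addrC addKr.
have := mixture_integral0 iu u0.
under eq_bigr => k _.
  under eq_Rintegral do rewrite mulrBl -[X in _ - X]mulrA.
  rewrite (RintegralB measurableT (int_gg _ _ _) (integrableZl measurableT _ (int_g k i))).
  rewrite (RintegralZl _ measurableT (int_g k i)) mulrBr.
  over.
rewrite sumrB => /eqP; rewrite subr_eq0 => /eqP E.

under [RHS]eq_bigr do rewrite 2!mxE.
rewrite E [RHS](bigD1 (lift ord0 j))//= eqxx mul1r big1 ?addr0// => k /negbTE ->.
by rewrite mul0r mulr0.
Qed.

Lemma score_mean_image k :
  exists2 e : 'rV[R]_(S + K), lsubmx e = 0 & r k *: score_mean k = e *m info.
Proof.
have l0 j : lsubmx (delta_mx 0 (rshift S j) : 'rV[R]_(S + K)) = 0.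
  by apply/rowP => i; rewrite !mxE eq_lrshift.
have [j ->|->] := unliftP ord0 k.
  by exists (delta_mx 0 (rshift S j)); [exact: l0|exact: score_mean_lift].
(* Group 0 has no gamma coordinate; its mean is obtained from the others through
   [score_mean_sum0]. *)
exists (- \sum_j delta_mx 0 (rshift S j)).
  by rewrite linearN linear_sum big1 ?oppr0// => j _; exact: l0.
have /eqP := score_mean_sum0; rewrite big_ord_recl addr_eq0 => /eqP ->.
rewrite mulNmx mulmx_suml; congr (- _); apply: eq_bigr => j _.
exact: score_mean_lift.
Qed.

Lemma score_cov_info : exists2 A, ulsubmx A = 0 & score_cov = info - info *m A *m info.
Proof.
have [e el eE] : exists2 e : 'I_K.+1 -> 'rV[R]_(S + K), forall k, lsubmx (e k) = 0 &
    forall k, r k *: score_mean k = e k *m info.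
  have /choice[e eP] : forall k, exists e : 'rV[R]_(S + K),
      lsubmx e = 0 /\ r k *: score_mean k = e *m info.
    by move=> k; have [e e0 eE] := score_mean_image k; exists e.
  by exists e => k; have [] := eP k.
(* With r_k m_k = e_k I and I symmetric, r_k m_k^T m_k is r_k^-1 I e_k^T e_k I; the theta-block
   vanishes because each [e k] has no theta part. *)
exists (\sum_k (r k)^-1 *: ((e k)^T *m e k)).
  apply/matrixP => i j; rewrite mxE [in LHS]mxE summxE [RHS]mxE big1// => k _.
  have := congr1 (fun v : 'rV[R]_S => v 0 i) (el k).
  by rewrite !mxE => E; rewrite big_ord1 mxE E mul0r mulr0.
rewrite /score_cov; under eq_bigr do rewrite scalerBr.
rewrite sumrB -info_second_moment; congr (_ - _).
move: info info_sym eE => I symI eE.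
rewrite mulmx_sumr mulmx_suml; apply: eq_bigr => k _.
have -> : score_mean k = (r k)^-1 *: (e k *m I).
  by rewrite -eE scalerA mulVf ?scale1r// gt_eqF.
rewrite [(_ *: _)^T]linearZ/= -scalemxAl -!scalemxAr -scalemxAl !scalerA trmx_mul symI !mulmxA.
by rewrite mulfV ?mul1r// gt_eqF.
Qed.

Lemma score_cov_sandwich : info \in unitmx ->
  ulsubmx (invmx info *m score_cov *m invmx info) = ulsubmx (invmx info).
Proof.
move=> uI; have [A A0 ->] := score_cov_info.
rewrite mulmxBr mulmxBl mulVmx// mul1mx !mulmxA mulVmx// mul1mx -mulmxA mulmxV// mulmx1.
apply/matrixP => i j; have := congr1 (fun M : 'M[R]_S => M i j) A0.
by rewrite !mxE => ->; rewrite subr0.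
Qed.

Lemma score_cov_sym : score_cov^T = score_cov.
Proof.
apply/matrixP => i j; rewrite mxE !summxE; apply: eq_bigr => k _.
rewrite !mxE !big_ord1 !mxE; congr (_ * (_ - _)); last exact: mulrC.
by apply: eq_Rintegral => x _; rewrite [X in X * _]mulrC.
Qed.

Lemma int_dot k t : nu.-integrable setT (EFin \o (fun x => dot (g k x) t * f k x)) /\
  \int[nu]_x (dot (g k x) t * f k x) = dot (score_mean k) t.
Proof.
have [i E] := Rint_lincomb (index_enum 'I_(S + K)) (fun i => t 0 i) measurableT (int_g k).
have dE : (fun x => dot (g k x) t * f k x) =
    (fun x => \sum_(i <- index_enum 'I_(S + K)) t 0 i * (g k x 0 i * f k x)).
  by apply/funext => x; rewrite dotE mulr_suml; apply: eq_bigr => j _; ring.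
rewrite dE E; split => //; rewrite dotE; apply: eq_bigr => j _.
by rewrite mxE mulrC.
Qed.

Lemma int_dot2 k t : nu.-integrable setT (EFin \o (fun x => dot (g k x) t ^+ 2 * f k x)) /\
  \int[nu]_x (dot (g k x) t ^+ 2 * f k x) = dot (t *m second_moment k) t.
Proof.
have I j := Rint_lincomb (index_enum 'I_(S + K)) (fun i => t 0 i) measurableT (int_gg k ^~ j).
have [i E] := Rint_lincomb (index_enum 'I_(S + K)) (fun j => t 0 j) measurableT (fun j => (I j).1).
have dE : (fun x => dot (g k x) t ^+ 2 * f k x) =
    (fun x => \sum_(j <- index_enum 'I_(S + K)) t 0 j *
      \sum_(i <- index_enum 'I_(S + K)) t 0 i * (g k x 0 i * g k x 0 j * f k x)).
  apply/funext => x; rewrite dotE expr2 big_distrlr exchange_big mulr_suml /=.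
  apply: eq_bigr => j _; rewrite mulr_sumr mulr_suml; apply: eq_bigr => l _.
  by ring.
rewrite dE E; split => //; rewrite dotE; apply: eq_bigr => j _.
rewrite (I j).2 mulrC; congr (_ * _).
by rewrite mxE; apply: eq_bigr => l _; rewrite mxE.
Qed.

(** Puts the projected score of group [k], centred at its own mean, in the form required by the
    central limit theorem, with its variance as a quadratic form. *)
Lemma int_centered k t :
  [/\ nu.-integrable setT (EFin \o (fun x => dot (g k x - score_mean k) t * f k x)),
   nu.-integrable setT (EFin \o (fun x => dot (g k x - score_mean k) t ^+ 2 * f k x)),
   \int[nu]_x (dot (g k x - score_mean k) t * f k x) = 0 &
   \int[nu]_x (dot (g k x - score_mean k) t ^+ 2 * f k x) =
     dot (t *m (second_moment k - (score_mean k)^T *m score_mean k)) t].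
Proof.
set m := score_mean k; have [i1 E1] := int_dot k t; have [i2 E2] := int_dot2 k t.
have e1 : (fun x => dot (g k x - m) t * f k x) =
    (fun x => dot (g k x) t * f k x - dot m t * f k x).
  by apply/funext => x; rewrite dotDl dotNl mulrBl.
have e2 : (fun x => dot (g k x - m) t ^+ 2 * f k x) =
    (fun x => dot (g k x) t ^+ 2 * f k x +
      (dot m t ^+ 2 * f k x - (2 * dot m t) * (dot (g k x) t * f k x))).
  by apply/funext => x; rewrite dotDl dotNl; ring.
have j1 (a : R) : nu.-integrable setT (EFin \o (fun x => a * f k x)).
  exact: (integrableZl measurableT _ (intf k)).
have j2 (a : R) : nu.-integrable setT (EFin \o (fun x => a * (dot (g k x) t * f k x))).
  exact: (integrableZl measurableT _ i1).
have j3 := integrableB measurableT (j1 (dot m t ^+ 2)) (j2 (2 * dot m t)).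
split.
- by rewrite e1; exact: (integrableB measurableT i1 (j1 _)).
- by rewrite e2; exact: (integrableD measurableT i2 j3).
- rewrite e1 (RintegralB measurableT i1 (j1 _)) E1 (RintegralZl _ measurableT (intf k)) f1 mulr1.
  by rewrite subrr.
- rewrite e2 (RintegralD measurableT i2 j3) E2 (RintegralB measurableT (j1 _) (j2 _)).
  rewrite (RintegralZl _ measurableT (intf k)) (RintegralZl _ measurableT i1) f1 E1 -/m.
  have -> : dot (t *m (second_moment k - m^T *m m)) t =
      dot (t *m second_moment k) t - dot m t ^+ 2.
    rewrite mulmxBr dotDl dotNl; congr (_ - _).
    rewrite mulmxA [t *m m^T]mx11_scalar mul_scalar_mx dotZl -/(dot t m) dotC expr2.
    by [].
  ring.
Qed.

Lemma score_cov_form t : dot (t *m score_cov) t =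
  \sum_k r k * \int[nu]_x (dot (g k x - score_mean k) t ^+ 2 * f k x).
Proof.
rewrite mulmx_sumr /dot mulmx_suml summxE; apply: eq_bigr => k _.
have [_ _ _ ->] := int_centered k t.
by rewrite -scalemxAr -scalemxAl mxE.
Qed.

Lemma score_cov_psd : psd score_cov.
Proof.
move=> t; rewrite score_cov_form; apply: sumr_ge0 => k _; rewrite mulr_ge0 ?(ltW (r0 k))//.
by apply: Rintegral_ge0 => x _; rewrite mulr_ge0 ?sqr_ge0.
Qed.

End information.

(** * Slutsky's argument *)

Lemma mulmx_norm_le {R : realType} {q : nat} (u : 'rV[R]_q) (M : 'M[R]_q) :
  `|u *m M| <= q%:R * `|u| * `|M|.
Proof.
apply: mx_norm_le => [|i j]; first by rewrite !mulr_ge0.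
rewrite mxE (le_trans (ler_norm_sum _ _ _))//.
rewrite (@le_trans _ _ (\sum_(k < q) `|u| * `|M|))//.
  by apply: ler_sum => k _; rewrite normrM ler_pM//; exact: mx_coord_le.
by rewrite sumr_const card_ord -[leLHS]mulr_natl mulrA.
Qed.

Lemma dot_norm_le {R : realType} {q : nat} (u t : 'rV[R]_q) :
  `|dot u t| <= q%:R * `|u| * `|t|.
Proof.
rewrite dotE (le_trans (ler_norm_sum _ _ _))//.
rewrite (@le_trans _ _ (\sum_(k < q) `|u| * `|t|))//.
  by apply: ler_sum => k _; rewrite normrM ler_pM//; exact: mx_coord_le.
by rewrite sumr_const card_ord -[leLHS]mulr_natl mulrA.
Qed.

Lemma cos_lip {R : realType} (a b : R) : `|cos a - cos b| <= `|a - b|.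
Proof.
have E (m h : R) : cos (m + h) - cos (m - h) = - 2 * (sin m * sin h).
  by rewrite cosB cosD; ring.
have -> : cos a - cos b = cos ((a + b) / 2 + (a - b) / 2) - cos ((a + b) / 2 - (a - b) / 2).
  by congr (cos _ - cos _); field.
rewrite E normrM normrN [`|2|]ger0_norm// normrM.
have := norm_sin_le ((a - b) / 2); rewrite normrM [`|2^-1|]ger0_norm ?invr_ge0//.
have : `|sin ((a + b) / 2)| <= 1 by rewrite ler_norml sin_le1 sin_geN1.
have := normr_ge0 (sin ((a + b) / 2)); have := normr_ge0 (sin ((a - b) / 2)).
move: (`|sin ((a + b) / 2)|) (`|sin _|) (`|a - b|) => x y z; nra.
Qed.

Section slutsky.
Context {R : realType} {q : nat} {d : measure_display} {T : measurableType d}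
  (P : probability T R).

Lemma cvg_in_dist_cf (Z : nat -> T -> 'rV[R]_q) (V : 'M[R]_q) : (forall n, mcoord (Z n)) ->
  V^T = V -> psd V ->
  (forall t c, (fun n => \int[P]_w cos (dot (Z n w) t + c)) @ \oo -->
     expR (- dot (t *m V) t / 2) * cos c) ->
  cvg_in_dist_normal P Z V.
Proof.
move=> mZ symV psdV cfZ.
have [|dW [TW [PW [W [mW cfW]]]]] := @gauss_exists R q q V symV psdV.
  by move=> i j; rewrite leqNgt ltn_ord.
exists dW, TW, PW, W; split; [exact: mW|exact: cf_gaussian_vector|].
move=> g cg [M gM].
have L := levy_continuity mZ mW (fun t c => eq_rect_r (fun z => _ --> z) (cfZ t c) (cfW t c)) cg gM.
have E (d' : measure_display) (T' : measurableType d') (P' : probability T' R)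
    (Z' : T' -> 'rV[R]_q) : mcoord Z' ->
    (\int[P']_w (g (Z' w))%:E)%E = (\int[P']_w g (Z' w))%:E.
  move=> mZ'; rewrite /Rintegral fineK//; apply: integrable_fin_num => //.
  by apply: (@bint _ _ _ P' _ M) => //; exact: meas_bcont mZ' cg gM.
rewrite E//; under eq_fun do rewrite E//.
apply: cvg_EFin; first exact: nearW.
exact: L.
Qed.

Lemma cf_perturb (U Z : nat -> T -> 'rV[R]_q) (B : 'M[R]_q) (phi : 'rV[R]_q -> R -> R) :
  (forall n, mcoord (U n)) -> (forall n, mcoord (Z n)) ->
  (forall t c, (fun n => \int[P]_w cos (dot (U n w) t + c)) @ \oo --> phi t c) ->
  (forall e : R, 0 < e -> forall delta : R, 0 < delta -> \forall n \near \oo,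
     exists A, [/\ measurable A, (P A <= delta%:E)%E &
       forall w, ~ A w -> `|Z n w - U n w *m B| <= e]) ->
  forall t c, (fun n => \int[P]_w cos (dot (Z n w) t + c)) @ \oo --> phi (t *m B^T) c.
Proof.
move=> mU mZ cfU close t c.
apply/cvgrPdist_le => e e0.
(* A positive Lipschitz constant of [dot _ t]. The error is split as e/2 for the limit, e/4 off the
   exceptional event and 2 * (e/8) on it. *)
pose b := q%:R * `|t| + 1.
have b0 : 0 < b by rewrite ltr_pwDr// mulr_ge0.
near=> n.
have h1 : `|phi (t *m B^T) c - \int[P]_w cos (dot (U n w) (t *m B^T) + c)| <= e / 2.
  near: n; have e2 : 0 < e / 2 by rewrite divr_gt0.
  exact: (proj1 (cvgrPdist_le _ _) (cfU (t *m B^T) c) _ e2).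
have [A [mA PA AP]] : exists A, [/\ measurable A, (P A <= (e / 8)%:E)%E &
       forall w, ~ A w -> `|Z n w - U n w *m B| <= e / 4 / b].
  by near: n; apply: close; rewrite ?divr_gt0.
have h2 := @Rint_dist _ _ _ P (fun w => cos (dot (U n w) (t *m B^T) + c))
  (fun w => cos (dot (Z n w) t + c)) 1 (e / 4) (e / 8) A
  (meas_cos_dot _ _ (mU n)) (meas_cos_dot _ _ (mZ n)) (fun w => cos_max _)
  (fun w => cos_max _) mA PA.
have {}h2 : `|\int[P]_w cos (dot (U n w) (t *m B^T) + c) - \int[P]_w cos (dot (Z n w) t + c)|
    <= e / 4 + 2 * 1 * (e / 8).
  apply: h2 => [|w Aw]; first by rewrite divr_ge0// ltW.
  rewrite (le_trans (cos_lip _ _))// opprD addrACA subrr addr0 distrC.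
  have -> : dot (U n w) (t *m B^T) = dot (U n w *m B) t by rewrite dot_tr.
  rewrite -dotNl -dotDl (le_trans (dot_norm_le _ _))//.
  rewrite mulrAC (@le_trans _ _ (b * `|Z n w - U n w *m B|))//.
    by rewrite ler_wpM2r// lerDl.
  by rewrite -ler_pdivlMl// mulrC AP.
rewrite (le_trans (ler_distD (\int[P]_w cos (dot (U n w) (t *m B^T) + c)) _ _))//.
by rewrite (le_trans (lerD h1 h2))//; lra.
Unshelve. all: by end_near.
Qed.

(** The deterministic core, in which [M] is never inverted: z - u B = - o B - z (M - I) B, and the
    last term is first absorbed to bound |z|, then estimated with that bound. *)
Lemma solve_near_linear (I B : 'M[R]_q) : B = invmx I -> I \in unitmx ->
  forall L : R, 0 <= L -> forall e : R, 0 < e -> exists2 eta : R, 0 < eta &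
  forall (u o z : 'rV[R]_q) (M : 'M[R]_q), o = u - z *m M -> `|u| <= L -> `|o| <= eta ->
    `|M - I| <= eta -> `|z - u *m B| <= e.
Proof.
move=> BE uI L L0 e e0; pose c : R := q%:R; pose b := `|B|.
have c0 : 0 <= c by []. have b0 : 0 <= b by exact: normr_ge0.
(* [k] comes from two uses of [mulmx_norm_le] on z (M - I) B. Absorption needs k eta <= 1/2 and,
   with eta <= 1, gives |z| <= 2 (c b + c L b); the total error is then [eta * D]. *)
pose k := c * c * b; have k0 : 0 <= k by rewrite !mulr_ge0.
pose D := c * b + 2 * k * (c * L * b + c * b).
have D0 : 0 <= D by rewrite addr_ge0 ?mulr_ge0 ?addr_ge0 ?mulr_ge0.
exists (Num.min 1 (Num.min (2 * k + 1)^-1 (e / (D + 1)))).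
  by rewrite !lt_min ltr01/= invr_gt0 divr_gt0// ltr_pwDr// mulr_ge0.
set eta := Num.min _ _ => u o z M oE uL oe Me.
have eta1 : eta <= 1 by rewrite ge_min lexx.
have eta2 : eta * (2 * k + 1) <= 1.
  by rewrite -ler_pdivlMr ?ltr_pwDr ?mulr_ge0// div1r !ge_min lexx !orbT.
have eta3 : eta * (D + 1) <= e by rewrite -ler_pdivlMr ?ltr_pwDr// !ge_min lexx !orbT.
have eta0 : 0 <= eta := le_trans (normr_ge0 _) oe.
have zE : z - u *m B = - (o *m B) - z *m (M - I) *m B.
  have zI : z *m I *m B = z by rewrite BE mulmxK.
  rewrite oE mulmxBl mulmxBr mulmxBl zI.
  by rewrite !opprB [RHS]addrC addrA subrK.
have oB : `|o *m B| <= c * eta * b.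
  by rewrite (le_trans (mulmx_norm_le _ _))// ler_wpM2r// ler_wpM2l.
have zB : `|z *m (M - I) *m B| <= k * eta * `|z|.
  rewrite (le_trans (mulmx_norm_le _ _))//.
  rewrite (_ : k * eta * `|z| = c * (c * `|z| * eta) * b); last by rewrite /k; ring.
  rewrite ler_wpM2r// ler_wpM2l// (le_trans (mulmx_norm_le _ _))//.
  by rewrite ler_wpM2l// mulr_ge0.
have uB : `|u *m B| <= c * L * b.
  by rewrite (le_trans (mulmx_norm_le _ _))// ler_wpM2r// ler_wpM2l.
have zu : `|z - u *m B| <= c * eta * b + k * eta * `|z|.
  by rewrite zE (le_trans (ler_normB _ _))// normrN lerD.
have z1 : `|z| <= `|z - u *m B| + `|u *m B| by rewrite -{1}(subrK (u *m B) z) ler_normD.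
have z0 := normr_ge0 z.
move: zu z1 z0 uB; move: (`|z|) (`|z - u *m B|) (`|u *m B|) => x y v yx xy x0 vL.
have kx : k * eta * x <= x / 2.
  have : 2 * (k * eta) <= 1 by nra.
  nra.
have x2 : x <= 2 * (c * b + c * L * b).
  have : c * eta * b <= c * b by rewrite ler_wpM2r// ler_piMr.
  lra.
have : k * eta * x <= k * eta * (2 * (c * b + c * L * b)) by rewrite ler_wpM2l ?mulr_ge0.
rewrite /D in eta3; nra.
Qed.

(** Outside three events of probability at most delta/3 each, [U] is bounded by [L], [o] is small
    and [M] is close to [I], so [solve_near_linear] places [Z] near [U *m invmx I]. Symmetry of
    [invmx I] matches the covariances. *)
Lemma asymptotic_normality (U o Z : nat -> T -> 'rV[R]_q) (M : nat -> T -> 'M[R]_q)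
    (I V : 'M[R]_q) :
  (forall n, mcoord (U n)) -> (forall n, mcoord (Z n)) ->
  I^T = I -> I \in unitmx -> V^T = V -> psd V ->
  (forall t c, (fun n => \int[P]_w cos (dot (U n w) t + c)) @ \oo -->
     expR (- dot (t *m V) t / 2) * cos c) ->
  cvg_in_prob P o 0 -> cvg_in_prob P M I ->
  (forall n w, o n w = U n w - Z n w *m M n w) ->
  cvg_in_dist_normal P Z (invmx I *m V *m invmx I).
Proof.
move=> mU mZ symI uI symV psdV cfU o0 MI oE.
have symB : (invmx I)^T = invmx I by rewrite trmx_inv symI.
have formE t : dot (t *m (invmx I *m V *m invmx I)) t =
    dot ((t *m invmx I) *m V) (t *m invmx I).
  by rewrite !mulmxA dot_tr symB.
apply: cvg_in_dist_cf => //.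
- by rewrite !trmx_mul symB symV mulmxA.
- by move=> t; rewrite formE.
move=> t c; rewrite formE -{1 2}symB.
apply: (@cf_perturb U Z (invmx I) (fun t c => expR (- dot (t *m V) t / 2) * cos c)) => //.
move=> e e0 delta delta0.
(* [tight_vec] takes its limit transforms from an actual random vector, so one with covariance [V]
   is supplied. *)
have [|dW [TW [PW [W [mW cfW]]]]] := @gauss_exists R q q V symV psdV.
  by move=> i j; rewrite leqNgt ltn_ord.
have cfUW t' c' : (fun n => \int[P]_w cos (dot (U n w) t' + c')) @ \oo -->
    \int[PW]_w cos (dot (W w) t' + c') by rewrite cfW; exact: cfU.
have d3 : 0 < delta / 3 by rewrite divr_gt0.
have [L L0 UL] := tight_vec mU mW cfUW d3.
have [eta eta0 H] := solve_near_linear erefl uI (ltW L0) e0.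
near=> n.
have [A1 [mA1 PA1 hA1]] : exists A, [/\ measurable A, (P A <= (delta / 3)%:E)%E &
    forall w, ~ A w -> `|U n w| <= L] by near: n.
have [A2 [mA2 PA2 hA2]] : exists A, [/\ measurable A, (P A <= (delta / 3)%:E)%E &
    [set w | eta <= `|o n w - 0| ] `<=` A] by near: n; exact: o0.
have [A3 [mA3 PA3 hA3]] : exists A, [/\ measurable A, (P A <= (delta / 3)%:E)%E &
    [set w | eta <= `|M n w - I| ] `<=` A] by near: n; exact: MI.
exists (A1 `|` A2 `|` A3); split.
- by do 2?apply: measurableU.
- rewrite (le_trans (measureU2 _ _ _))//; first exact: measurableU.
  rewrite (_ : delta = delta / 3 + delta / 3 + delta / 3); last by field.
  rewrite EFinD leeD// EFinD (le_trans (measureU2 _ _ _))// leeD//.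
- move=> w /not_orP[/not_orP[nA1 nA2] nA3]; apply: (H _ _ _ _ (oE n w)).
  + exact: hA1.
  + by rewrite leNgt; apply/negP => h; apply/nA2/hA2; rewrite /= subr0 ltW.
  + by rewrite leNgt; apply/negP => h; apply/nA3/hA3; rewrite /= ltW.
Unshelve. all: by end_near.
Qed.

End slutsky.

(** A test direction for the first block is a direction of the whole space completed by zeros, and
    continuous test functions compose with the projection. *)
Lemma cvg_in_dist_lsub {R : realType} {d : measure_display} {T : measurableType d}
    (P : probability T R) {S K : nat} (Z : nat -> T -> 'rV[R]_(S + K)) (V : 'M[R]_(S + K)) :
  cvg_in_dist_normal P Z V -> cvg_in_dist_normal P (fun n w => lsubmx (Z n w)) (ulsubmx V).
Proof.
move=> [dW [TW [PW [W [mW gW cW]]]]].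
exists dW, TW, PW, (fun w => lsubmx (W w)); split.
- move=> i; rewrite (_ : (fun w => _) = (fun w => W w 0 (lshift K i)))//.
  by apply/funext => w; rewrite mxE.
- move=> t B mB.
  have E (u : 'rV[R]_(S + K)) : u *m (row_mx t (0 : 'rV[R]_K))^T = lsubmx u *m t^T.
    by rewrite -{1}[u]hsubmxK tr_row_mx mul_row_col trmx0 mulmx0 addr0.
  have := gW (row_mx t 0) B mB; rewrite E.
  have -> : lsubmx (row_mx t 0 *m V) = t *m ulsubmx V.
    by rewrite -{1}[V]submxK mul_row_block mul0mx addr0 row_mxKl.
  by move=> <-; congr (PW _); apply/seteqP; split => w /=; rewrite E.
- move=> g cg [M gM].
  apply: (cW (fun v => g (lsubmx v))); last by exists M.
  by move=> v; apply: continuous_comp; [exact: lsub_continuous|exact: cg].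
Qed.

(** * The association model *)

Lemma posdef_unitmx {R : realType} {q : nat} (A : 'M[R]_q) : posdef A -> A \in unitmx.
Proof.
move=> posA; rewrite -row_free_unit -kermx_eq0; apply/eqP/row_matrixP => i.
rewrite row0; apply/eqP; apply/negP => /negP v0.
have := posA _ v0; rewrite -row_mul mulmx_ker row0 mul0mx mxE ltxx.
by [].
Qed.

Lemma grad_sum {R : realType} {q : nat} (I : Type) (s : seq I) (f : I -> 'rV[R]_q -> R) v :
  (forall i, C1 (f i)) -> grad (fun v => \sum_(i <- s) f i v) v = \sum_(i <- s) grad (f i) v.
Proof.
move=> Cf; apply/rowP => j; rewrite mxE (C1_sum s Cf).2 summxE.
by apply: eq_bigr => i _; rewrite mxE.
Qed.

Lemma strict_mono_le (N : nat -> nat) : (forall m, (N m < N m.+1)%N) -> forall m, (m <= N m)%N.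
Proof. by move=> hN; elim=> // m IH; exact: leq_ltn_trans IH (hN m). Qed.

Section measurability.
Context {R : realType} {d : measure_display} {TX : measurableType d} {TY : Type} {S K : nat}.
Variables (psi : 'rV[R]_S -> TX -> TY -> R) (y : 'I_K.+1 -> TY).
Hypotheses (mpsi : forall th k, measurable_fun setT (fun x => psi th x (y k)))
  (psi2 : forall x k, C2 (fun th => psi th x (y k))).
Local Notation lp := (logpstar psi y).

Lemma meas_logpstar k lam : measurable_fun setT (fun x => lp k x lam).
Proof.
have ml j : measurable_fun setT (fun x => expR (logit psi y j x lam)).
  by apply: measurableT_comp => //; apply: measurable_funD.
rewrite (_ : (fun x => _) = (fun x => logit psi y k x lam + -1 * ln (normalizer psi y x lam))).
  apply: measurable_funD; first exact: measurable_funD.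
  apply: measurable_funM => //; apply: measurableT_comp => //.
  exact: measurable_sum.
by apply/funext => x; rewrite logpstarE.
Qed.

Lemma meas_grad k lam i : measurable_fun setT (fun x => grad (lp k x) lam 0 i).
Proof.
rewrite (_ : (fun x => _) = (fun x => pderiv i (lp k x) lam)).
  apply: meas_pderiv => [v|x]; first exact: meas_logpstar.
  by have [[[_ /(_ i)[D _]] _] _] := C2_logpstar psi2 k x.
by apply/funext => x; rewrite mxE.
Qed.

Lemma meas_hess k lam i j : measurable_fun setT (fun x => hess (lp k x) lam i j).
Proof.
rewrite (_ : (fun x => _) = (fun x => pderiv i (pderiv j (lp k x)) lam)).
  apply: meas_pderiv => [v|x].
    have := meas_grad k v j; rewrite (_ : (fun x => _) = (fun x => pderiv j (lp k x) v))//.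
    by apply/funext => x; rewrite mxE.
  by have [[_ /(_ j)[_ /(_ i)[D _]]] _] := C2_logpstar psi2 k x.
by apply/funext => x; rewrite mxE.
Qed.

End measurability.

Lemma pstar_posterior {R : realType} {TX TY : Type} {S K : nat}
    (psi : 'rV[R]_S -> TX -> TY -> R) (y : 'I_K.+1 -> TY) (th0 : 'rV[R]_S) (beta : TX -> R)
    (eps r : 'I_K.+1 -> R) (x : TX) (k : 'I_K.+1) :
  (forall k, 0 < r k) ->
  let f k := expR (beta x + psi th0 x (y k) - eps k) in
  let lam0 := row_mx th0 (\row_(j < K) (ln (r (lift ord0 j)) - eps (lift ord0 j)
                              - ln (r ord0) + eps ord0)) in
  r k * f k = (\sum_l r l * f l) * pstar psi y k x lam0.
Proof.
(* [c] is the ratio, independent of the class, between the unnormalised weights of [pstar] at [lam0]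
   and the products r_l f_l; it cancels in the quotient. *)
move=> r0 f lam0; pose c := expR (eps ord0 - beta x) / r ord0.
have gE l : gam lam0 l = ln (r l) - eps l - ln (r ord0) + eps ord0.
  rewrite /gam; case: unliftP => [j ->|->]; first by rewrite row_mxKr mxE.
  by ring.
have lE l : expR (gam lam0 l + psi (lsubmx lam0) x (y l)) = c * (r l * f l).
  rewrite row_mxKl gE /c /f -[in RHS](lnK (r0 l)) -[in RHS](lnK (r0 ord0)) -expRN -!expRD.
  by congr expR; ring.
have h0 : \sum_l r l * f l != 0.
  rewrite gt_eqF// big_ord_recl ltr_pwDl ?mulr_gt0 ?expR_gt0//.
  by apply: sumr_ge0 => l _; rewrite mulr_ge0 ?expR_ge0// ltW.
have c0 : c != 0 by rewrite gt_eqF// divr_gt0// expR_gt0.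
rewrite /pstar lE; under [X in _ * (_ / X)]eq_bigr do rewrite lE.
rewrite -mulr_sumr; field.
by rewrite c0 h0.
Qed.

Theorem theorem5
  (R : realType)
  (* Omega_X with sigma-finite measure nu_X *)
  (dX : measure_display) (TX : measurableType dX)
  (nu : {measure set TX -> \bar R}) (hnu : sigma_finite setT nu)
  (* Omega_Y and distinct points y_0, ..., y_K *)
  (dY : measure_display) (TY : measurableType dY)
  (K : nat) (hK : (1 <= K)%N) (y : 'I_K.+1 -> TY) (hy : injective y)
  (* parameter dimension S and log-odds-ratio functions psi_theta(x, y) *)
  (S : nat) (hS : (1 <= S)%N)
  (psi : 'rV[R]_S -> TX -> TY -> R)
  (hpsim : forall (th : 'rV[R]_S) (k : 'I_K.+1), measurable_fun setT (fun x => psi th x (y k)))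
  (hpsi0 : forall (th : 'rV[R]_S) (x : TX), psi th x (y ord0) = 0)
  (hpsiC3 : forall (x : TX) (k : 'I_K.+1), C3 (fun th => psi th x (y k)))
  (* true parameter and the densities f_k *)
  (th0 : 'rV[R]_S) (beta : TX -> R) (hbeta : measurable_fun setT beta)
  (eps : 'I_K.+1 -> R)
  (hf : forall k : 'I_K.+1,
      (\int[nu]_x (expR (beta x + psi th0 x (y k) - eps k))%:E = 1)%E)
  (* sampling proportions *)
  (rbar : 'I_K.+1 -> R) (hr : forall k, 0 < rbar k) (hr1 : \sum_(k < K.+1) rbar k = 1) :
  let f := fun (k : 'I_K.+1) (x : TX) => expR (beta x + psi th0 x (y k) - eps k) in
  let lam0 : 'rV[R]_(S + K) :=
    row_mx th0 (\row_(j < K) (ln (rbar (lift ord0 j)) - eps (lift ord0 j)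
                              - ln (rbar ord0) + eps ord0)) in
  let lp := fun (k : 'I_K.+1) (x : TX) => logpstar psi y k x in
  let Ibar := fun lam : 'rV[R]_(S + K) =>
    \sum_(k < K.+1) rbar k *:
      (\matrix_(i, j) Rintegral nu setT (fun x => - hess (lp k x) lam i j * f k x)
        : 'M[R]_(S + K)) in
  let Sigbar := fun lam : 'rV[R]_(S + K) =>
    \sum_(k < K.+1) rbar k *:
      ((\matrix_(i, j) Rintegral nu setT
           (fun x => grad (lp k x) lam 0 i * grad (lp k x) lam 0 j * f k x)
         : 'M[R]_(S + K))
       - (\row_i Rintegral nu setT (fun x => grad (lp k x) lam 0 i * f k x)
            : 'rV[R]_(S + K))^T
         *m (\row_i Rintegral nu setT (fun x => grad (lp k x) lam 0 i * f k x))) in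
  forall
  (* the sampling scheme *)
  (dO : measure_display) (TO : measurableType dO) (P : probability TO R)
  (X : 'I_K.+1 -> nat -> TO -> TX)
  (hXm : forall k i, measurable_fun setT (X k i))
  (hXlaw : forall k i (A : set TX), measurable A ->
      P (X k i @^-1` A) = (\int[nu]_(x in A) (f k x)%:E)%E)
  (hXind : mutually_independent P (fun ki : 'I_K.+1 * nat => X ki.1 ki.2))
  (N : nat -> nat) (hN : forall m, (N m < N m.+1)%N)
  (nk : 'I_K.+1 -> nat -> nat) (hnk : forall k m, (nk k m)%:R = rbar k * (N m)%:R)
  (* the estimators *)
  (lamhat : nat -> TO -> 'rV[R]_(S + K))
  (hlamhat : forall m i, measurable_fun setT (fun w => lamhat m w 0 i)),
  let ell := fun (m : nat) (w : TO) (lam : 'rV[R]_(S + K)) =>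
    \sum_(k < K.+1) \sum_(i < nk k m) lp k (X k i w) lam in
  let J := fun (m : nat) (w : TO) (lam : 'rV[R]_(S + K)) => - hess (ell m w) lam in
  posdef (Ibar lam0) ->
  (forall k, nu.-integrable setT (fun x => (`|grad (lp k x) lam0| ^+ 2 * f k x)%:E)) ->
  (forall k, nu.-integrable setT (fun x => (`|hess (lp k x) lam0| * f k x)%:E)) ->
  (* (N1) *)
  cvg_in_prob P (fun m w => (Num.sqrt (N m)%:R)^-1 *: grad (ell m w) (lamhat m w)) 0 ->
  (* (N2) *)
  cvg_in_prob P lamhat lam0 ->
  (* (N3) *)
  cvg_in_prob P
    (fun m w => ((N m)%:R)^-1 *:
       (\matrix_(i, j) Rintegral lebesgue_measure `[0, 1]
          (fun t => J m w (lam0 + t *: (lamhat m w - lam0)) i j) : 'M[R]_(S + K)))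
    (Ibar lam0) ->
  (* (a) *)
  cvg_in_dist_normal P (fun m w => Num.sqrt (N m)%:R *: (lamhat m w - lam0))
    (invmx (Ibar lam0) *m Sigbar lam0 *m invmx (Ibar lam0))
  /\
  (* (b) *)
  cvg_in_dist_normal P (fun m w => Num.sqrt (N m)%:R *: (lsubmx (lamhat m w) - th0))
    (ulsubmx (invmx (Ibar lam0))).
Proof.
move=> f lam0 lp Ibar Sigbar dO TO P X hXm hXlaw hXind N hN nk hnk lamhat hlamhat ell J.
move=> posI intg inth N1 _ N3.
have psi2 x k : C2 (fun th => psi th x (y k)) := C3_C2 (hpsiC3 x k).
pose g k x := grad (lp k x) lam0; pose H k x := hess (lp k x) lam0.
have C2lp k x : C2 (lp k x) := (C2_logpstar psi2 k x).1.
have mf k : measurable_fun setT (f k).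
  apply: measurableT_comp => //; apply: measurable_funB => //; exact: measurable_funD.
have f0 k x : 0 <= f k x by exact: expR_ge0.
have intf k : nu.-integrable setT (EFin \o f k).
  apply/integrableP; split; first exact/measurable_EFinP.
  under eq_integral do rewrite /= ger0_norm//.
  by rewrite hf ltry.
have f1 k : \int[nu]_x f k x = 1 by rewrite /Rintegral hf.
have mg k i : measurable_fun setT (fun x => g k x 0 i) := meas_grad hpsim psi2 k lam0 i.
have mH k i j : measurable_fun setT (fun x => H k x i j) := meas_hess hpsim psi2 k lam0 i j.
have post k x := pstar_posterior psi y th0 beta eps x k hr.
have s0 x i : \sum_k pstar psi y k x lam0 * g k x 0 i = 0.
  by rewrite -[RHS](bartlett1 psi2 x lam0 i); apply: eq_bigr => k _; rewrite mxE.
have s2 x i j := bartlett2 psi2 x lam0 i j.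
have sK k x j : g k x 0 (rshift S j) = (k == lift ord0 j)%:R - pstar psi y (lift ord0 j) x lam0.
  by rewrite mxE (C2_logpstar psi2 k x).2.
have IE : Ibar lam0 = info nu f H rbar by [].
have SE : Sigbar lam0 = score_cov nu f g rbar by [].
have uI : Ibar lam0 \in unitmx by exact: posdef_unitmx.
have symI : (Ibar lam0)^T = Ibar lam0 by exact: (info_sym mf mg mH post intg inth s2).
have symS : (Sigbar lam0)^T = Sigbar lam0 by exact: score_cov_sym.
have psdS : psd (Sigbar lam0) by exact: (score_cov_psd mf mg f0 intf f1 hr intg).
have m0 := score_mean_sum0 mf mg intf post intg s0.
have C2ell m w : C2 (ell m w).
  by apply: C2_sum => k; apply: C2_sum => i; exact: C2lp.
have gell m w lam : grad (ell m w) lam = \sum_(k < K.+1) \sum_(i < nk k m) grad (lp k (X k i w)) lam.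
  rewrite grad_sum => [|k]; last by apply: (C2_sum _ _).1 => i; exact: C2lp.
  by apply: eq_bigr => k _; rewrite grad_sum// => i; exact: (C2lp _ _).1.
pose rN m : R := Num.sqrt (N m)%:R.
pose U m w := (rN m)^-1 *: grad (ell m w) lam0.
pose Z m w := rN m *: (lamhat m w - lam0).
have mU m : mcoord (U m).
  move=> i; rewrite (_ : (fun w => _) = (fun w => (rN m)^-1 *
      \sum_(k < K.+1) \sum_(l < nk k m) g k (X k l w) 0 i)).
    apply: measurable_funM => //; apply: measurable_sum => k; apply: measurable_sum => l.
    exact: (measurableT_comp (mg k i) (hXm k l)).
  apply/funext => w; rewrite mxE gell summxE; congr (_ * _).
  by apply: eq_bigr => k _; rewrite summxE.
have mZ m : mcoord (Z m).
  move=> i; rewrite (_ : (fun w => _) = (fun w => rN m * (lamhat m w 0 i - lam0 0 i))).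
    by apply: measurable_funM => //; exact: measurable_funB.
  by apply/funext => w; rewrite !mxE.
have cfU t c : (fun m => \int[P]_w cos (dot (U m w) t + c)) @ \oo -->
    expR (- dot (t *m Sigbar lam0) t / 2) * cos c.
  (* The law of the first observation of each group, packed as a probability; by [hXlaw] it is
     shared by the whole group and has density [f k]. *)
  pose X0 k : {RV P >-> TX} := HB.pack (X k 0%N)
    (isMeasurableFun.Build _ _ _ _ (X k 0%N) (hXm k 0%N)).
  pose m k : probability TX R := distribution P (X0 k).
  have mE k i A : measurable A -> P (X k i @^-1` A) = m k A.
    by move=> mA; rewrite hXlaw// -(hXlaw k 0%N).
  have dens k A : measurable A -> m k A = (\int[nu]_(x in A) (f k x)%:E)%E.
    by move=> mA; rewrite -(mE k 0%N)// hXlaw.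
  pose z k x := dot (g k x - score_mean nu f g k) t.
  have mz k : measurable_fun setT (z k).
    apply: (@meas_dot R dX TX (S + K) (fun x => g k x - score_mean nu f g k)) => i.
    rewrite (_ : (fun x => _) = (fun x => g k x 0 i - score_mean nu f g k 0 i)).
      exact: measurable_funB.
    by apply/funext => x; rewrite !mxE.
  have zP k := int_centered mf mg intf f1 intg k t.
  have [z1 z2] : (forall k, \int[m k]_x z k x = 0) /\
      forall k, (m k).-integrable setT (EFin \o (fun x => z k x ^+ 2)) /\
        \int[m k]_x z k x ^+ 2 = \int[nu]_x (z k x ^+ 2 * f k x).
    split=> k; have [i1 i2 i3 _] := zP k.
      by rewrite (int_density (mf k) (f0 k) (dens k) (mz k) i1).2.
    by apply: (int_density (mf k) (f0 k) (dens k)) => //; exact: measurable_funX.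
  have NN : forall l, (l <= N l)%N by exact: strict_mono_le.
  have := @clt_cf R dO dX TO TX P _ X m hXm hXind mE rbar N nk NN hnk z mz (fun k => (z2 k).1) z1 c.
  rewrite SE (score_cov_form rbar mf mg intf f1 intg t).
  under eq_bigr do rewrite (z2 _).2.
  rewrite (_ : (fun l => _) = (fun m => \int[P]_w cos (dot (U m w) t + c)))//.
  apply/funext => l; apply: eq_Rintegral => w _; congr (cos (_ + _)).
  rewrite dotZl; congr (_ * _); rewrite gell /dot mulmx_suml summxE.
  (* Because the group sizes are exactly rbar k * N, the centring terms add up to N times the
     weighted sum of group means, which is 0. *)
  have c0 : \sum_(k < K.+1) \sum_(i < nk k l) dot (score_mean nu f g k) t = 0.
    under eq_bigr => k _ do rewrite sumr_const card_ord -[_ *+ _]mulr_natl hnk mulrAC -dotZl.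
    rewrite -mulr_suml /dot -summxE -mulmx_suml m0 mul0mx mxE mul0r.
    by [].
  rewrite -[RHS]subr0 -[X in _ = _ - X]c0.
  rewrite -sumrB; apply: eq_bigr => k _; rewrite mulmx_suml summxE -sumrB.
  by apply: eq_bigr => i _; rewrite /z dotDl dotNl.
have main : cvg_in_dist_normal P Z (invmx (Ibar lam0) *m Sigbar lam0 *m invmx (Ibar lam0)).
  apply: (asymptotic_normality mU mZ symI uI symS psdS cfU N1 N3) => m w.
  rewrite (grad_taylor lam0 (lamhat m w) (C2ell m w)) scalerBr; congr (_ - _).
  rewrite -scalemxAl -scalemxAr scalerA; congr (_ *: _).
  rewrite -[X in _ / X](sqr_sqrtr (ler0n R (N m))) expr2 invfM mulrA -/(rN m).
  (* [N 0] may be 0; both sides are then 0, as the inverse of 0 is 0. *)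
  by have [->|?] := eqVneq (rN m) 0; [rewrite invr0 mulr0|rewrite divff// mul1r].
split; first exact: main.
have := cvg_in_dist_lsub main.
rewrite (score_cov_sandwich mf mg mH intf hr post intg inth s0 s2 sK uI).
rewrite (_ : (fun m w => lsubmx (Z m w)) =
  (fun m w => Num.sqrt (N m)%:R *: (lsubmx (lamhat m w) - th0)))//.
apply/funext => m; apply/funext => w; apply/rowP => i; rewrite !mxE.
by rewrite (unsplitK (inl i)).
Qed.
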